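(* Let $(W,S)$ be a finite Coxeter system of rank $n$, $c=s_1\cdots s_n$ a standard Coxeter element, $k$ a field, $\mathcal{A}=k[\mathbf{D}(W)]$ the dual braid monoid algebra, and fix a $c$-compatible reflection ordering $\prec$ on $T$. For $0\le j\le n-1$ define the left $\mathcal{A}$-module maps $\partial_j:\mathcal{A}\otimes k^{\Delta^+_j}\to \mathcal{A}\otimes k^{\Delta^+_{j-1}}$ by \[\partial_j(\mathbf{b}\otimes f)=\sum_{i=0}^{j}(-1)^i\,(\mathbf{b}\cdot \mathbf{t}_i^{\mathbf{t}_{i-1},\dots,\mathbf{t}_0})\otimes (f\setminus\{t_i\}),\] for $\mathbf{b}\in\mathbf{D}(W)$ and $f=\{t_0\succ t_1\succ\dots\succ t_j\}\in\Delta^+_j$, where $\mathbf{t}_i^{\mathbf{t}_{i-1},\dots,\mathbf{t}_0}$ denotes the generator of $\mathbf{D}(W)$ corresponding to the reflection $t_0t_1\cdots t_{i-1}t_it_{i-1}\cdots t_1t_0$. Identify $\mathcal{A}\otimes k^{\Delta^+_{-1}}$ with $\mathcal{A}$ and let $\epsilon:\mathcal{A}\to k$ be the augmentation (projection onto the degree $0$ component). Then \[0\to \mathcal{A}\otimes k^{\Delta^+_{n-1}}\xrightarrow{\partial_{n-1}}\cdots\xrightarrow{\partial_1}\mathcal{A}\otimes k^{\Delta^+_0}\xrightarrow{\partial_0}\mathcal{A}\otimes k^{\Delta^+_{-1}}\xrightarrow{\epsilon}k\to 0\] is the minimal graded free resolution of $k$ by left $\mathcal{A}$-modules.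
   Context: $(W,S)$ is a finite Coxeter group of rank $n$ with identity $e$, realized as a reflection group in $\mathbb{R}^n$; $T=\{wsw^{-1}: s\in S,w\in W\}$ is its set of reflections, and for $t\in T$, $\rho(t)$ is the associated positive root. For $u,t\in W$ write $t^u=u^{-1}tu$. The absolute length $\ell_T(w)$ is the least $k$ such that $w$ is a product of $k$ reflections; the absolute order is $w\le_T z$ iff $\ell_T(w)+\ell_T(w^{-1}z)=\ell_T(z)$. $NC=NC(W)$ is the interval $[e,c]$ for $\le_T$ and $NC_j$ its elements of absolute length $j$. The dual braid monoid $\mathbf{D}(W)$ is the monoid with generators $\mathbf{t}$ ($t\in T$) and relations $\mathbf{t}\mathbf{u}=\mathbf{u}\mathbf{t}^{\mathbf{u}}$ whenever $tu\le_T c$, where $\mathbf{t}^{\mathbf{u}}$ is the generator corresponding to $utu$. For $w\in NC_j$ with $w=t_1\cdots t_j$ ($t_i\in T$), the element $\mathbf{w}=\mathbf{t}_1\cdots\mathbf{t}_j$ is well defined (a simple braid). A reflection ordering is a total order $\prec$ on $T$ such that for every rank 2 parabolic subgroup $P$, with its reflections indexed $u_1,\dots,u_m$ so that $u_{i+1}u_i=u_iu_{i-1}$ (indices mod $m$) and $u_1,u_m$ are the simple reflections of $P$, one has $u_1\prec\cdots\prec u_m$ or $u_m\prec\cdots\prec u_1$. It is $c$-compatible if for every $w\in NC_2$, writing $\{t\in T: t\le_T w\}=\{u_1\prec\dots\prec u_m\}$, one has $w=u_iu_{i-1}$ for all $1\le i\le m$ ($u_0=u_m$); such orderings exist. A positive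 $c$-cluster is a set $\{t_1,\dots,t_n\}$ of reflections such that $c=t_1\cdots t_n$ and $\langle\rho(t_i),\rho(t_j)\rangle\ge0$ for $i\ne j$. $\Delta^+$ is the simplicial complex whose facets are the positive $c$-clusters; $\Delta^+_i$ is its set of faces of cardinality $i+1$, with $\Delta^+_{-1}=\{\varnothing\}$. $k^X$ denotes the vector space with basis $X$. A graded free resolution is minimal if no map has a component of degree $0$. *)

(* Defs.v *)
From HB Require Import structures.
From mathcomp Require Import all_boot all_order all_algebra all_fingroup.
From mathcomp Require Import mxrepresentation.
From mathcomp Require classical_sets.
From mathcomp Require Import boolp reals.
From mathcomp Require Import finmap monalg.

Set Implicit Arguments.
Unset Strict Implicit.
Unset Printing Implicit Defensive.

Import Order.TTheory GRing.Theory Num.Theory.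

Local Open Scope group_scope.

Notation malgmod k M X := {ffun X -> {malg k[M]}^o}.

Section Resolutions.
Variables (k : fieldType) (M : monomType).
Local Open Scope ring_scope.

(** [{ffun X -> k[M]}] is k[M] ⊗ k^X as a left k[M]-module, and [tens a x] is
    the tensor a ⊗ x. *)
Definition tens (X : finType) (a : {malg k[M]}) (x : X) : malgmod k M X :=
  [ffun y => if y == x then a else 0].

Local Notation A := {malg k[M]}.

Lemma tens0 (X : finType) (x : X) : tens 0 x = 0.
Proof. by apply/ffunP => y; rewrite !ffunE if_same. Qed.

Lemma tensD (X : finType) (a b : A) (x : X) :
  tens (a + b) x = tens a x + tens b x.
Proof. by apply/ffunP => y; rewrite !ffunE; case: eqP; rewrite ?addr0. Qed.

Lemma tensZ (X : finType) (a b : A) (x : X) : tens (a * b) x = a *: tens b x.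
Proof. by apply/ffunP => y; rewrite !ffunE; case: eqP; rewrite ?scaler0. Qed.

Lemma signr_scaleC (X : finType) i (a : A) (v : malgmod k M X) :
  (-1) ^+ i *: (a *: v) = a *: ((-1) ^+ i *: v).
Proof. by rewrite !scalerA; congr (_ *: _); rewrite -(commr_sign (a : A)). Qed.

Lemma sum_tens (X : finType) (V : zmodType) (F : X -> A -> V) a x :
  (forall y, F y 0 = 0) -> \sum_y F y (tens a x y) = F x a.
Proof.
move=> F0; rewrite (bigD1 x) //= ffunE eqxx big1 ?addr0 // => y yx.
by rewrite ffunE (negPf yx).
Qed.

Lemma malgmod_linE (X : finType) a (u v : malgmod k M X) x :
  (a *: u + v) x = a * u x + v x.
Proof. by rewrite !ffunE. Qed.

Lemma sign_tens_lin (X : finType) i (a b c g : A) (x : X) :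
  (-1) ^+ i *: tens ((a * b + c) * g) x
  = a *: ((-1) ^+ i *: tens (b * g) x) + (-1) ^+ i *: tens (c * g) x.
Proof. by rewrite mulrDl -mulrA tensD tensZ scalerDr signr_scaleC. Qed.

Lemma malgUM (a b : M) : << a >> * << b >> = << mmul a b >> :> A.
Proof. by rewrite malgM_def fgmulUU mulr1. Qed.

(** As 1 is the only element of degree 0 of M, the degree 0 component of k[M]
    is k 1. *)
Definition augmentation (a : {malg k[M]}) : k := a@_(@mone M).

Variable deg : measure M.

(** The generator 1 ⊗ x has degree [wt x]. *)
Definition homogeneous (X : finType) (wt : X -> nat) (e : nat)
    (v : malgmod k M X) : Prop :=
  forall x m, m \in msupp (v x) -> (deg m + wt x = e)%N.

(** ... -> k[M] ⊗ k^(X 1) -> k[M] ⊗ k^(X 0) -> k -> 0, where X p is empty for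
    p > n; k is the k[M]-module on which k[M] acts through [augmentation],
    concentrated in degree 0. *)
Record minimal_graded_free_resolution (n : nat) (X : nat -> finType)
    (wt : forall p, X p -> nat)
    (d : forall p, {linear malgmod k M (X p.+1) -> malgmod k M (X p)})
    (eps : malgmod k M (X 0%N) -> k) : Prop := {
  res_length : forall p, (n < p)%N -> #|X p| = 0%N;
  res_eps_add : forall u v, eps (u + v) = eps u + eps v;
  res_eps_scale : forall a v, eps (a *: v) = augmentation a * eps v;
  res_eps_graded :
    forall e v, homogeneous (wt 0%N) e v -> (0 < e)%N -> eps v = 0;
  res_graded :
    forall p e v, homogeneous (wt p.+1) e v -> homogeneous (wt p) e (d p v);
  res_eps_surj : forall z : k, exists v, eps v = z;
  res_exact0 : forall v, eps v = 0 <-> exists u, d 0%N u = v;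
  res_exactS : forall p v, d p v = 0 <-> exists u, d p.+1 u = v;
  res_minimal : forall p (x : X p.+1) (y : X p),
    augmentation (d p (tens 1 x) y) = 0
}.

End Resolutions.

Section Coxeter.
(** [s] lists S in the order of the factors of the Coxeter element c. *)
Variables (n : nat) (gT : finGroupType) (s : 'I_n -> gT).
Local Notation repr := generic_quotient.repr.

Record coxeter_system : Prop := {
  cox_inj : injective s;
  cox_gen : <<[set s i | i : 'I_n]>> = [set: gT];
  cox_order2 : forall i, #[s i] = 2;
  cox_pres : forall (H : groupType) (f : 'I_n -> H),
    (forall i j, (f i * f j) ^+ #[s i * s j] = 1) ->
    exists phi : gT -> H,
      {morph phi : x y / x * y} /\ (forall i, phi (s i) = f i)
}.

Definition coxeter_elt : gT := \prod_(i < n) s i.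

Definition reflections : {set gT} :=
  [set w * s i * w^-1 | w in [set: gT], i in [set: 'I_n]].

Definition refl : Type := {t : gT | t \in reflections}.
HB.instance Definition _ := Finite.on refl.

Lemma reflections_conj t w : t \in reflections -> t ^ w \in reflections.
Proof.
case/imset2P=> x i _ _ ->; apply/imset2P; exists (w^-1 * x) i => //.
by rewrite conjgE !invMg invgK !mulgA.
Qed.

Definition rconj (t : refl) (w : gT) : refl :=
  exist _ (val t ^ w) (reflections_conj w (valP t)).

Definition prod_of_reflections (w : gT) (k : nat) : bool :=
  [exists u : k.-tuple refl, \prod_(t <- u) val t == w].

(** The default value 0 is not used when S generates W. *)
Definition abs_length (w : gT) : nat :=
  if pselect (exists k, prod_of_reflections w k) is left ex_k
  then ex_minn ex_k else 0.

Definition abs_le (w z : gT) : bool :=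
  abs_length w + abs_length (w^-1 * z) == abs_length z.

Definition NC (j : nat) : {set gT} :=
  [set w | abs_le w coxeter_elt & abs_length w == j].

(** The congruence on words in T generated by t u = u t^u for t u <=_T c. *)

Inductive braid_eq : seq refl -> seq refl -> Prop :=
| BraidRefl x : braid_eq x x
| BraidSym x y : braid_eq x y -> braid_eq y x
| BraidTrans x y z : braid_eq x y -> braid_eq y z -> braid_eq x z
| BraidStep x y t u : abs_le (val t * val u) coxeter_elt ->
    braid_eq (x ++ [:: t; u] ++ y) (x ++ [:: u; rconj t (val u)] ++ y).

Definition braid_eqb (x y : seq refl) : bool := `[< braid_eq x y >].

Lemma braid_eqb_refl : reflexive braid_eqb.
Proof. by move=> x; apply/asboolP; apply: BraidRefl. Qed.

Lemma braid_eqb_sym : symmetric braid_eqb.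
Proof. by move=> x y; apply/asboolP/asboolP => /BraidSym. Qed.

Lemma braid_eqb_trans : transitive braid_eqb.
Proof.
move=> y x z /asboolP xy /asboolP yz.
by apply/asboolP; apply: BraidTrans xy yz.
Qed.

Canonical braid_equiv :=
  EquivRel braid_eqb braid_eqb_refl braid_eqb_sym braid_eqb_trans.

Local Open Scope quotient_scope.

Definition dual_braid := {eq_quot braid_equiv}.
HB.instance Definition _ := Choice.on dual_braid.
HB.instance Definition _ := EqQuotient.on dual_braid.

Definition dbword (x : seq refl) : dual_braid := \pi x.
Definition dbone : dual_braid := dbword [::].
Definition dbmul (x y : dual_braid) : dual_braid := dbword (repr x ++ repr y).
Definition dblength (x : dual_braid) : nat := size (repr x).

Lemma dbwordP x y : dbword x = dbword y <-> braid_eq x y.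
Proof.
by split=> [/eqmodP /asboolP//|xy]; apply/eqmodP/asboolP.
Qed.

Lemma braid_eq_cat x x' y y' :
  braid_eq x x' -> braid_eq y y' -> braid_eq (x ++ y) (x' ++ y').
Proof.
move=> xx' yy'; apply: (@BraidTrans _ (x' ++ y)).
- elim: xx' y {yy'} => {x x'} [x|x x' _ IH|x x' x'' _ IH _ IH'|x x' t u tu] y.
  + exact: BraidRefl.
  + exact: BraidSym.
  + exact: BraidTrans (IH y) (IH' y).
  + by rewrite -!catA; apply: BraidStep.
- elim: yy' => {y y'} [y|y y' _ IH|y y' y'' _ IH _ IH'|y y' t u tu].
  + exact: BraidRefl.
  + exact: BraidSym.
  + exact: BraidTrans IH IH'.
  + by rewrite ![x' ++ y ++ _]catA; apply: BraidStep.
Qed.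

Lemma braid_eq_size x y : braid_eq x y -> size x = size y.
Proof.
by elim=> {x y} [//|x y _ ->//|x y z _ -> _ ->//|x y t u _]; rewrite !size_cat.
Qed.

Lemma dbword_repr x : dbword (repr x) = x.
Proof. exact: reprK. Qed.

Lemma braid_eq_repr x : braid_eq (repr (dbword x)) x.
Proof. by apply/dbwordP; rewrite dbword_repr. Qed.

Lemma dbword_cat x y : dbword (x ++ y) = dbmul (dbword x) (dbword y).
Proof.
apply/dbwordP; apply: braid_eq_cat; apply: BraidSym; exact: braid_eq_repr.
Qed.

Lemma dblength_word x : dblength (dbword x) = size x.
Proof. exact: braid_eq_size (braid_eq_repr x). Qed.

Lemma dbmulA : associative dbmul.
Proof.
move=> x y z; rewrite -[x]dbword_repr -[y]dbword_repr -[z]dbword_repr.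
by rewrite -!dbword_cat catA.
Qed.

Lemma dbmul1 : left_id dbone dbmul.
Proof. by move=> x; rewrite -[x]dbword_repr -dbword_cat. Qed.

Lemma dbmulr1 : right_id dbone dbmul.
Proof. by move=> x; rewrite -[x]dbword_repr -dbword_cat cats0. Qed.

Lemma dblength1 : dblength dbone = 0.
Proof. exact: dblength_word. Qed.

Lemma dblengthM : {morph dblength : x y / dbmul x y >-> x + y}.
Proof. by move=> x y; rewrite dblength_word size_cat. Qed.

Lemma dblength_eq0 x : dblength x = 0 -> x = dbone.
Proof. by move=> /size0nil x0; rewrite -[x]dbword_repr x0. Qed.

Lemma dbmul_eq1 x y : dbmul x y = dbone -> x = dbone /\ y = dbone.
Proof.
move=> /(congr1 dblength); rewrite dblengthM dblength1 => /eqP.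
by rewrite addn_eq0 => /andP[/eqP/dblength_eq0-> /eqP/dblength_eq0->].
Qed.

HB.instance Definition _ := Choice_isMonomialDef.Build dual_braid
  dbmulA dbmul1 dbmulr1 dbmul_eq1.
HB.instance Definition _ :=
  isMeasure.Build dual_braid dblength dblength1 dblengthM dblength_eq0.

Definition dbgen (t : refl) : dual_braid := dbword [:: t].

Section Realization.
Variable R : realType.

Definition dotp (u v : 'cV[R]_n) : R := (u^T *m v)%R 0%R 0%R.

Definition in_cone (I : finType) (A : {set I}) (x : I -> 'cV[R]_n)
    (v : 'cV[R]_n) : Prop :=
  exists2 a : I -> R,
    forall i, (0 <= a i)%R & v = (\sum_(i in A) a i *: x i)%R.

(** W acts on column vectors from the left; [alpha] is the simple system of
    unit vectors attached to S: each root w α_i is a nonnegative or a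
    nonpositive combination of the simple roots. *)
Record reflection_realization (rG : mx_representation R [set: gT] n)
    (alpha : 'I_n -> 'cV[R]_n) : Prop := {
  real_faithful : mx_faithful rG;
  real_unit : forall i, dotp (alpha i) (alpha i) = 1%R;
  real_basis : (\matrix_(i, j) alpha j i 0)%R \in unitmx;
  real_refl : forall i (x : 'cV[R]_n),
    (rG (s i) *m x = x - (2 * dotp x (alpha i)) *: alpha i)%R;
  real_roots : forall w i,
    in_cone [set: 'I_n] alpha (rG w *m alpha i)%R \/
    in_cone [set: 'I_n] alpha (- (rG w *m alpha i))%R
}.

Variables (rG : mx_representation R [set: gT] n) (alpha : 'I_n -> 'cV[R]_n).

Definition is_positive_root (t : refl) (v : 'cV[R]_n) : Prop :=
  [/\ dotp v v = 1%R,
      forall x, (rG (val t) *m x = x - (2 * dotp x v) *: v)%R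
    & in_cone [set: 'I_n] alpha v].

(** Exactly one vector satisfies [is_positive_root t] under
    [reflection_realization]. *)
Definition rho (t : refl) : 'cV[R]_n :=
  classical_sets.xget 0%R (is_positive_root t).

(** The simple roots of the positive system of a reflection subgroup P are its
    positive roots that are not nonnegative combinations of the others. *)
Definition simple_reflection (P : {set gT}) (t : refl) : Prop :=
  val t \in P /\
  ~ in_cone [set u : refl | (val u \in P) && (u != t)] rho (rho t).

Section Ordering.
Variable prec : rel refl.

Definition strict_total_order : Prop :=
  [/\ irreflexive prec, transitive prec
    & forall t u, t != u -> prec t u || prec u t].

(** [P] ranges over the conjugates of the subgroups generated by two elements
    of S, and [u] over the indexings u_1, ..., u_m (m = m'+1). *)
Definition reflection_ordering : Prop :=
  strict_total_order /\
  forall (i j : 'I_n) (w : gT), i != j ->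
  let P := <<[set s i; s j]>> :^ w in
  forall (m' : nat) (u : 'I_m'.+1 -> refl),
    injective u ->
    (forall t : refl, val t \in P <-> exists h, u h = t) ->
    (forall h, val (u (ordS h)) * val (u h)
             = val (u h) * val (u (ord_pred h))) ->
    (forall t, simple_reflection P t <-> t = u ord0 \/ t = u ord_max) ->
    (forall h l : 'I_m'.+1, h < l -> prec (u h) (u l)) \/
    (forall h l : 'I_m'.+1, h < l -> prec (u l) (u h)).

Definition c_compatible : Prop :=
  forall w, w \in NC 2 ->
  forall (m : nat) (u : 'I_m -> refl),
    (forall h l : 'I_m, h < l -> prec (u h) (u l)) ->
    (forall t : refl, abs_le (val t) w <-> exists h, u h = t) ->
    forall h, w = val (u h) * val (u (ord_pred h)).

Definition positive_cluster (F : {set refl}) : bool :=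
  [exists u : n.-tuple refl,
    [&& F == [set t in u], \prod_(t <- u) val t == coxeter_elt &
        [forall i, forall j,
          (i != j) ==> (0 <= dotp (rho (tnth u i)) (rho (tnth u j)))%R]]].

(** The empty set is a face whether or not there is a positive cluster. *)
Definition is_face (f : {set refl}) : bool :=
  (f == set0) || [exists F, positive_cluster F && (f \subset F)].

(** The faces of cardinality p, that is, of dimension p - 1. *)
Definition face (p : nat) : Type :=
  {f : {set refl} | is_face f && (#|f| == p)}.
HB.instance Definition _ p := Finite.on (face p).

Lemma face0_proof : is_face set0 && (#|@set0 refl| == 0).
Proof. by rewrite /is_face eqxx cards0. Qed.

Definition face0 : face 0 := exist _ set0 face0_proof.

(** t_0, t_1, ..., t_j with t_0 ≻ t_1 ≻ ... ≻ t_j. *)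
Definition face_seq p (f : face p) : seq refl :=
  sort (fun t u => ~~ prec t u) (enum (val f)).

Lemma face_seq_size p (f : face p) : size (face_seq f) == p.
Proof. by rewrite size_sort -cardE; case/andP: (valP f). Qed.

Definition face_vtx p (f : face p) : p.-tuple refl := Tuple (face_seq_size f).

Lemma mem_face_vtx p (f : face p) i : tnth (face_vtx f) i \in val f.
Proof. by rewrite -mem_enum -(mem_sort (fun t u => ~~ prec t u)) mem_tnth. Qed.

Lemma face_del_proof p (f : face p.+1) (i : 'I_p.+1) :
  let g := val f :\ tnth (face_vtx f) i in is_face g && (#|g| == p).
Proof.
have := mem_face_vtx f i; move: (tnth _ _) => t tf /=.
have /andP[ff /eqP cf] := valP f.
move: cf; rewrite (cardsD1 t) tf add1n => -[->]; rewrite eqxx andbT.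
case/orP: ff => [/eqP f0|/existsP[F /andP[cF fF]]]; first by rewrite f0 inE in tf.
apply/orP; right; apply/existsP; exists F.
by rewrite cF (subset_trans _ fF) // subsetDl.
Qed.

Definition face_del p (f : face p.+1) (i : 'I_p.+1) : face p :=
  exist _ (val f :\ tnth (face_vtx f) i) (face_del_proof f i).

(** The conjugate of t_i by t_(i-1) ... t_0, that is, the reflection
    t_0 ... t_(i-1) t_i t_(i-1) ... t_0. *)
Definition face_refl p (f : face p) (i : 'I_p) : refl :=
  rconj (tnth (face_vtx f) i) (\prod_(t <- rev (take i (face_vtx f))) val t).

Lemma val_face_refl p (f : face p) (i : 'I_p) : coxeter_system ->
  val (face_refl f i) =
    (\prod_(t <- take i (face_vtx f)) val t) * val (tnth (face_vtx f) i)
    * (\prod_(t <- rev (take i (face_vtx f))) val t).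
Proof.
move=> hW; rewrite /= conjgE mulgA; congr (_ * _ * _).
elim: (take _ _) => [|t x IH]; first by rewrite !big_nil invg1.
rewrite rev_cons -cats1 big_cat /= big_seq1 invMg IH big_cons; congr (_ * _).
case: t => t /= /imset2P[w j _ _ ->].
have s2 : (s j)^-1 = s j.
  apply/eqP; rewrite eq_invg_mul -expg2.
  by have := expg_order (s j); rewrite (cox_order2 hW j) => ->.
by rewrite !invMg invgK s2 mulgA.
Qed.

Variable k : fieldType.
Local Notation A := {malg k[dual_braid]}.
Local Open Scope ring_scope.

(** [boundary p] is ∂_p : A ⊗ k^(Δ^+_p) -> A ⊗ k^(Δ^+_(p-1)). *)
Definition boundary p (v : malgmod k dual_braid (face p.+1)) :
    malgmod k dual_braid (face p) :=
  \sum_(f : face p.+1) \sum_(i < p.+1)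
    (-1) ^+ i *: tens (v f * << dbgen (face_refl f i) >>) (face_del f i).

Fact boundary_is_linear p : linear (@boundary p).
Proof.
move=> a u v; rewrite /boundary scaler_sumr -big_split; apply: eq_bigr => f _.
rewrite scaler_sumr -big_split; apply: eq_bigr => i _ /=.
by rewrite malgmod_linE; apply: sign_tens_lin.
Qed.

HB.instance Definition _ p :=
  GRing.isLinear.Build A (malgmod k dual_braid (face p.+1))
    (malgmod k dual_braid (face p)) _ (@boundary p) (@boundary_is_linear p).

Lemma boundary_tens p (b : dual_braid) (f : face p.+1) :
  boundary (tens << b >> f) =
  \sum_(i < p.+1) (-1) ^+ i *:
    tens << mmul b (dbgen (face_refl f i)) >> (face_del f i).
Proof.
pose F g (a : A) := \sum_(i < p.+1) (-1) ^+ i *: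
  tens (a * << dbgen (face_refl g i) >>) (face_del g i).
have F0 g : F g 0 = 0.
  by rewrite /F big1 // => i _; rewrite mul0r tens0 scaler0.
rewrite /boundary [LHS](sum_tens << b >> f F0) /F.
by apply: eq_bigr => i _; rewrite malgUM.
Qed.

Definition epsilon (v : malgmod k dual_braid (face 0)) : k :=
  augmentation (v face0).

(** The generator 1 ⊗ f has degree |f|, so that ∂ preserves degrees. *)
Definition face_weight p (f : face p) : nat := p.

End Ordering.
End Realization.
End Coxeter.

(* Main.v *)
(* Idea.  The form E x y = 2 <x, (1 - c)^-1 y> detects factorizations of c: a
   word t_1 ... t_j is a reduced word of a noncrossing element iff
   E (ρ t_b) (ρ t_a) = 0 for all a < b.  For a c-compatible ordering the signs
   of E on pairs of positive roots are governed by ≺, which makes Δ^+ a flag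
   complex: its faces, listed decreasingly, are the decreasing reduced words of
   noncrossing elements.

   Going once around the cyclic order ±T while keeping track of the simple
   roots of a noncrossing parabolic shows that noncrossing elements have meets
   and joins.  Hence right divisors of an element of D(W) have a common
   multiple and D(W) is right cancellative.  If moreover t ≺ u and b t = b' u,
   then b has a right divisor v ≻ t for which v t is noncrossing.

   So, matching b M ⊗ f with b ⊗ (M ∪ f), where M ≻ f is as large as possible,
   leaves only 1 ⊗ ∅ unmatched.  Every chain is a boundary plus a chain
   supported on the second members of the pairs, and a cycle of the latter kind
   is 0, as its terms with smallest top vertex do not cancel in the boundary. *)

Require Import Defs.
From mathcomp Require Import all_boot all_order all_algebra all_fingroup.
From mathcomp Require Import mxrepresentation cyclic.
From mathcomp Require Import boolp reals finmap monalg.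
From mathcomp Require Import ring lra zify.

Set Implicit Arguments.
Unset Strict Implicit.
Unset Printing Implicit Defensive.
Import Order.TTheory GRing.Theory Num.Theory.
Local Open Scope ring_scope.

(** The form E is bilinear but not symmetric. As c is orthogonal, E x y + E y x = 2 <x, y>; so E (ρ
    t) (ρ t) = 1, and once one of E (ρ t) (ρ u), E (ρ u) (ρ t) vanishes, the other is twice a dot
    product. Together with the signs that ≺ imposes on both values, this turns the acute angles of a
    cluster into vanishing conditions on pairs. A noncrossing parabolic is not handled as a group:
    it is represented by a reduced word and by the span of the roots of its letters, and one-sided
    E-orthogonality cuts out the span left when the first or the last letter is removed. The
    delicate point is that each reflection below a noncrossing element can be made the first or the
    last letter of one of its reduced words. This is accessible when the reflection is simple for a
    suitable positive system, hence the family of positive systems obtained by moving the cut: each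
    reflection comes first for one of them. In D(W), the existence of common multiples and the
    comparison of last letters depend on each other, so both are proved in one induction on the
    length of words. *)

Definition mx_entryE (R : pzRingType) m n :=
  ((fun (A B : 'M[R]_(m, n)) i j => mxE _ _ _ _ : (A + B) i j = A i j + B i j),
   (fun (A : 'M[R]_(m, n)) i j => mxE _ _ _ _ : (- A) i j = - A i j),
   (fun a (A : 'M[R]_(m, n)) i j => mxE _ _ _ _ : (a *: A) i j = a * A i j),
   (fun i j => mxE _ _ _ _ : (0 : 'M[R]_(m, n)) i j = 0)).

(** Module identities are checked entrywise. Matrix products are not expanded, so vectors such as
    [rG g *m x] remain atoms for [ring]. *)
Ltac vring := apply/matrixP => ? ?; rewrite !mx_entryE; ring.

(** * Dot products and reflections *)

Section DotProduct.
Variables (R : realType) (n : nat).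
Implicit Types (u v w x y : 'cV[R]_n) (a : R).

Lemma dotpE u v : dotp u v = \sum_i u i 0 * v i 0.
Proof. by rewrite /dotp mxE; apply: eq_bigr => i _; rewrite mxE. Qed.

Lemma dotpC u v : dotp u v = dotp v u.
Proof. by rewrite !dotpE; apply: eq_bigr => i _; rewrite mulrC. Qed.

Lemma dotpDl u v w : dotp (u + v) w = dotp u w + dotp v w.
Proof.
by rewrite !dotpE -big_split; apply: eq_bigr => i _; rewrite mxE mulrDl.
Qed.

Lemma dotpZl a u v : dotp (a *: u) v = a * dotp u v.
Proof.
by rewrite !dotpE mulr_sumr; apply: eq_bigr => i _; rewrite mxE mulrA.
Qed.

Lemma dotpDr u v w : dotp w (u + v) = dotp w u + dotp w v.
Proof. by rewrite dotpC dotpDl !(dotpC w). Qed.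

Lemma dotpZr a u v : dotp u (a *: v) = a * dotp u v.
Proof. by rewrite dotpC dotpZl dotpC. Qed.

Lemma dotpNl u v : dotp (- u) v = - dotp u v.
Proof. by rewrite -scaleN1r dotpZl mulN1r. Qed.

Lemma dotpNr u v : dotp u (- v) = - dotp u v.
Proof. by rewrite dotpC dotpNl dotpC. Qed.

Lemma dotp0l v : dotp 0 v = 0.
Proof. by rewrite -(scale0r (0 : 'cV_n)) dotpZl mul0r. Qed.

Lemma dotp0r v : dotp v 0 = 0.
Proof. by rewrite dotpC dotp0l. Qed.

Definition dotp_lin := (dotpDl, dotpDr, dotpNl, dotpNr, dotpZl, dotpZr).

Lemma dotp_suml (I : Type) (r : seq I) (P : pred I) (F : I -> 'cV[R]_n) v :
  dotp (\sum_(i <- r | P i) F i) v = \sum_(i <- r | P i) dotp (F i) v.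
Proof.
by apply: (big_morph (fun u => dotp u v)) => [x y|]; rewrite ?dotp0l ?dotpDl.
Qed.

Lemma dotp_ge0 v : 0 <= dotp v v.
Proof. by rewrite dotpE sumr_ge0 // => i _; rewrite -expr2 sqr_ge0. Qed.

Lemma dotp_eq0 v : dotp v v = 0 -> v = 0.
Proof.
rewrite dotpE => /eqP; rewrite psumr_eq0 => [/allP v0|i _]; last first.
  by rewrite -expr2 sqr_ge0.
apply/matrixP => i j; rewrite ord1 mxE.
by have := v0 i (mem_index_enum _); rewrite /= -expr2 sqrf_eq0 => /eqP.
Qed.

Lemma dotp_gt0 v : v != 0 -> 0 < dotp v v.
Proof.
by move=> v0; rewrite lt_def dotp_ge0 andbT; apply: contraNneq v0 => /dotp_eq0->.
Qed.

Definition reflv v x := x - (2 * dotp x v) *: v.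

Lemma reflvN v x : reflv (- v) x = reflv v x.
Proof. by rewrite /reflv dotpNr mulrN scaleNr scalerN opprK. Qed.

(** Evaluating both reflections at [v] makes [v] a multiple of [w]; the norms leave only the factors
    1 and -1. *)
Lemma reflv_inj v w :
  dotp v v = 1 -> dotp w w = 1 -> reflv v =1 reflv w -> v = w \/ v = - w.
Proof.
move=> v1 w1 /(_ v); rewrite /reflv v1 mulr1.
move=> vE; have {}vE : v = dotp v w *: w.
  apply: (@scalerI _ _ (2 : R)); first by rewrite pnatr_eq0.
  by rewrite scalerA -[RHS](subKr v) -vE; vring.
have: dotp v w ^+ 2 == 1 by rewrite expr2 -dotpZr -vE v1.
rewrite sqrf_eq1 => /orP[] /eqP dvw; move: vE; rewrite dvw.
  by rewrite scale1r; left.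
by rewrite scaleN1r; right.
Qed.

Lemma dotp_reflv v x y :
  dotp v v = 1 -> dotp (reflv v x) (reflv v y) = dotp x y.
Proof.
by move=> v1; rewrite /reflv !dotp_lin v1 (dotpC v y); ring.
Qed.

Lemma reflvv v : dotp v v = 1 -> reflv v v = - v.
Proof.
by move=> v1; rewrite /reflv v1 mulr1 scaler_nat mulr2n opprD addrA subrr sub0r.
Qed.

End DotProduct.

Section Resolution.
Variables (n : nat) (gT : finGroupType) (s : 'I_n -> gT).
Variables (R : realType) (rG : mx_representation R [set: gT] n).
Variables (alpha : 'I_n -> 'cV[R]_n) (prec : rel (refl s)).
Hypothesis hW : coxeter_system s.
Hypothesis hR : reflection_realization s rG alpha.
Hypothesis hprec : reflection_ordering rG alpha prec.
Hypothesis hc : c_compatible prec.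
Implicit Types (g : gT) (t u v : refl s) (x y : 'cV[R]_n).
Local Notation rho := (@rho n gT s R rG alpha).
Local Notation pos := (in_cone [set: 'I_n] alpha).

(** * The action of W and its positive roots *)

Lemma coxeter_ind (P : gT -> Prop) :
  P 1%g -> (forall i g, P g -> P (s i * g)%g) -> forall g, P g.
Proof.
move=> P1 PM g; have: g \in <<[set s i | i : 'I_n]>>%g by rewrite (cox_gen hW) inE.
case/gen_prodgP=> m [c cS ->]; elim: m c cS => [|m IH] c cS; first by rewrite big_ord0.
rewrite big_ord_recl; have /imsetP[i _ ->] := cS ord0; apply: PM.
by apply: IH => i'.
Qed.

Lemma actM (g h : gT) x : rG (g * h)%g *m x = rG g *m (rG h *m x).
Proof. by rewrite repr_mxM ?inE // mulmxA. Qed.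

Lemma act1 x : rG 1%g *m x = x.
Proof. by rewrite repr_mx1 mul1mx. Qed.

Lemma actK g : cancel (fun x => rG g *m x) (fun x => rG g^-1%g *m x).
Proof. by move=> x; rewrite -actM mulVg act1. Qed.

Lemma actKV g : cancel (fun x => rG g^-1%g *m x) (fun x => rG g *m x).
Proof. by move=> x; rewrite -actM mulgV act1. Qed.

Lemma act_inj g : injective (fun x => rG g *m x).
Proof. exact: can_inj (actK g). Qed.

Lemma actE i x : rG (s i) *m x = reflv (alpha i) x.
Proof. exact: (real_refl hR). Qed.

Lemma dotp_act g x y : dotp (rG g *m x) (rG g *m y) = dotp x y.
Proof.
elim/coxeter_ind: g x y => [|i g IH] x y; first by rewrite !act1.
by rewrite !actM !actE dotp_reflv ?IH // (real_unit hR).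
Qed.

Lemma dotp_actl g x y : dotp (rG g *m x) y = dotp x (rG g^-1%g *m y).
Proof. by rewrite -{1}(actKV g y) dotp_act. Qed.

Lemma act_eq (g h : gT) : (forall x, rG g *m x = rG h *m x) -> g = h.
Proof.
move=> gh; have /subsetP/(_ (g * h^-1)%g) := real_faithful hR.
rewrite !inE mul1mx /= => gh1; apply/eqP; rewrite eq_mulgV1; apply: gh1.
apply/eqP/matrixP => i j; move: (gh (rG h^-1%g *m delta_mx j 0)).
rewrite -!actM mulgV act1 => /matrixP/(_ i 0).
by rewrite -colE !mxE eqxx andbT.
Qed.

(** Both signs are allowed, unlike in [is_positive_root], which makes the notion stable under
    conjugation. *)
Definition is_root t (v : 'cV[R]_n) :=
  dotp v v = 1 /\ forall x, rG (val t) *m x = reflv v x.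

Lemma reflv_act g (v : 'cV[R]_n) x : reflv (rG g *m v) x = rG g *m reflv v (rG g^-1%g *m x).
Proof.
by rewrite /reflv mulmxBr actKV -scalemxAr dotpC dotp_actl dotpC.
Qed.

Lemma is_root_conj t g (v : 'cV[R]_n) : is_root t v -> is_root (rconj t g) (rG g^-1%g *m v).
Proof.
case=> v1 tE; split=> [|x]; first by rewrite dotp_act.
by rewrite reflv_act /= conjgE invgK !actM tE.
Qed.

Lemma is_root_uniq t (v w : 'cV[R]_n) : is_root t v -> is_root t w -> v = w \/ v = - w.
Proof.
by move=> [v1 tv] [w1 tw]; apply: reflv_inj => // x; rewrite -tv tw.
Qed.

Lemma is_rootN t (v : 'cV[R]_n) : is_root t v -> is_root t (- v).
Proof.
by case=> v1 tv; split=> [|x]; rewrite ?dotp_lin ?opprK // tv reflvN.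
Qed.

Lemma refl_ind (P : refl s -> Prop) :
  (forall t g i, val t = (g * s i * g^-1)%g -> P t) -> forall t, P t.
Proof. by move=> Pt t; have /imset2P[g i _ _ /Pt] := valP t. Qed.

Lemma is_root_refl t g i : val t = (g * s i * g^-1)%g -> is_root t (rG g *m alpha i).
Proof.
move=> tE; split=> [|x]; first by rewrite dotp_act (real_unit hR).
by rewrite tE reflv_act !actM actE.
Qed.

Lemma rhoP t : is_positive_root rG alpha t (rho t).
Proof.
apply: classical_sets.xgetPex; elim/refl_ind: t => t g i tE.
have [t1 t2] := is_root_refl tE.
have [w0|w0] := real_roots hR g i; [exists (rG g *m alpha i)|exists (- (rG g *m alpha i))]; split=> //.
  by rewrite dotp_lin dotpNr opprK.
by move=> x; rewrite t2 -[LHS]reflvN.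
Qed.

Lemma rho_root t : is_root t (rho t).
Proof. by have [? ? _] := rhoP t. Qed.

Lemma rho1 t : dotp (rho t) (rho t) = 1.
Proof. by case: (rho_root t). Qed.

Lemma act_refl t x : rG (val t) *m x = reflv (rho t) x.
Proof. by case: (rho_root t). Qed.

Lemma rho_pos t : pos (rho t).
Proof. by case: (rhoP t). Qed.

Lemma is_root_rho t (v : 'cV[R]_n) : is_root t v -> v = rho t \/ v = - rho t.
Proof. by move/is_root_uniq; apply; apply: rho_root. Qed.

Lemma rho_conj t g : rG g^-1%g *m rho t = rho (rconj t g) \/
                     rG g^-1%g *m rho t = - rho (rconj t g).
Proof. exact/is_root_rho/is_root_conj/rho_root. Qed.

Lemma rho_neq0 t : rho t != 0.
Proof. by apply: contra_eq_neq (rho1 t) => ->; rewrite dotp0l eq_sym oner_eq0. Qed.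

Lemma is_root_inj t u (v : 'cV[R]_n) : is_root t v -> is_root u v -> t = u.
Proof.
by move=> [_ tv] [_ uv]; apply/val_inj/act_eq => x; rewrite tv uv.
Qed.

Lemma rho_scale t u a : rho t = a *: rho u -> t = u.
Proof.
move=> tu; have: a ^+ 2 == 1 by rewrite -(rho1 t) tu !dotp_lin rho1 mulr1.
rewrite sqrf_eq1 => /orP[] /eqP a1; move: tu; rewrite a1 ?scale1r ?scaleN1r => tu.
  by apply: is_root_inj (rho_root t) _; rewrite tu; apply: rho_root.
by apply: is_root_inj (rho_root t) _; rewrite tu; apply/is_rootN/rho_root.
Qed.

Lemma refl_invol t : (val t * val t = 1)%g.
Proof.
apply/act_eq => x; rewrite actM !act_refl act1 /reflv !dotp_lin rho1 mulr1.
by vring.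
Qed.

Lemma refl_inv t : ((val t)^-1 = val t)%g.
Proof. by apply/eqP; rewrite eq_invg_mul refl_invol. Qed.

Lemma rconjK t u : rconj (rconj t (val u)) (val u) = t.
Proof. by apply/val_inj; rewrite /= -conjgM refl_invol conjg1. Qed.

(** Pairing with [d] is the height function: it is positive on nonzero vectors of the positive cone,
    and so decides the sign of a root. *)
Lemma exists_delta : exists d : 'cV[R]_n, forall i, dotp d (alpha i) = 1.
Proof.
set A := (\matrix_(i, j) alpha j i 0); have Au := real_basis hR.
exists (invmx A^T *m const_mx 1) => i.
have: A^T *m (invmx A^T *m const_mx 1) = const_mx 1 :> 'cV[R]_n.
  by rewrite mulKVmx // unitmx_tr.
move: (invmx A^T *m _) => d /matrixP/(_ i 0); rewrite !mxE dotpC dotpE => <-.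
by apply: eq_bigr => j _; rewrite !mxE.
Qed.

Lemma pos_eq0 (v : 'cV[R]_n) : pos v -> pos (- v) -> v = 0.
Proof.
have [d dE] := exists_delta; move=> [a a0 vE] [b b0 wE].
have dv : dotp v d = \sum_i a i.
  by rewrite vE dotp_suml; apply: eq_big => [i|i _]; rewrite ?inE // dotpZl dotpC dE mulr1.
have dw : - dotp v d = \sum_i b i.
  by rewrite -dotpNl wE dotp_suml; apply: eq_big => [i|i _]; rewrite ?inE // dotpZl dotpC dE mulr1.
have /eqP a_eq0 : \sum_i a i == 0.
  by rewrite eq_le sumr_ge0 // andbT -dv -oppr_ge0 dw sumr_ge0.
rewrite vE big1 // => i _; have /eqP := a_eq0.
by rewrite psumr_eq0 // => /allP/(_ i (mem_index_enum _))/eqP->; rewrite scale0r.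
Qed.

Lemma posN_rho t : ~ pos (- rho t).
Proof. by move=> tn; have := rho_neq0 t; rewrite (pos_eq0 (rho_pos t) tn) eqxx. Qed.

Lemma alpha_simple i : exists2 t, val t = s i & rho t = alpha i.
Proof.
have si : s i \in reflections s.
  by apply/imset2P; exists 1%g i; rewrite ?inE // invg1 mul1g mulg1.
exists (exist _ (s i) si) => //.
have tr : is_root (exist _ (s i) si) (alpha i) by split; [exact: (real_unit hR)|exact: actE].
have [|tE] := is_root_rho tr; first by [].
case: (@posN_rho (exist _ (s i) si)); rewrite -tE.
exists (fun j => (j == i)%:R) => [j|]; first by rewrite ler0n.
rewrite (bigD1 i) ?inE //= eqxx scale1r big1 ?addr0 // => j /andP[_ /negPf->].
by rewrite scale0r.
Qed.

Lemma rho_indep t u a b : t != u -> a *: rho t + b *: rho u = 0 -> a = 0 /\ b = 0.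
Proof.
move=> tu ab0; have b0 : b = 0.
  apply: contraNeq tu => b0; apply/eqP/esym/(@rho_scale _ _ (- (b^-1 * a))).
  apply: (scalerI b0); rewrite scalerA mulrN mulVKf // scaleNr.
  by apply/eqP; rewrite -addr_eq0 addrC ab0.
by move: ab0; rewrite b0 scale0r addr0 => /eqP; rewrite scaler_eq0 (negPf (rho_neq0 _)) orbF => /eqP.
Qed.

(** Strict Cauchy-Schwarz: the component of ρ t orthogonal to ρ u is not zero. *)
Lemma rho_dot_lt1 t u : t != u -> 0 < 1 - dotp (rho t) (rho u) ^+ 2.
Proof.
move=> tu; have : rho t - dotp (rho t) (rho u) *: rho u != 0.
  by apply: contraNneq tu => /eqP; rewrite subr_eq0 => /eqP/rho_scale ->.
move/dotp_gt0; rewrite !dotp_lin !rho1 (dotpC (rho u)); set g := dotp _ _.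
by rewrite (_ : _ - g * g + _ = 1 - g ^+ 2) //; ring.
Qed.

(** * Rank 2 parabolic subgroups *)

Definition plane t u (v : 'cV[R]_n) := exists a b, v = a *: rho t + b *: rho u.

Lemma plane_orth t u (v : 'cV[R]_n) : t != u ->
  exists y, [/\ plane t u (v - y), dotp y (rho t) = 0 & dotp y (rho u) = 0].
Proof.
move=> tu; have D0 := rho_dot_lt1 tu; set g := dotp (rho t) (rho u) in D0.
set D := 1 - g ^+ 2 in D0; have D1 : D != 0 by rewrite gt_eqF.
(* Cramer's rule for the Gram matrix of ρ t and ρ u, whose determinant is [D]. *)
pose a := (dotp v (rho t) - g * dotp v (rho u)) / D.
pose b := (dotp v (rho u) - g * dotp v (rho t)) / D.
exists (v - (a *: rho t + b *: rho u)); split; first by exists a, b; rewrite subKr.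
  by rewrite !dotp_lin rho1 (dotpC (rho u)) -/g /a /b /D; field; rewrite -/D.
by rewrite !dotp_lin rho1 -/g /a /b /D; field; rewrite -/D.
Qed.

Lemma exists_gt_seq (l : seq R) : exists m, forall a, a \in l -> a < m.
Proof.
elim: l => [|a l [m mP]]; first by exists 0.
exists (Num.max (a + 1) m) => b; rewrite inE lt_max => /orP[/eqP->|/mP->].
  by rewrite ltrDl ltr01.
by rewrite orbT.
Qed.

(** Reflections are treated one by one: if ρ w0 is not in the plane, a large multiple of a vector
    orthogonal to the plane but not to ρ w0 is added to x. *)
Lemma generic_point t u : t != u ->
  exists x, [/\ dotp x (rho t) = 0, dotp x (rho u) = 0
    & forall w, dotp x (rho w) = 0 -> plane t u (rho w)].
Proof.
move=> tu; suff [x [xt xu xP]] : exists x, [/\ dotp x (rho t) = 0, dotp x (rho u) = 0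
    & forall w, w \in enum {: refl s} -> dotp x (rho w) = 0 -> plane t u (rho w)].
  by exists x; split=> // w; apply: xP; rewrite mem_enum.
elim: (enum _) => [|w0 l [x [xt xu xP]]].
  by exists 0; split; rewrite ?dotp0l.
have [y [yP yt yu]] := plane_orth (rho w0) tu.
have [y0|/dotp_gt0 y0] := eqVneq y 0.
  exists x; split=> // w; rewrite inE => /orP[/eqP-> _|]; last exact: xP.
  by move: yP; rewrite y0 subr0.
have yw0 : dotp y (rho w0) = dotp y y.
  case: yP => a [b /(canRL (subrK _)) ->].
  by rewrite !dotp_lin yt yu !mulr0 !add0r.
(* [m] exceeds every parameter at which the line x + m y crosses one of the hyperplanes; when y lies
   in a hyperplane, the division by 0 only adds the bound 0. *)
have [m mP] := exists_gt_seq [seq - (dotp x (rho w) / dotp y (rho w)) | w <- w0 :: l].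
exists (x + m *: y); split; rewrite ?dotp_lin ?xt ?xu ?yt ?yu ?mulr0 ?addr0 //.
move=> w wl; rewrite !dotp_lin; have [yw|yw] := eqVneq (dotp y (rho w)) 0.
  rewrite yw mulr0 addr0; apply: xP; move: wl; rewrite inE => /orP[/eqP ww0|//].
  by move: y0; rewrite -yw0 -ww0 yw ltxx.
move=> xm; have := mP _ (map_f _ wl); rewrite ltNge => /negP[].
by rewrite le_eqVlt -subr_eq0 opprK -(mulfK yw m) -mulrDl addrC xm mul0r eqxx.
Qed.

Lemma alpha_free (a : 'I_n -> R) : \sum_i a i *: alpha i = 0 -> forall i, a i = 0.
Proof.
move=> a0 i; have Au := real_basis hR; pose v := \col_i a i.
suff v0 : v = 0 by have := congr1 (fun m : 'cV[R]_n => m i 0) v0; rewrite !mxE.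
rewrite -[v](mulKmx Au) (_ : _ *m v = 0) ?mulmx0 //.
apply/matrixP => j k; rewrite ord1 mxE -[RHS]/((0 : 'cV[R]_n) j 0) -a0 summxE.
by apply: eq_bigr => l _; rewrite !mxE mulrC.
Qed.

Lemma pos_dot (d v : 'cV[R]_n) :
  (forall i, dotp d (alpha i) = 1) -> pos v -> v != 0 -> 0 < dotp d v.
Proof.
move=> dE [a a0 vE] v0.
have dv : dotp d v = \sum_i a i.
  by rewrite dotpC vE dotp_suml; apply: eq_big => [i|i _]; rewrite ?inE // dotpZl dotpC dE mulr1.
rewrite lt_def dv sumr_ge0 // andbT; apply: contraNneq v0 => /eqP.
rewrite psumr_eq0 // => /allP a_eq0; rewrite vE big1 // => i _.
by rewrite (eqP (a_eq0 i (mem_index_enum _))) scale0r.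
Qed.

Lemma conj_rho t g : exists2 w : refl s, w = rconj t g^-1%g &
  rG g *m rho t = rho w \/ rG g *m rho t = - rho w.
Proof.
by exists (rconj t g^-1%g) => //; have := rho_conj t g^-1%g; rewrite invgK.
Qed.

Lemma pos_sum (v : 'cV[R]_n) : pos v <-> exists2 a : 'I_n -> R,
  (forall i, 0 <= a i) & v = \sum_i a i *: alpha i.
Proof.
by split=> -[a a0 ->]; exists a => //; apply: eq_bigl => i; rewrite inE.
Qed.

(** A lexicographic maximum: g maximizes <g x, d> and, among the maximizers, <g d, d>. The tie-break
    makes g^-1 map the simple roots orthogonal to g x to positive roots. *)
Lemma dominant_point x d : (forall i, dotp d (alpha i) = 1) ->
  exists g, (forall i, 0 <= dotp (rG g *m x) (alpha i)) /\
    forall i, dotp (rG g *m x) (alpha i) = 0 -> 0 <= dotp (rG g *m d) (alpha i).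
Proof.
move=> dE; pose F y g := dotp (rG g *m y) d.
have Fs y g i : F y (s i * g)%g = F y g - 2 * dotp (rG g *m y) (alpha i).
  by rewrite /F actM actE /reflv !dotp_lin (dotpC (alpha i)) dE mulr1.
have [g1 _ g1P] := @Order.TotalTheory.arg_maxP _ _ gT 1%g xpredT (F x) isT.
have [g /eqP gE gP] := @Order.TotalTheory.arg_maxP _ _ gT g1 (fun g => F x g == F x g1) (F d) (eqxx _).
exists g; split=> [i|i xi].
  by have := g1P (s i * g)%g isT; rewrite /= Fs gE gerBl pmulr_rge0.
have := gP (s i * g)%g; rewrite /= !Fs xi mulr0 subr0 gE eqxx => /(_ isT).
by rewrite gerBl pmulr_rge0.
Qed.

(* A generic point of the orthogonal of the plane of two roots is moved into
   the closed fundamental chamber; the simple roots vanishing there span the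
   image of the plane. *)
Lemma rank2_parabolic t u : t != u ->
  exists (i j : 'I_n) g (p q : refl s), [/\ i != j, val p = (s i ^ g)%g, val q = (s j ^ g)%g &
   [/\ p != q, plane t u (rho p), plane t u (rho q) &
    forall w, plane t u (rho w) ->
      exists a b : R, [/\ 0 <= a, 0 <= b & rho w = a *: rho p + b *: rho q]]].
Proof.
move=> tu; have [x [xt xu xP]] := generic_point tu.
have [d dE] := exists_delta; have [g [gx gd]] := dominant_point x dE.
pose I (i : 'I_n) := dotp (rG g *m x) (alpha i) == 0.
have dpos w : 0 < dotp d (rho w) by apply: pos_dot => //; [exact: rho_pos|exact: rho_neq0].
have /fin_all_exists[p pP] i : exists p : refl s, val p = (s i ^ g)%g /\
    (I i -> rho p = rG g^-1%g *m alpha i).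
  have [ti tv tr] := alpha_simple i.
  exists (rconj ti g); split; first by rewrite /= tv.
  move=> /eqP/gd; rewrite -tr dotp_actl => di.
  case: (rho_conj ti g) => // tE; move: di; rewrite tE dotpNr oppr_ge0 leNgt.
  by rewrite dpos.
have xp i : I i -> plane t u (rho (p i)).
  move=> Ii; apply: xP; have [_ /(_ Ii) ->] := pP i.
  by rewrite -dotp_actl (eqP Ii).
(* As g x lies in the closed chamber, a nonnegative combination of simple roots orthogonal to it
   involves only those indexed by [I]. The height [d] then settles the sign of the image root. *)
have cone w : plane t u (rho w) -> exists2 a : 'I_n -> R,
    forall i, 0 <= a i & rho w = \sum_(i | I i) a i *: rho (p i).
  move=> [a [b wE]]; have xw : dotp x (rho w) = 0.
    by rewrite wE !dotp_lin xt xu !mulr0 addr0.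
  have [w' _ w'E] := conj_rho w g.
  have /pos_sum[e e0 eE] := rho_pos w'.
  have ew' : \sum_i e i * dotp (rG g *m x) (alpha i) = 0.
    have -> : \sum_i e i * dotp (rG g *m x) (alpha i) = dotp (rho w') (rG g *m x).
      by rewrite eE dotp_suml; apply: eq_bigr => i _; rewrite dotpZl (dotpC (alpha i)).
    by apply/eqP; rewrite -oppr_eq0 -dotpNl; case: w'E => <-; rewrite ?dotpNl ?oppr_eq0 dotp_act dotpC xw.
  have eI i : ~~ I i -> e i = 0.
    move=> Ii; have ew0 k : true -> 0 <= e k * dotp (rG g *m x) (alpha k).
      by rewrite mulr_ge0.
    have /eqP := psumr_eq0P ew0 ew' (i := i) isT.
    by rewrite mulf_eq0 => /orP[/eqP//|xi]; rewrite /I xi in Ii.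
  have gw' : rG g^-1%g *m rho w' = \sum_(i | I i) e i *: rho (p i).
    rewrite eE mulmx_sumr (bigID I) /= [X in _ + X]big1 ?addr0 => [|i /eI ->]; last by rewrite scale0r mulmx0.
    by apply: eq_bigr => i Ii; have [_ /(_ Ii) ->] := pP i; rewrite scalemxAr.
  have gw0 : 0 <= dotp d (rG g^-1%g *m rho w').
    rewrite gw' dotpC dotp_suml sumr_ge0 // => i Ii.
    by rewrite dotpZl mulr_ge0 // dotpC ltW.
  exists e => //; case: w'E => w'E.
    by rewrite -gw' -w'E actK.
  move: gw0; rewrite -[rho w']opprK -w'E mulmxN actK dotpNr oppr_ge0 leNgt.
  by rewrite dpos.
have pt : plane t u (rho t) by exists 1, 0; rewrite scale1r scale0r addr0.
have pu : plane t u (rho u) by exists 0, 1; rewrite scale1r scale0r add0r.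
have [i Ii] : exists i, I i.
  have [a _ tE] := cone _ pt; apply/existsP; apply: contraNT (rho_neq0 t).
  rewrite negb_exists => /forallP nI; rewrite tE big1 // => i Ii.
  by have := nI i; rewrite Ii.
have [j /andP[Ij ij]] : exists j, I j && (i != j).
  apply/existsP; apply: contraNT tu; rewrite negb_exists => /forallP nI.
  have only w : plane t u (rho w) -> exists a, rho w = a *: rho (p i).
    move=> /cone[a _ ->]; exists (a i); rewrite (bigD1 i) //= big1 ?addr0 //.
    by move=> k /andP[Ik]; rewrite eq_sym => ik; have := nI k; rewrite Ik ik.
  by have [a /rho_scale ->] := only _ pt; have [b /rho_scale ->] := only _ pu.
have pij (a b : R) : a *: rho (p i) + b *: rho (p j) = 0 -> a = 0 /\ b = 0.
  rewrite (proj2 (pP i) Ii) (proj2 (pP j) Ij) !scalemxAr -mulmxDr => ab0.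
  have {}ab0 : a *: alpha i + b *: alpha j = 0.
    by apply: (act_inj (g := g^-1%g)); rewrite /= ab0 mulmx0.
  pose f k := if k == i then a else if k == j then b else 0.
  have /alpha_free f0 : \sum_k f k *: alpha k = 0.
    rewrite (bigD1 i) //= (bigD1 j) 1?eq_sym //= big1 ?addr0 /f ?eqxx.
      by rewrite eq_sym (negPf ij) ab0.
    by move=> k /andP[/negPf-> /negPf->]; rewrite scale0r.
  by have := (f0 i, f0 j); rewrite /f !eqxx eq_sym (negPf ij) => -[].
have Iij k : I k -> (k == i) || (k == j).
  move=> Ik; apply/negPn; rewrite negb_or; apply/negP => /andP[ki kj].
  have [[a1 [b1 e1]] [a2 [b2 e2]]] := (xp _ Ii, xp _ Ij).
  have [a3 [b3 e3]] := xp _ Ik.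
  (* Three vectors of a plane satisfy the linear relation whose coefficients are their 2 by 2
     minors, so a third simple root in [I] would contradict independence. *)
  pose f l := if l == i then a2 * b3 - a3 * b2 else
    if l == j then a3 * b1 - a1 * b3 else if l == k then a1 * b2 - a2 * b1 else 0.
  have /alpha_free f0 : \sum_l f l *: alpha l = 0.
    apply: (act_inj (g := g^-1%g)); rewrite /= mulmx0 mulmx_sumr.
    rewrite (bigD1 i) //= (bigD1 j) 1?eq_sym //= (bigD1 k) /= ?ki ?kj // big1 ?addr0 /f ?eqxx.
      rewrite eq_sym (negPf ij) (negPf ki) (negPf kj) -!scalemxAr.
      rewrite -(proj2 (pP i) Ii) -(proj2 (pP j) Ij) -(proj2 (pP k) Ik) e1 e2 e3.
      by vring.
    by move=> l /andP[/andP[/negPf-> /negPf->] /negPf->]; rewrite scale0r mulmx0.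
  have m0 : a1 * b2 - a2 * b1 = 0.
    by have := f0 k; rewrite /f (negPf ki) (negPf kj) eqxx.
  have [|a20 a10] := pij (a2) (- a1).
    rewrite e1 e2 -[RHS](scale0r (rho u)) -[0 in RHS]oppr0 -m0; vring.
  have [|b20 b10] := pij (b2) (- b1).
    rewrite e1 e2 -[RHS](scale0r (rho t)) -m0; vring.
  move/eqP: a10; rewrite oppr_eq0 => /eqP a10.
  move/eqP: b10; rewrite oppr_eq0 => /eqP b10.
  by have := rho_neq0 (p i); rewrite e1 a10 b10 !scale0r addr0 eqxx.
exists i, j, g, (p i), (p j); split=> //; first by case: (pP i).
  by case: (pP j).
split; try exact: xp.
  apply/eqP => pe; have [|o _] := pij 1 (-1); first by rewrite pe scale1r scaleN1r subrr.
  by move/eqP: o; rewrite oner_eq0.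
move=> w /cone[a a0 ->]; exists (a i), (a j); split=> //.
rewrite (bigD1 i) //= (bigD1 j) ?Ij 1?eq_sym //= big1 ?addr0 //.
by move=> k /andP[/andP[/Iij /orP[/eqP->|/eqP->]]]; rewrite eqxx.
Qed.

(** * The roots of a dihedral parabolic in angular order *)

Section Dihedral.
Variables p q : refl s.
Hypothesis pq : p != q.
Hypothesis cone_pq : forall w, plane p q (rho w) ->
  exists a b : R, [/\ 0 <= a, 0 <= b & rho w = a *: rho p + b *: rho q].
Local Notation a := (rho p).
Local Notation b := (rho q).
Local Notation g := (dotp (rho p) (rho q)).
Local Notation r := (val p * val q)%g.
Local Notation m := #[r]%g.


Lemma plane_unique (x z x' z' : R) : x *: a + z *: b = x' *: a + z' *: b -> x = x' /\ z = z'.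
Proof.
move=> e; have /(rho_indep pq) [] : (x - x') *: a + (z - z') *: b = 0.
  transitivity ((x *: a + z *: b) - (x' *: a + z' *: b)); first by vring.
  by rewrite e subrr.
by move=> /eqP; rewrite subr_eq0 => /eqP-> /eqP; rewrite subr_eq0 => /eqP->.
Qed.

Lemma root_sign w y (x z : R) : is_root w y -> y = x *: a + z *: b ->
  (0 <= x /\ 0 <= z) \/ (x <= 0 /\ z <= 0).
Proof.
move=> wy yE; have [wE|wE] := is_root_rho wy.
  have [|x' [z' [x0 z0 e]]] := cone_pq (w := w); first by exists x, z; rewrite -wE.
  by left; have [|-> ->] := @plane_unique x z x' z'; rewrite // -yE wE.
have [|x' [z' [x0 z0 e]]] := cone_pq (w := w).
  by exists (- x), (- z); rewrite -[LHS]opprK -wE yE; vring.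
right; have [|-> ->] := @plane_unique x z (- x') (- z'); last by rewrite !oppr_le0.
by rewrite -yE wE e; vring.
Qed.

(** For g = - cos θ this is sin (k θ) / sin θ, a Chebyshev polynomial of the second kind in - g. *)
Fixpoint dih_coef (k : nat) : R :=
  match k with
  | 0 => 0
  | k'.+1 => match k' with 0 => 1 | k''.+1 => - 2 * g * dih_coef k' - dih_coef k'' end
  end.
Local Notation D := dih_coef.

Lemma dih_coefSS (k : nat) : D k.+2 = - 2 * g * D k.+1 - D k.
Proof. by []. Qed.

(** The left side is the determinant of the roots of index h and h + k in the basis a, b, so
    positivity of [dih_coef] means that the roots are listed in angular order. *)
Lemma dih_coef_det (h k : nat) : D h.+1 * D (h + k) - D h * D (h + k).+1 = D k.
Proof.
elim: h => [|h IH]; first by rewrite add0n mul1r mul0r subr0.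
by rewrite addSn !dih_coefSS -[RHS]IH; ring.
Qed.

Definition dih_root (h : nat) := D h.+1 *: a + D h *: b.
Local Notation beta := dih_root.

Lemma dih_rootSS (h : nat) : beta h.+2 = (- 2 * g) *: beta h.+1 - beta h.
Proof. by rewrite /beta !dih_coefSS; vring. Qed.

(** Consecutive reflections are carried in pairs, because each one is the conjugate of the one two
    places before by the one just before. *)
Fixpoint dih_pair (h : nat) : refl s * refl s :=
  if h is h'.+1 then ((dih_pair h').2, rconj (dih_pair h').1 (val (dih_pair h').2))
  else (p, rconj q (val p)).
Definition dih_refl (h : nat) := (dih_pair h).1.
Local Notation v := dih_refl.

Lemma dih_reflS (h : nat) : val (v h.+1) = (r * val (v h))%g.
Proof.
rewrite /v; elim: h => [|h IH] /=; first by rewrite conjgE refl_inv mulgA.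
move=> /=; move: IH => /=; case: (dih_pair h) => [x y] /= yE; rewrite -[sval x]/(val x) -[sval y]/(val y) in yE *.
by rewrite conjgE refl_inv mulgA {1}yE -!mulgA [(val x * (val x * _))%g]mulgA refl_invol mul1g.
Qed.

Lemma dih_reflE (h : nat) : val (v h) = (r ^+ h * val p)%g.
Proof.
by elim: h => [|h IH]; rewrite ?mul1g // dih_reflS IH expgS mulgA.
Qed.

Lemma dih_rootP (h : nat) : [/\ is_root (v h) (beta h), is_root (v h.+1) (beta h.+1)
  & dotp (beta h) (beta h.+1) = - g].
Proof.
elim: h => [|h [h1 h2 h3]].
  have b0 : beta 0%N = a by rewrite /beta /=; vring.
  have b1 : beta 1%N = rG (val p)^-1%g *m b.
    by rewrite refl_inv act_refl /reflv (dotpC b) /beta /=; vring.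
  rewrite b0; split; first exact: rho_root.
    by rewrite b1; apply/is_root_conj/rho_root.
  by rewrite /beta /= !dotp_lin rho1; ring.
split=> //.
  have -> : beta h.+2 = - (rG (val (v h.+1))^-1%g *m beta h).
    rewrite refl_inv (proj2 h2) /reflv h3 dih_rootSS; vring.
  exact/is_rootN/is_root_conj.
rewrite dih_rootSS; case: h2 h3 => + _; move: (beta h) (beta h.+1) => x y y1 xy.
by rewrite !dotp_lin y1 (dotpC y) xy; ring.
Qed.

Lemma dih_isroot (h : nat) : is_root (v h) (beta h).
Proof. by case: (dih_rootP h). Qed.

Lemma dih_dot (h : nat) : dotp (beta h) (beta h.+1) = - g.
Proof. by case: (dih_rootP h). Qed.

(** For h = 0, reflecting in p gives coordinates of opposite signs. In the step, the reflection of
    index h + 1 maps the sector between the roots h + 1 and h + 2, up to sign, onto the sector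
    between h and h + 1. *)
Lemma dih_no_between (h : nat) w (x z : R) : 0 < x -> 0 < z ->
  ~ is_root w (x *: beta h + z *: beta h.+1).
Proof.
elim: h w x z => [|h IH] w x z x0 z0 wr.
  have e : rG (val p)^-1%g *m (x *: beta 0%N + z *: beta 1%N) = (- x) *: a + z *: b.
    by rewrite refl_inv act_refl /reflv /beta /= !dotp_lin rho1 (dotpC b); vring.
  have [[]|[_]] := root_sign (is_root_conj _ wr) e; first by rewrite oppr_ge0 leNgt x0.
  by rewrite leNgt z0.
have /is_rootN := is_root_conj (val (v h.+1)) wr.
rewrite refl_inv (proj2 (dih_isroot _)) => wr'.
apply: (IH (rconj w (val (v h.+1))) z x) => //; move: wr'; congr (is_root _ _).
have [y1 _] := dih_isroot h.+1; have := dih_dot h; rewrite dih_rootSS /reflv.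
move: (beta h) (beta h.+1) y1 => u y y1 uy; rewrite !dotp_lin y1 uy; vring.
Qed.

(** The root of index 1 is - 2 g a + b, and its coordinates cannot have opposite signs. *)
Lemma dih_dot_le0 : g <= 0.
Proof.
have := dih_isroot 1; rewrite /beta => /root_sign /(_ erefl) /=.
by case=> -[g0 g1]; [lra|move: g1; rewrite ler10].
Qed.

Lemma dih_order_gt1 : (1 < m)%N.
Proof.
rewrite ltnNge leq_eqVlt ltnS leqn0 -[#[r]%g == 0%N]negbK -lt0n order_gt0 orbF order_eq1.
apply: contraNN pq => /eqP pq1; apply/eqP/val_inj/esym/eqP; rewrite -(mulgK (val q) (val p)) pq1.
by rewrite mul1g refl_inv.
Qed.

Lemma dih_refl_last : v m.-1 = q.
Proof.
apply/val_inj; rewrite dih_reflE /=; apply: (mulgI r).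
by rewrite mulgA -expgS prednK ?order_gt0 // expg_order mul1g -mulgA refl_invol mulg1.
Qed.

Lemma dih_refl_inj (h l : nat) : (h < m)%N -> (l < m)%N -> v h = v l -> h = l.
Proof.
move=> hm lm /(congr1 val); rewrite !dih_reflE => /mulIg/eqP.
by rewrite eq_expg_mod_order !modn_small // => /eqP.
Qed.

(** As long as one coordinate is positive, [root_sign] makes the other nonnegative. If D (l + 1) =
    0, the root of index l is a multiple of b, so its reflection is q, which among the indices below
    m occurs only at m - 1. *)
Lemma dih_coef_ge0 (h : nat) : (h < m)%N ->
  [/\ 0 <= D h, 0 <= D h.+1 & (h.+1 < m)%N -> 0 < D h.+1].
Proof.
have last_m l : D l.+1 = 0 -> 0 <= D l -> v l = q.
  move=> d0 d1; have [_ wr] := dih_isroot l.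
  have bE : beta l = D l *: b by rewrite /beta d0 scale0r add0r.
  have [e|e] := is_root_rho (dih_isroot l); first by apply: (@rho_scale _ _ (D l)); rewrite -e.
  by apply: (@rho_scale _ _ (- D l)); rewrite scaleNr -bE e opprK.
have lt_last l : (l.+1 < m)%N -> v l <> q.
  move=> lm vq; have m0 : (m.-1 < m)%N by rewrite prednK ?order_gt0.
  have lE := dih_refl_inj (ltnW lm) m0 (etrans vq (esym dih_refl_last)).
  by move: lm; rewrite lE prednK ?order_gt0 // ltnn.
elim: h => [|h IH] hm; first by split=> //=; rewrite ltr01.
have [h0 h1 h2] := IH (ltnW hm); have {}h2 := h2 hm.
have h3 : 0 <= D h.+2.
  have /root_sign/(_ erefl)[[]//|[_]] := dih_isroot h.+1.
  by rewrite leNgt h2.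
split=> // h4; rewrite lt_def h3 andbT; apply/eqP => d0.
exact: lt_last h4 (last_m _ d0 h1).
Qed.

Lemma dih_rho (h : nat) : (h < m)%N -> rho (v h) = beta h.
Proof.
move=> hm; have [d0 d1 _] := dih_coef_ge0 hm.
have [//|e] := is_root_rho (dih_isroot h).
have [|x [z [x0 z0 vE]]] := cone_pq (w := v h).
  by exists (- D h.+1), (- D h); rewrite -[LHS]opprK -e /beta; vring.
have [|dx dz] := @plane_unique (D h.+1) (D h) (- x) (- z).
  by rewrite -/(beta h) e vE; vring.
have := proj1 (dih_isroot h); rewrite /beta.
have -> : D h.+1 = 0 by apply/eqP; rewrite eq_le d1 dx oppr_le0 x0.
have -> : D h = 0 by apply/eqP; rewrite eq_le d0 dz oppr_le0 z0.
by rewrite !scale0r addr0 dotp0l => /eqP; rewrite eq_sym oner_eq0.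
Qed.

(** [f h] is the determinant of the root of index h and ρ w. It runs from z ≥ 0 to - x ≤ 0; where it
    changes sign, ρ w lies in the sector of two consecutive roots, whose interior contains no
    root. *)
Lemma dih_complete w : plane p q (rho w) -> exists2 h, (h < m)%N & w = v h.
Proof.
move=> /cone_pq[x [z [x0 z0 wE]]]; pose f (h : nat) := D h.+1 * z - D h * x.
have sector (h : nat) : (h.+1 < m)%N -> 0 <= f h -> f h.+1 < 0 -> w = v h.
  move=> hm f0 f1.
  have dt : D h.+1 * D h.+1 - D h * D h.+2 = 1 by have := dih_coef_det h 1; rewrite addn1.
  have wh : rho w = (- f h.+1) *: beta h + f h *: beta h.+1.
    transitivity ((D h.+1 * D h.+1 - D h * D h.+2) *: rho w); first by rewrite dt scale1r.
    by rewrite wE /f /beta; vring.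
  move: f0; rewrite le_eqVlt => /orP[/eqP f0|f0].
    by apply: rho_scale; rewrite dih_rho ?(ltnW hm) // wh -f0 scale0r addr0.
  case: (@dih_no_between h w (- f h.+1) (f h)) => //; rewrite ?oppr_gt0 //.
  by rewrite -wh; apply: rho_root.
suff main (k : nat) : (k < m)%N -> 0 <= f k \/ exists2 h, (h < m)%N & w = v h.
  have [|fm|//] := main m.-1; first by rewrite prednK ?order_gt0.
  have m1 : (m.-1 < m)%N by rewrite prednK ?order_gt0.
  have bE : beta m.-1 = b by rewrite -dih_rho // dih_refl_last.
  have [|d1 d0] := @plane_unique (D m.-1.+1) (D m.-1) 0 1.
    by rewrite -/(beta m.-1) bE; vring.
  move: fm; rewrite /f d1 d0 mul0r mul1r sub0r oppr_ge0 => x1.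
  exists m.-1 => //; rewrite dih_refl_last; apply: (@rho_scale _ _ z).
  by rewrite wE (_ : x = 0) ?scale0r ?add0r //; apply/eqP; rewrite eq_le x0 x1.
elim: k => [|k IH] km; first by left; rewrite /f mul1r mul0r subr0.
have [fk|] := IH (ltnW km); last by right.
have [fk1|fk1] := leP 0 (f k.+1); first by left.
by right; exists k; [exact: ltnW|apply: sector].
Qed.

Lemma dih_det_gt0 (h l : nat) : (h < l)%N -> (l < m)%N -> 0 < D h.+1 * D l - D h * D l.+1.
Proof.
move=> hl lm; rewrite -(subnKC (ltnW hl)) dih_coef_det.
have l0 : (l - h).-1.+1 = (l - h)%N by lia.
by rewrite -l0; have [|_ _] := @dih_coef_ge0 (l - h).-1; [lia|apply; lia].
Qed.

Lemma dih_refl_mod (k : nat) : v (k %% m)%N = v k.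
Proof. by apply/val_inj; rewrite !dih_reflE expg_mod_order. Qed.

Lemma plane_act (x : gT) y : x \in <<[set val p; val q]>>%g -> plane p q (rG x *m y - y).
Proof.
case/gen_prodgP=> k [f fpq ->]; elim: k f fpq y => [|k IH] f fpq y.
  by rewrite big_ord0 act1 subrr; exists 0, 0; vring.
rewrite big_ord_recl actM; set z := rG _ *m y.
have [x1 [z1 e1]] : plane p q (z - y) by apply: IH => l; apply: fpq.
have [w [e wE]] : exists w, val w = f ord0 /\ (w = p \/ w = q).
  by have := fpq ord0; rewrite !inE => /orP[] /eqP->; [exists p|exists q]; auto.
rewrite -e act_refl /reflv -(subrK (y) (z - _)) addrK addrAC e1.
by case: wE => ->; [exists (x1 - 2 * dotp z a), z1|exists x1, (z1 - 2 * dotp z b)]; vring.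
Qed.

Lemma dih_mem w :
  val w \in <<[set val p; val q]>>%g <-> exists2 h, (h < m)%N & v h = w.
Proof.
split=> [wP|[h _ <-]].
  have [x [z e]] := plane_act (rho w) wP.
  have [|h hm ->] := @dih_complete w; last by exists h.
  (* w moves ρ w by - 2 ρ w, and this displacement lies in the plane by [plane_act]. *)
  exists (- (x / 2)), (- (z / 2)); apply: (@scalerI _ _ (- 2 : R)).
    by rewrite oppr_eq0 pnatr_eq0.
  transitivity (rG (val w) *m rho w - rho w).
    by rewrite act_refl (reflvv (rho1 w)); vring.
  by rewrite e scalerDr !scalerA; congr (_ *: _ + _ *: _); field.
have pP : val p \in <<[set val p; val q]>>%g by rewrite mem_gen // !inE eqxx.
have qP : val q \in <<[set val p; val q]>>%g by rewrite mem_gen // !inE eqxx orbT.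
by rewrite dih_reflE groupM // groupX // groupM.
Qed.

Lemma dih_parabolic (i j : 'I_n) g0 : val p = (s i ^ g0)%g -> val q = (s j ^ g0)%g ->
  (<<[set s i; s j]>> :^ g0 = <<[set val p; val q]>>)%g.
Proof. by move=> -> ->; rewrite -genJ conjUg !conjg_set1. Qed.

Lemma dih_simple w :
  simple_reflection rG alpha <<[set val p; val q]>>%g w <-> w = v 0%N \/ w = v m.-1.
Proof.
have m1 := dih_order_gt1.
split=> [[/dih_mem[h hm <-] nc]|wE].
  have [->|h0] := eqVneq h 0%N; first by left.
  have [->|h1] := eqVneq h m.-1; first by right.
  case: nc; have [d0 d1 _] := dih_coef_ge0 hm.
  exists (fun w => if w == p then D h.+1 else if w == q then D h else 0).
    by move=> x; case: ifP => // _; case: ifP.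
  have vp : v 0%N = p by [].
  have hp : p != v h.
    by rewrite -vp; apply: contra_neq h0 => /dih_refl_inj <- //; rewrite order_gt0.
  have hq : q != v h.
    rewrite -dih_refl_last; apply: contra_neq h1 => /esym/dih_refl_inj -> //.
    by rewrite prednK ?order_gt0.
  rewrite (bigD1 p) /=; last by rewrite !inE hp andbT mem_gen // !inE eqxx.
  rewrite (bigD1 q) /=; last by rewrite !inE hq eq_sym pq !andbT mem_gen // !inE eqxx orbT.
  rewrite big1 ?addr0 => [|x /andP[/andP[_ /negPf->] /negPf->]]; last by rewrite scale0r.
  by rewrite eqxx eq_sym (negPf pq) eqxx dih_rho.
have wpq : w = p \/ w = q by case: wE => ->; [left|right; rewrite dih_refl_last].
have wP : val w \in <<[set val p; val q]>>%g by case: wpq => ->; rewrite mem_gen // !inE eqxx ?orbT.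
split=> // -[c c0 e].
(* Every root of the subgroup other than a has a positive b-coordinate, and every one other than b
   has a positive a-coordinate. So neither a nor b is a nonnegative combination of the others. *)
have /fin_all_exists2[xz xz0 xzE] (x : refl s) : exists2 xz : R * R,
    [/\ 0 <= xz.1, 0 <= xz.2 & val x \in <<[set val p; val q]>>%g -> (x != p -> 0 < xz.2) /\ (x != q -> 0 < xz.1)] &
    val x \in <<[set val p; val q]>>%g -> rho x = xz.1 *: a + xz.2 *: b.
  have [/dih_mem[h hm <-]|xP] := boolP (val x \in _); last by exists (0, 0) => //=; rewrite (negPf xP).
  have [d0 d1 _] := dih_coef_ge0 hm; exists (D h.+1, D h) => /= [|_]; last exact: dih_rho.
  split=> // _; rewrite !lt_def d0 d1 !andbT; split.
    apply: contra_neq => e0; apply: (@rho_scale _ _ (D h.+1)).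
    by rewrite dih_rho // /beta e0 scale0r addr0.
  apply: contra_neq => e0; apply: (@rho_scale _ _ (D h)).
  have {}e0 : D h.+1 = 0 := e0.
  by rewrite dih_rho // /beta e0 scale0r add0r.
pose S := [set u : refl s | (val u \in <<[set val p; val q]>>%g) && (u != w)].
have wS : rho w = (\sum_(u in S) c u * (xz u).1) *: a + (\sum_(u in S) c u * (xz u).2) *: b.
  rewrite e !scaler_suml -big_split; apply: eq_bigr => u; rewrite inE => /andP[uP _].
  by rewrite xzE // scalerDr !scalerA.
have nonneg u : 0 <= c u * (xz u).1 /\ 0 <= c u * (xz u).2.
  by have [? ? _] := xz0 u; split; apply: mulr_ge0.
have c0' : (forall u, u \in S -> c u = 0) -> False.
  move=> cS; have := rho_neq0 w; rewrite e big1 ?eqxx // => u uS.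
  by rewrite cS // scale0r.
case: wpq => we; apply: c0' => u uS; have := uS; rewrite inE => /andP[uP uw].
  have [|_ S0] := @plane_unique (\sum_(u in S) c u * (xz u).1) (\sum_(u in S) c u * (xz u).2) 1 0.
    by rewrite -wS we; vring.
  have /eqP := psumr_eq0P (fun (z : refl s) _ => proj2 (nonneg z)) S0 (i := u) uS.
  have [_ _ /(_ uP)[+ _]] := xz0 u; rewrite -we => /(_ uw) x0.
  by rewrite mulf_eq0 (gt_eqF x0) orbF => /eqP.
have [|S0 _] := @plane_unique (\sum_(u in S) c u * (xz u).1) (\sum_(u in S) c u * (xz u).2) 0 1.
  by rewrite -wS we; vring.
have /eqP := psumr_eq0P (fun (z : refl s) _ => proj1 (nonneg z)) S0 (i := u) uS.
have [_ _ /(_ uP)[_]] := xz0 u; rewrite -we => /(_ uw) x0.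
by rewrite mulf_eq0 (gt_eqF x0) orbF => /eqP.
Qed.

Lemma dih_monotone (i j : 'I_n) g0 : i != j ->
  val p = (s i ^ g0)%g -> val q = (s j ^ g0)%g ->
  (forall h l : nat, (h < l)%N -> (l < m)%N -> prec (v h) (v l)) \/
  (forall h l : nat, (h < l)%N -> (l < m)%N -> prec (v l) (v h)).
Proof.
move=> ij pE qE; have [_ /(_ i j g0 ij)] := hprec.
rewrite (dih_parabolic pE qE) => /(_ m.-1 (fun h => v h)).
have mE : m.-1.+1 = m by rewrite prednK ?order_gt0.
have ltm (h : 'I_m.-1.+1) : (h < m)%N by apply: leq_trans (ltn_ord h) _; rewrite mE.
case=> [h l|w|h|w|mono|mono].
- by move=> /(dih_refl_inj (ltm h) (ltm l)) e; apply/val_inj.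
- split=> [/dih_mem[h hm <-]|[h <-]]; first by rewrite -mE in hm; exists (Ordinal hm).
  by apply/dih_mem; exists h.
- have e k : v (k %% m.-1.+1) = v k by rewrite mE dih_refl_mod.
  rewrite /= !e dih_reflS -mulgA refl_invol mulg1.
  (* Adding a full period makes every index a successor, so that the cyclic predecessor of index 0
     is covered too. *)
  have per (k : nat) : v k = v (k + m.-1.+1).-1.+1.
    by rewrite addnS succnK -addnS mE; apply/val_inj; rewrite !dih_reflE expgD expg_order mulg1.
  rewrite (per h).
  by rewrite dih_reflS -mulgA refl_invol mulg1.
- exact: dih_simple.
- left=> h l hl lm; rewrite -mE in lm.
  exact: (mono (Ordinal (ltn_trans hl lm)) (Ordinal lm)).
- right=> h l hl lm; rewrite -mE in lm.
  exact: (mono (Ordinal (ltn_trans hl lm)) (Ordinal lm)).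
Qed.

End Dihedral.

Lemma prec_trans : transitive prec.
Proof. by case: hprec => -[]. Qed.

Lemma prec_irr : irreflexive prec.
Proof. by case: hprec => -[]. Qed.

Lemma prec_total t u : t != u -> prec t u || prec u t.
Proof. by case: hprec => -[] _ _ tot _; apply: tot. Qed.

Lemma prec_asym t u : prec t u -> ~~ prec u t.
Proof. by move=> tu; apply/negP => /(prec_trans tu); rewrite prec_irr. Qed.

Lemma prec_neq t u : prec t u -> t != u.
Proof. by apply: contraTneq => ->; rewrite prec_irr. Qed.

Lemma rank2_dihedral t u : t != u -> exists p q : refl s,
  [/\ p != q, plane p q (rho t), plane p q (rho u),
   forall w, plane p q (rho w) ->
      exists a b : R, [/\ 0 <= a, 0 <= b & rho w = a *: rho p + b *: rho q]
   & let v := dih_refl p q in let m := #[val p * val q]%g in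
     (forall h l : nat, (h < l)%N -> (l < m)%N -> prec (v h) (v l)) \/
     (forall h l : nat, (h < l)%N -> (l < m)%N -> prec (v l) (v h))].
Proof.
move=> tu; have [i [j [g [p [q [ij pE qE [pq tp tq cone]]]]]]] := rank2_parabolic tu.
have cone' w : plane p q (rho w) ->
      exists a b : R, [/\ 0 <= a, 0 <= b & rho w = a *: rho p + b *: rho q].
  move=> [a [b wE]]; apply: cone; case: tp tq wE => [a1 [b1 ->]] [a2 [b2 ->]] ->.
  by exists (a * a1 + b * a2), (a * b1 + b * b2); vring.
exists p, q; split=> //.
- have [|a [b [_ _ ->]]] := cone t; last by exists a, b.
  by exists 1, 0; vring.
- have [|a [b [_ _ ->]]] := cone u; last by exists a, b.
  by exists 0, 1; vring.
- exact: dih_monotone pq cone' _ _ _ ij pE qE.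
Qed.

(** Determinants place t between t1 and t2 in the angular numbering of their dihedral parabolic,
    along which ≺ is monotone. *)
Lemma prec_between t t1 t2 (x z : R) : 0 < x -> 0 < z -> t != t1 -> t != t2 ->
  rho t = x *: rho t1 + z *: rho t2 ->
  (prec t1 t && prec t t2) || (prec t2 t && prec t t1).
Proof.
move=> x0 z0 tt1 tt2 tE.
have t12 : t1 != t2.
  apply: contra_neq tt1 => e; apply: (@rho_scale _ _ (x + z)).
  by rewrite tE e; vring.
have [p [q [pq p1 p2 cone mono]]] := rank2_dihedral t12.
have pt : plane p q (rho t).
  case: p1 p2 tE => [a1 [b1 ->]] [a2 [b2 ->]] ->.
  by exists (x * a1 + z * a2), (x * b1 + z * b2); vring.
have [h hm tv] := dih_complete pq cone pt.
have [h1 h1m t1v] := dih_complete pq cone p1.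
have [h2 h2m t2v] := dih_complete pq cone p2.
pose D := dih_coef p q.
have [d1 d0] : D h.+1 = x * D h1.+1 + z * D h2.+1 /\ D h = x * D h1 + z * D h2.
  apply: (@plane_unique p q pq); rewrite -/(dih_root p q h) -dih_rho // -tv tE t1v t2v.
  by rewrite !dih_rho // /dih_root /D; vring.
have det (k l : nat) : (k < #[val p * val q]%g)%N -> (l < #[val p * val q]%g)%N ->
    0 < D k.+1 * D l - D k * D l.+1 -> (k < l)%N.
  move=> km lm d; rewrite ltnNge; apply: contraTN d; rewrite leq_eqVlt => /orP[/eqP->|lk].
    by rewrite mulrC subrr ltxx.
  by rewrite -leNgt -oppr_ge0 opprB ltW // [_ * D l.+1]mulrC [_ * D l]mulrC; apply: dih_det_gt0.
have order : (h1 < h)%N && (h < h2)%N || (h2 < h)%N && (h < h1)%N.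
  have [h12|h21|h12] := ltngtP h1 h2; last by case/eqP: t12; rewrite t1v t2v h12.
    have := dih_det_gt0 pq cone h12 h2m; rewrite -/D => d.
    have -> : (h1 < h)%N.
      apply: det => //; rewrite d0 d1.
      by rewrite (_ : _ - _ = z * (D h1.+1 * D h2 - D h1 * D h2.+1)) ?mulr_gt0 //; ring.
    have -> // : (h < h2)%N; apply: det => //; rewrite d0 d1.
    by rewrite (_ : _ - _ = x * (D h1.+1 * D h2 - D h1 * D h2.+1)) ?mulr_gt0 //; ring.
  have := dih_det_gt0 pq cone h21 h1m; rewrite -/D => d.
  have -> : (h2 < h)%N.
    apply: det => //; rewrite d0 d1.
    by rewrite (_ : _ - _ = x * (D h2.+1 * D h1 - D h2 * D h1.+1)) ?mulr_gt0 //; ring.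
  have -> : (h < h1)%N; last by rewrite orbT.
  apply: det => //; rewrite d0 d1.
  by rewrite (_ : _ - _ = z * (D h2.+1 * D h1 - D h2 * D h1.+1)) ?mulr_gt0 //; ring.
rewrite tv t1v t2v.
by case: mono => mono; case/orP: order => /andP[o1 o2];
  rewrite (mono _ _ o1) // (mono _ _ o2) ?orbT.
Qed.

Local Notation pr l := (\prod_(t <- l) val t)%g.

(** * Absolute length and the form E *)

Lemma prod_of_reflectionsP w k :
  reflect (exists2 l : seq (refl s), size l = k & pr l = w) (prod_of_reflections s w k).
Proof.
apply: (iffP existsP) => [[l /eqP lw]|[l lk lw]]; first by exists l; rewrite ?size_tuple.
have lk' : size l == k by rewrite lk.
by exists (Tuple lk'); apply/eqP.
Qed.

Lemma prod_of_reflections_ex w : exists k, prod_of_reflections s w k.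
Proof.
elim/coxeter_ind: w => [|i g [k /prod_of_reflectionsP[l lk lg]]].
  by exists 0%N; apply/prod_of_reflectionsP; exists [::]; rewrite ?big_nil.
have [t ti _] := alpha_simple i.
by exists k.+1; apply/prod_of_reflectionsP; exists (t :: l); rewrite /= ?lk ?big_cons ?lg ?ti.
Qed.

Lemma abs_lengthP w :
  (exists2 l : seq (refl s), size l = abs_length s w & pr l = w) /\
  (forall l : seq (refl s), pr l = w -> (abs_length s w <= size l)%N).
Proof.
rewrite /abs_length; case: pselect => [ex|]; last by case; apply: prod_of_reflections_ex.
case: ex_minnP => k /prod_of_reflectionsP kw kmin; split=> // l lw.
by apply/kmin/prod_of_reflectionsP; exists l.
Qed.

Lemma refl_neq1 t : val t != 1%g.
Proof.
apply/eqP => t1; have := act_refl t (rho t); rewrite t1 act1 reflvv ?rho1 // => e {t1}.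
by have := rho1 t; rewrite {2}e dotpNr rho1 => {e} ?; lra.
Qed.

Lemma abs_length1 : abs_length s 1%g = 0%N.
Proof.
have [_ /(_ [::])] := abs_lengthP 1%g; rewrite big_nil => /(_ erefl).
by rewrite leqn0 => /eqP.
Qed.

Lemma abs_length_refl t : abs_length s (val t) = 1%N.
Proof.
have [[l lk lw] /(_ [:: t])] := abs_lengthP (val t).
rewrite big_seq1 => /(_ erefl); rewrite /= leq_eqVlt => /orP[/eqP//|].
rewrite ltnS leqn0 -lk => /eqP/size0nil l0; move: lw; rewrite l0 big_nil => /esym/eqP.
by rewrite (negPf (refl_neq1 t)).
Qed.

Lemma abs_length_eq1 w : abs_length s w = 1%N -> exists t, val t = w.
Proof.
move=> w1; have [[l lk <-] _] := abs_lengthP w; move: lk; rewrite w1.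
by case: l => [|t [|]] // _; exists t; rewrite big_seq1.
Qed.

(** If w = x y, then w moves the part of ρ x orthogonal to ρ y by a nonzero multiple of ρ x, and
    displacements under w lie in the plane. Conversely, a product of three reflections of a dihedral
    group is a reflection. *)
Lemma NC2_dihedral_le (p q t u x : refl s) : p != q ->
   (forall w, plane p q (rho w) ->
      exists a b : R, [/\ 0 <= a, 0 <= b & rho w = a *: rho p + b *: rho q]) ->
   plane p q (rho t) -> plane p q (rho u) -> abs_length s (val t * val u)%g = 2%N ->
  abs_le s (val x) (val t * val u)%g <-> plane p q (rho x).
Proof.
move=> pq cone pt pu tu2; have w1 : (val t * val u)%g <> 1%g.
  by move=> tu1; move: tu2; rewrite tu1 abs_length1.
have wP : (val t * val u)%g \in <<[set val p; val q]>>%g.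
  have [h1 h1m ->] := dih_complete pq cone pt; have [h2 h2m ->] := dih_complete pq cone pu.
  by rewrite groupM //; apply/(dih_mem pq cone); [exists h1|exists h2].
rewrite /abs_le abs_length_refl tu2 -[2%N]/(1 + 1)%N eqn_add2l.
split=> [/eqP/abs_length_eq1[y yE]|px].
  have wE : (val t * val u = val x * val y)%g by rewrite yE mulKVg.
  have xy : x != y by apply: contra_not_neq w1 => e; rewrite wE e refl_invol.
  have := rho_dot_lt1 xy; set c := dotp _ _ => c1.
  have := plane_act (rho x - c *: rho y) wP; rewrite wE actM !act_refl.
  have -> : reflv (rho y) (rho x - c *: rho y) = rho x - c *: rho y.
    by rewrite /reflv !dotp_lin rho1 -/c; vring.
  rewrite /reflv !dotp_lin rho1 (dotpC (rho y)) -/c => -[a [b e]].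
  exists (- (2 * (1 - c ^+ 2))^-1 * a), (- (2 * (1 - c ^+ 2))^-1 * b).
  rewrite -!scalerA -scalerDr -e; move: c1; set d := 1 - c ^+ 2 => d0.
  rewrite (_ : _ - _ = - (2 * d) *: rho x).
    by rewrite scalerA mulrNN mulVf ?scale1r // mulf_neq0 ?pnatr_eq0 ?gt_eqF.
  by rewrite /d; vring.
have [h hm ->] := dih_complete pq cone px.
have [h1 h1m ->] := dih_complete pq cone pt; have [h2 h2m ->] := dih_complete pq cone pu.
rewrite refl_inv mulgA.
pose v := dih_refl p q; rewrite -/v.
suff -> : (val (v h) * val (v h1) * val (v h2) = val (v (h + #[val p * val q]%g - h1 + h2)%N))%g.
  by rewrite abs_length_refl.
have vD (k l : nat) : val (v (k + l)%N) = ((val p * val q) ^+ k * val (v l))%g.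
  by rewrite !dih_reflE expgD mulgA.
have -> : val (v h) = val (v (h + #[val p * val q]%g - h1 + h1)%N).
  by rewrite subnK; [rewrite addnC vD expg_order mul1g | lia].
by rewrite !vD -!mulgA; congr (_ * _)%g; rewrite mulgA refl_invol mul1g.
Qed.

(** By c-compatibility, [t u] is either a product of neighbours in decreasing order, whose dot
    product is - g ≥ 0, or the first reflection times the last; the latter two are the simple ones
    and have dot product g ≤ 0. *)
Lemma NC2_dot t u : t != u -> (val t * val u)%g \in NC s 2 ->
  (prec u t -> 0 <= dotp (rho t) (rho u)) /\ (prec t u -> dotp (rho t) (rho u) <= 0).
Proof.
move=> tu wNC; have := wNC; rewrite inE => /andP[_ /eqP w2].
have [p [q [pq pt pu cone mono]]] := rank2_dihedral tu.
have leE (x : refl s) := NC2_dihedral_le x pq cone pt pu w2.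
pose v := dih_refl p q; set m := #[val p * val q]%g in mono.
have m1 : (1 < m)%N := dih_order_gt1 pq.
have mE : m.-1.+1 = m by rewrite prednK ?order_gt0.
have ltm (h : 'I_m.-1.+1) : (h < m)%N by apply: leq_trans (ltn_ord h) _; rewrite mE.
have split_r (x y : refl s) : plane p q (rho x) -> (val x * val y = val p * val q)%g ->
    (exists2 h : nat, (h.+1 < m)%N & x = v h.+1 /\ y = v h) \/ (x = v 0%N /\ y = v m.-1).
  move=> /(dih_complete pq cone)[h hm xE] xy; have yE z : (val x * val z = val p * val q)%g -> y = z.
    by move=> xz; apply/val_inj/(mulgI (val x)); rewrite xy xz.
  case: h hm xE => [|h] hm xE; [right|left; exists h => //]; split=> //; apply: yE; rewrite xE.
    by rewrite /v dih_refl_last.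
  by rewrite dih_reflS -mulgA refl_invol mulg1.
have dot_r (x y : refl s) (h : nat) : (h.+1 < m)%N -> x = v h.+1 -> y = v h -> 0 <= dotp (rho x) (rho y).
  move=> hm -> ->; rewrite !dih_rho ?(ltnW hm) // dotpC dih_dot oppr_ge0.
  exact: dih_dot_le0.
have dot_0 (x y : refl s) : x = v 0%N -> y = v m.-1 -> dotp (rho x) (rho y) <= 0.
  by move=> -> ->; rewrite /v dih_refl_last; apply: dih_dot_le0.
have predE (h : 'I_m.-1.+1) : (0 < h)%N -> ord_pred h = h.-1 :> nat.
  move=> h0; rewrite -[LHS]/((h + m.-1.+1).-1 %% m.-1.+1)%N -{1}(prednK h0) addSn succnK.
  by rewrite modnDr modn_small // (leq_ltn_trans (leq_pred h)).
case: mono => mono.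
  have wE : (val t * val u = val p * val q)%g.
    rewrite (hc wNC (u := fun h : 'I_m.-1.+1 => v h) _ _ ord_max).
    - rewrite predE; last by rewrite /= -ltnS mE.
      rewrite /= (_ : m.-1 = m.-1.-1.+1) /=; last by rewrite prednK // -ltnS mE.
      by rewrite [sval _]dih_reflS -mulgA refl_invol mulg1.
    - by move=> h l hl; apply: mono.
    - move=> x; rewrite leE; split=> [/(dih_complete pq cone)[h hm ->]|[h <-]].
        by rewrite -/m -mE in hm; exists (Ordinal hm).
      by exists (dih_coef p q h.+1), (dih_coef p q h); rewrite dih_rho.
  have [[h hm [tE uE]]|[tE uE]] := split_r _ _ pt wE.
    split; first by move=> _; apply: dot_r hm _ _.
    by rewrite tE uE => /prec_asym; rewrite mono.
  split; last by move=> _; apply: dot_0.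
  by rewrite tE uE => /prec_asym; rewrite mono // -ltnS mE.
(* Here ≺ runs against the angular order: the increasing list is h ↦ v (m - 1 - h), and t u is the
   inverse of p q. *)
have wE : (val u * val t = val p * val q)%g.
  have : (val t * val u = val (v 0%N) * val (v 1%N))%g.
    rewrite (hc wNC (u := fun h : 'I_m.-1.+1 => v (m.-1 - h)%N) _ _ ord_max).
    - rewrite predE; last by rewrite /= -ltnS mE.
      have -> : (m.-1 - (ord_max : 'I_m.-1.+1) = 0)%N by rewrite /= subnn.
      by have -> : (m.-1 - (ord_max : 'I_m.-1.+1).-1 = 1)%N by rewrite /=; lia.
    - by move=> h l hl; apply: mono; have := ltm l; lia.
    - move=> x; rewrite leE; split=> [/(dih_complete pq cone)[h hm ->]|[h <-]].
        have hm' : (m.-1 - h < m.-1.+1)%N by lia.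
        by exists (Ordinal hm'); congr (v _) => /=; rewrite -/m in hm; lia.
      exists (dih_coef p q (m.-1 - h).+1), (dih_coef p q (m.-1 - h)).
      by rewrite dih_rho //; have := ltm h; rewrite -/m; lia.
  move/(congr1 (fun g => g^-1%g)); rewrite !invMg !refl_inv => ->.
  by rewrite -mulgA refl_invol mulg1.
have [[h hm [uE tE]]|[uE tE]] := split_r _ _ pu wE.
  split; first by move=> _; rewrite dotpC; apply: dot_r hm _ _.
  by rewrite tE uE => /prec_asym; rewrite mono.
split; last by move=> _; rewrite dotpC; apply: dot_0.
by rewrite tE uE => /prec_asym; rewrite mono // -ltnS mE.
Qed.

(* Linear combinations of [f t], t in l, with nonnegative coefficients if [nneg]. *)
Fixpoint comb (nneg : bool) (f : refl s -> 'cV[R]_n) (l : seq (refl s)) (x : 'cV[R]_n) : Prop :=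
  if l is t :: l' then
    exists a, (nneg -> 0 <= a) /\ comb nneg f l' (x - a *: f t)
  else x = 0.

Implicit Types (nneg : bool) (l : seq (refl s)) (f : refl s -> 'cV[R]_n).

Lemma comb_ind nneg f l (Q : 'cV[R]_n -> Prop) : Q 0 ->
  (forall a t y, (nneg -> 0 <= a) -> t \in l -> Q y -> Q (y + a *: f t)) ->
  forall x, comb nneg f l x -> Q x.
Proof.
move=> Q0; elim: l => [|t l IH] QS x /=; first by move->.
move=> [a [a0 xl]]; rewrite -(subrK (a *: f t) x).
apply: (QS); rewrite ?mem_head //; apply: IH xl => b u y b0 ul; apply: QS => //.
by rewrite inE ul orbT.
Qed.

Lemma comb0 nneg f l : comb nneg f l 0.
Proof.
elim: l => //= t l IH; exists 0; split; first by rewrite lexx.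
by rewrite scale0r subr0.
Qed.

Lemma combD nneg f l x y : comb nneg f l x -> comb nneg f l y -> comb nneg f l (x + y).
Proof.
elim: l x y => [|t l IH] x y /=; first by move=> -> ->; rewrite addr0.
move=> [a [a0 xl]] [b [b0 yl]]; exists (a + b); split.
  by move=> nn; rewrite addr_ge0 ?a0 ?b0.
by rewrite (_ : _ - _ = (x - a *: f t) + (y - b *: f t)); [apply: IH|vring].
Qed.

Lemma combZ nneg f l (a : R) x : (nneg -> 0 <= a) -> comb nneg f l x -> comb nneg f l (a *: x).
Proof.
move=> a0; elim: l x => [|t l IH] x /=; first by move->; rewrite scaler0.
move=> [b [b0 xl]]; exists (a * b); split; first by move=> nn; rewrite mulr_ge0 ?a0 ?b0.
by rewrite -scalerA -scalerBr; apply: IH.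
Qed.

Lemma combN f l x : comb false f l x -> comb false f l (- x).
Proof. by rewrite -scaleN1r; apply: combZ. Qed.

Lemma combB f l x y : comb false f l x -> comb false f l y -> comb false f l (x - y).
Proof. by move=> xl /combN; apply: combD. Qed.

Lemma comb_mem nneg f l t : t \in l -> comb nneg f l (f t).
Proof.
elim: l => //= u l IH; rewrite inE => /orP[/eqP->|tl].
  by exists 1; split; rewrite ?ler01 // scale1r subrr; apply: comb0.
by exists 0; split; rewrite ?lexx // scale0r subr0; apply: IH.
Qed.

Lemma comb_sub nneg f f' l l' : (forall t, t \in l -> comb nneg f' l' (f t)) ->
  forall x, comb nneg f l x -> comb nneg f' l' x.
Proof.
move=> sub x; apply: comb_ind => [|a t y a0 tl yl]; first exact: comb0.
by apply: combD => //; apply: combZ => //; apply: sub.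
Qed.

Lemma comb_weak f l x : comb true f l x -> comb false f l x.
Proof.
elim: l x => //= t l IH x [a [a0 xl]]; exists a; split=> //; exact: IH.
Qed.

Lemma comb_sum nneg (I : Type) (r : seq I) (F : I -> 'cV[R]_n) f l :
  (forall i, comb nneg f l (F i)) -> comb nneg f l (\sum_(i <- r) F i).
Proof.
move=> Fl; elim: r => [|i r IH]; first by rewrite big_nil; apply: comb0.
by rewrite big_cons; apply: combD.
Qed.

Local Notation span := (comb false rho).

Lemma span_sign f l x : (forall t, f t = rho t \/ f t = - rho t) ->
  comb false f l x <-> span l x.
Proof.
move=> fE; split; apply: comb_sub => t tl; case: (fE t) => e.
- by rewrite e; apply: comb_mem.
- by rewrite e; apply/combN/comb_mem.
- by rewrite -e; apply: comb_mem.
- by rewrite -[rho t]opprK -e; apply/combN/comb_mem.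
Qed.

(** Each letter moves a vector by a multiple of its own root. *)
Lemma span_telescope l y : span l (y - rG (pr l) *m y).
Proof.
elim: l y => [|t l IH] y; first by rewrite big_nil act1 subrr.
rewrite big_cons actM act_refl /reflv /=; set z := rG _ *m y.
exists (2 * dotp z (rho t)); split=> //.
by rewrite opprB addrA addrAC addrK; apply: IH.
Qed.

(** A spanning list provides a right inverse of the matrix whose columns are its roots. *)
Lemma span_size l : (forall x, span l x) -> (n <= size l)%N.
Proof.
move=> full; pose A := \matrix_(i < n, j < size l) rho (tnth (in_tuple l) j) i 0.
have AP x : exists v : 'cV_(size l), A *m v = x.
  apply: (comb_ind (Q := fun x => exists v : 'cV_(size l), A *m v = x)) (full x).
    by exists 0; rewrite mulmx0.
  move=> a t y _ tl [v vE].
  have /tnthP[j tj] : t \in in_tuple l by [].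
  exists (v + a *: delta_mx j 0); rewrite mulmxDr vE; congr (_ + _).
  by rewrite -scalemxAr -colE; apply/matrixP => i k; rewrite ord1 !mxE -tj.
have /fin_all_exists[B BE] j := AP (delta_mx j 0).
apply: (@mulmx1_min _ _ _ A (\matrix_(i, j) B j i 0)).
apply/matrixP => i j; move/matrixP/(_ i 0): (BE j); rewrite !mxE eqxx andbT => <-.
by apply: eq_bigr => k _; rewrite !mxE.
Qed.

Lemma span_free l1 t l2 : size (l1 ++ t :: l2) = n ->
  (forall x, span (l1 ++ t :: l2) x) -> ~ span (l1 ++ l2) (rho t).
Proof.
move=> sz full tl; have : (n <= size (l1 ++ l2))%N.
  apply: span_size => x; apply: comb_sub (full x) => u.
  rewrite mem_cat inE => /or3P[ul|/eqP->|ul].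
  - by apply: comb_mem; rewrite mem_cat ul.
  - exact: tl.
  - by apply: comb_mem; rewrite mem_cat ul orbT.
by move=> le; have := sz; rewrite !size_cat /= in le *; lia.
Qed.

Lemma span_scale l t (a : R) : ~ span l (rho t) -> span l (a *: rho t) -> a = 0.
Proof.
move=> tl al; apply: contra_not_eq tl => a0.
by rewrite -[rho t]scale1r -(mulVf a0) -scalerA; apply: combZ.
Qed.

Definition rfree l := forall l1 t l2, l = l1 ++ t :: l2 -> ~ span (l1 ++ l2) (rho t).

(** The first letter must undo the displacement of y by the remaining ones. The two displacements
    lie in independent spaces, so both vanish. *)
Lemma fix_orth l y : rfree l ->
  rG (pr l) *m y = y -> forall t, t \in l -> dotp y (rho t) = 0.
Proof.
elim: l => [|t l IH] free //; rewrite big_cons actM => e.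
have e' : rG (pr l) *m y = reflv (rho t) y.
  by apply: (act_inj (g := val t)); rewrite /= e act_refl /reflv !dotp_lin rho1; vring.
have y0 : dotp y (rho t) = 0.
  have := span_telescope l y; rewrite e' /reflv opprB addrC subrK.
  move/(span_scale (free [::] t l erefl))/eqP.
  by rewrite mulf_eq0 pnatr_eq0 => /eqP.
have {}IH := IH _; move=> u; rewrite inE => /orP[/eqP->//|ul].
apply: IH => // [l1 v l2 lE|].
  move=> vl; apply: (free (t :: l1) v l2); first by rewrite lE.
  by apply: comb_sub vl => w wl; apply: comb_mem; rewrite inE wl orbT.
by rewrite e' /reflv y0 mulr0 scale0r subr0.
Qed.

Local Notation c := (coxeter_elt s).

Lemma exists_simple_list : exists l, [/\ size l = n, pr l = c, forall x, span l x
  & forall x, pos x -> comb true rho l x].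
Proof.
have /fin_all_exists[f fP] i : exists t : refl s, val t = s i /\ rho t = alpha i.
  by have [t tE ta] := alpha_simple i; exists t.
have fl i : f i \in [seq f i | i <- enum 'I_n] by rewrite map_f // mem_enum.
exists [seq f i | i <- enum 'I_n]; split.
- by rewrite size_map size_enum_ord.
- by rewrite big_map enumT; apply: eq_bigr => i _; case: (fP i).
- move=> x; set A := (\matrix_(i, j) alpha j i 0); have Au : A \in unitmx := real_basis hR.
  have -> : x = \sum_j (invmx A *m x) j 0 *: rho (f j).
    apply/matrixP => i k; rewrite ord1 summxE -[in LHS](mulKVmx Au x) mxE.
    by apply: eq_bigr => j _; rewrite !mxE (proj2 (fP j)) mulrC.
  by apply: comb_sum => j; apply/combZ/comb_mem.
- move=> x /pos_sum[a a0 ->]; apply: comb_sum => j; apply: combZ => //.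
  by rewrite -(proj2 (fP j)); apply: comb_mem.
Qed.

Definition one_sub_c : 'M[R]_n := 1%:M - rG c.
Local Notation M := one_sub_c.

Lemma one_sub_c_act x : M *m x = x - rG c *m x.
Proof. by rewrite mulmxBl mul1mx. Qed.

(** A vector fixed by c is orthogonal to all simple roots by [fix_orth], as these are independent,
    and they span the space. *)
Lemma one_sub_c_unit : M \in unitmx.
Proof.
rewrite -unitmx_tr -row_free_unit; apply: inj_row_free => v /(congr1 trmx).
rewrite trmx_mul trmxK trmx0 one_sub_c_act => /eqP; rewrite subr_eq0 => /eqP e.
apply: trmx_inj; rewrite trmx0; move: (v^T) e => y yE {v}.
have [l [ln lc full _]] := exists_simple_list.
have free : rfree l.
  by move=> l1 t l2 lE; apply: (@span_free l1); rewrite -?lE.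
have yl := fix_orth free (etrans (congr1 (fun g => rG g *m y) lc) (esym yE)).
apply: dotp_eq0; apply: (comb_ind (Q := fun x => dotp y x = 0)) (full y).
  by rewrite dotp0r.
by move=> a t z _ tl z0; rewrite !dotp_lin z0 yl // mulr0 addr0.
Qed.

Definition E x y := 2 * dotp x (invmx M *m y).

Lemma E_M x y : E x (M *m y) = 2 * dotp x y.
Proof. by rewrite /E mulKmx // one_sub_c_unit. Qed.

Lemma EDl x y z : E (x + y) z = E x z + E y z.
Proof. by rewrite /E dotpDl mulrDr. Qed.
Lemma EDr x y z : E x (y + z) = E x y + E x z.
Proof. by rewrite /E mulmxDr dotpDr mulrDr. Qed.
Lemma EZl (a : R) x y : E (a *: x) y = a * E x y.
Proof. by rewrite /E dotpZl mulrCA. Qed.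
Lemma EZr (a : R) x y : E x (a *: y) = a * E x y.
Proof. by rewrite /E -scalemxAr dotpZr mulrCA. Qed.
Lemma ENl x y : E (- x) y = - E x y.
Proof. by rewrite -scaleN1r EZl mulN1r. Qed.
Lemma ENr x y : E x (- y) = - E x y.
Proof. by rewrite -scaleN1r EZr mulN1r. Qed.
Lemma E0l x : E 0 x = 0.
Proof. by rewrite -(scale0r (0 : 'cV[R]_n)) EZl mul0r. Qed.
Lemma E0r x : E x 0 = 0.
Proof. by rewrite -(scale0r (0 : 'cV[R]_n)) EZr mul0r. Qed.
Definition E_lin := (EDl, EDr, ENl, ENr, EZl, EZr).

Lemma E_sym x y : E x y + E y x = 2 * dotp x y.
Proof.
rewrite -(mulKVmx one_sub_c_unit x) -(mulKVmx one_sub_c_unit y).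
move: (invmx M *m x) (invmx M *m y) => {}x {}y; rewrite !E_M !one_sub_c_act !dotp_lin.
by rewrite dotp_act (dotpC y x) (dotpC (rG c *m y)); ring.
Qed.

Lemma E_diag x : E x x = dotp x x.
Proof. by have := E_sym x x; lra. Qed.

Definition cfact l := pr l = c /\ size l = n.

Lemma cfact_span l : cfact l -> forall x, span l x.
Proof.
move=> [lc _] x; rewrite -(mulKVmx one_sub_c_unit x) one_sub_c_act -lc.
exact: span_telescope.
Qed.

(** Hurwitz rotation t w = w t^w; iterating it brings any letter of a factorization of c to the
    front. *)
Lemma cfact_rot t l : cfact (t :: l) -> cfact (rcons l (rconj t (pr l))).
Proof.
move=> [lc ln]; split; last by rewrite size_rcons.
by rewrite -lc big_cons big_rcons /= conjgE mulKVg.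
Qed.

Lemma cfact_rot_cat l1 l2 : cfact (l1 ++ l2) -> exists l3, cfact (l2 ++ l3).
Proof.
elim: l1 l2 => [|t l1 IH] l2 ; first by exists [::]; rewrite cats0.
by move/cfact_rot; rewrite -cats1 -catA => /IH[l3]; rewrite -catA => ?; eexists; eassumption.
Qed.

Lemma cfact_free l : cfact l -> rfree l.
Proof.
by move=> lc l1 t l2 lE; apply: span_free; rewrite -lE; [case: lc|apply: cfact_span].
Qed.

Lemma rfree_catl l1 l2 : rfree (l1 ++ l2) -> rfree l1.
Proof.
move=> free l3 t l4 lE tl; apply: (free l3 t (l4 ++ l2)); first by rewrite lE -catA.
by apply: comb_sub tl => u ul; apply: comb_mem; move: ul; rewrite !mem_cat => /orP[]->; rewrite ?orbT.
Qed.

Lemma rfree_cons t l : rfree (t :: l) -> rfree l.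
Proof.
move=> free l1 u l2 lE ul; apply: (free (t :: l1) u l2); first by rewrite lE.
by apply: comb_sub ul => v vl; apply: comb_mem; rewrite inE vl orbT.
Qed.

(** Let y = (1 - c)^-1 ρ t and c = t w. Then y - w y is a multiple of ρ t lying in the span of l,
    hence 0, and [fix_orth] makes y orthogonal to the roots of l. *)
Lemma cfact_head t l : cfact (t :: l) -> forall u, u \in l -> E (rho u) (rho t) = 0.
Proof.
move=> lc u ul; have tl := cfact_free lc (l1 := [::]) erefl.
pose y := invmx M *m rho t; have yE : y - rG c *m y = rho t.
  by rewrite -one_sub_c_act mulKVmx ?one_sub_c_unit.
have [prc _] := lc; rewrite big_cons in prc.
have wy : rG (pr l) *m y = y.
  have := span_telescope l y; move: yE; rewrite -prc actM act_refl /reflv.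
  set z := rG _ *m y => yE; have -> : y - z = (1 - 2 * dotp z (rho t)) *: rho t.
    by rewrite scalerBl scale1r -[X in _ = X - _]yE; vring.
  move/(span_scale tl) => z0; apply/eqP; rewrite -subr_eq0 -oppr_eq0 opprB.
  have -> : y - z = (1 - 2 * dotp z (rho t)) *: rho t.
    by rewrite scalerBl scale1r -[X in _ = X - _]yE; vring.
  by rewrite z0 scale0r.
by rewrite /E dotpC (fix_orth (rfree_cons (cfact_free lc)) wy ul) mulr0.
Qed.

(* The reduced words of noncrossing elements, see [eorth_ncl]. *)
Definition eorth := pairwise (fun t u => E (rho u) (rho t) == 0).

Lemma cfact_eorth l : cfact l -> eorth l.
Proof.
move=> lc; suff main l1 l2 : l = l1 ++ l2 -> eorth l2 by apply: (main [::]).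
elim: l2 l1 => [|t l2 IH] l1 lE //=; apply/andP; split; last first.
  by apply: (IH (rcons l1 t)); rewrite cat_rcons.
rewrite lE in lc; have [l3 l3c] := cfact_rot_cat lc.
by apply/allP => u ul; rewrite (cfact_head l3c) // mem_cat ul.
Qed.

Lemma cfact_size l : pr l = c -> (n <= size l)%N.
Proof.
move=> lc; apply: span_size => x.
rewrite -(mulKVmx one_sub_c_unit x) one_sub_c_act -lc; exact: span_telescope.
Qed.

Lemma abs_length_c : abs_length s c = n.
Proof.
have [[l lk lc] cmin] := abs_lengthP c; have [l0 [l0n l0c _ _]] := exists_simple_list.
by have := cfact_size lc; have := cmin _ l0c; rewrite lk l0n; lia.
Qed.

Lemma pr_cat l1 l2 : pr (l1 ++ l2) = (pr l1 * pr l2)%g.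
Proof. by rewrite big_cat. Qed.

(** A shorter word for either factor would give a word for c with fewer than n letters. *)
Lemma cfact_abs_le l1 l2 : cfact (l1 ++ l2) ->
  abs_length s (pr l1) = size l1 /\ abs_le s (pr l1) c.
Proof.
move=> [lc ln]; have l2E : ((pr l1)^-1 * c = pr l2)%g by rewrite -lc pr_cat mulKg.
have [[m1 m1k m1E] /(_ l1 erefl) le1] := abs_lengthP (pr l1).
have [[m2 m2k m2E] /(_ l2 erefl) le2] := abs_lengthP (pr l2).
have := @cfact_size (m1 ++ m2); rewrite pr_cat m1E m2E -pr_cat lc size_cat m1k m2k.
move=> /(_ erefl) le; rewrite size_cat in ln.
have e1 : abs_length s (pr l1) = size l1 by lia.
split=> //; rewrite /abs_le l2E abs_length_c; apply/eqP; lia.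
Qed.

Lemma pr_conj l g : pr [seq rconj t g | t <- l] = (pr l ^ g)%g.
Proof.
elim: l => [|t l IH]; first by rewrite !big_nil conj1g.
by rewrite /= !big_cons IH conjMg.
Qed.

(** After a rotation that puts t first, u is moved left past [l2], whose letters get conjugated by
    u. *)
Lemma cfact_pair l1 t l2 u l3 : cfact (l1 ++ t :: l2 ++ u :: l3) ->
  exists l, cfact (t :: u :: l).
Proof.
move/cfact_rot_cat=> [l4 [lc ln]]; exists ([seq rconj w (val u) | w <- l2] ++ l3 ++ l4).
split; last by move: ln; rewrite /= !(size_cat, size_map) /=; lia.
rewrite -lc !(big_cons, big_cat) /= pr_conj conjgE refl_inv !mulgA; congr (_ * _ * _)%g.
by rewrite -!mulgA [(val u * (val u * _))%g]mulgA refl_invol mul1g.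
Qed.

Lemma cfact_NC2 t u l : cfact (t :: u :: l) -> t != u /\ (val t * val u)%g \in NC s 2.
Proof.
move=> lc; split.
  have /andP[/andP[/eqP Eut _] _] := cfact_eorth lc.
  by apply: contra_eq_neq Eut => <-; rewrite E_diag rho1 oner_eq0.
have [lE le] := @cfact_abs_le [:: t; u] l lc.
have prE : pr [:: t; u] = (val t * val u)%g by rewrite !big_cons big_nil mulg1.
by rewrite inE -prE le lE eqxx.
Qed.

Lemma exists_height : exists d : 'cV[R]_n, forall t, 0 < dotp d (rho t).
Proof.
have [d dE] := exists_delta; exists d => t.
by apply: pos_dot => //; [exact: rho_pos|exact: rho_neq0].
Qed.

Local Notation N := #|{: refl s}|.

Definition rank_of t : nat := #|[set u | prec u t]|.

Lemma rank_of_lt t u : prec t u = (rank_of t < rank_of u)%N.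
Proof.
have lt (x y : refl s) : prec x y -> (rank_of x < rank_of y)%N.
  move=> xy; apply/proper_card/properP; split.
    by apply/subsetP => z; rewrite !inE => zx; apply: prec_trans xy.
  by exists x; rewrite !inE ?prec_irr.
have [->|tu] := eqVneq t u; first by rewrite prec_irr ltnn.
case/orP: (prec_total tu) => [h|h]; first by rewrite h lt.
by rewrite (negPf (prec_asym h)); have := lt _ _ h; case: ltngtP.
Qed.

Lemma rank_of_inj : injective rank_of.
Proof.
move=> t u e; apply/eqP; apply: contraT => /prec_total.
by rewrite !rank_of_lt e ltnn.
Qed.

Lemma rank_of_ltN t : (rank_of t < N)%N.
Proof.
rewrite -cardsT; apply/proper_card/properP; split; first exact: subsetT.
by exists t; rewrite !inE ?prec_irr.
Qed.

Lemma rank_of_onto (k : nat) : (0 < N)%N -> exists u, rank_of u = (k %% N)%N.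
Proof.
move=> N0; pose f u := Ordinal (rank_of_ltN u).
have fi : injective f by move=> x y [] /rank_of_inj.
have [g fK gK] : bijective f by apply: inj_card_bij => //; rewrite card_ord.
have kN : (k %% N < N)%N by rewrite ltn_mod.
by exists (g (Ordinal kN)); have := congr1 val (gK (Ordinal kN)).
Qed.

(** * Simple systems along the reflection ordering *)

(* Cutting the cyclic order on ±T after k steps: the first k reflections have
   their roots negated. *)
Definition flipped (k : nat) t := odd (k %/ N) (+) (rank_of t < k %% N)%N.
Definition sroot (k : nat) t := if flipped k t then - rho t else rho t.
Definition front (k : nat) u := rank_of u = (k %% N)%N.

Lemma flipped_front k u t : front k u -> flipped k t = flipped k u (+) prec t u.
Proof. by move=> ku; rewrite /flipped rank_of_lt -ku ltnn addbF. Qed.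

Lemma flippedS k u t : front k u -> flipped k.+1 t = flipped k t (+) (t == u).
Proof.
rewrite /front /flipped => ku; have uN := rank_of_ltN u.
have tu : (t == u) = (rank_of t == rank_of u) by rewrite (inj_eq rank_of_inj).
have [q kE] : exists q, k = (q * N + rank_of u)%N by exists (k %/ N)%N; rewrite ku -divn_eq.
have kq : (k %/ N = q)%N by rewrite kE divnMDl ?divn_small ?addn0 //; lia.
rewrite kq -ku; have [uN'|uN'] := ltnP (rank_of u).+1 N.
  have -> : (k.+1 %/ N = q)%N by rewrite kE -addnS divnMDl ?divn_small ?addn0 //; lia.
  have -> : (k.+1 %% N = (rank_of u).+1)%N by rewrite kE -addnS modnMDl modn_small.
  by rewrite tu -addbA; congr (_ (+) _); rewrite ltnS; case: ltngtP.
have -> : (k.+1 = q.+1 * N)%N by rewrite kE mulSn; lia.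
rewrite mulnK ?modnMl ?ltn0; last by lia.
rewrite tu /= addbF -addbA; have tN := rank_of_ltN t.
have : (rank_of t <= rank_of u)%N by lia.
by case: ltngtP => // *; rewrite /= addbT.
Qed.

Lemma flipped_addN k t : flipped (k + N) t = ~~ flipped k t.
Proof.
have N0 : (0 < N)%N by apply: leq_ltn_trans (rank_of_ltN t).
by rewrite /flipped divnDr ?divnn // N0 addn1 modnDr /= addNb.
Qed.

Lemma flipped_rank u t : flipped (rank_of u) t = prec t u.
Proof.
have uN := rank_of_ltN u.
by rewrite /flipped divn_small // modn_small // rank_of_lt.
Qed.

Lemma front_rank u : front (rank_of u) u.
Proof. by rewrite /front modn_small ?rank_of_ltN. Qed.

Lemma srootE k t : sroot k t = rho t \/ sroot k t = - rho t.
Proof. by rewrite /sroot; case: flipped; auto. Qed.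

Lemma sroot_addN k t : sroot (k + N) t = - sroot k t.
Proof. by rewrite /sroot flipped_addN; case: flipped; rewrite ?opprK. Qed.

Lemma srootS_neq k u t : front k u -> t != u -> sroot k.+1 t = sroot k t.
Proof. by move=> ku /negPf tu; rewrite /sroot (flippedS _ ku) tu addbF. Qed.

Lemma srootS_eq k u : front k u -> sroot k.+1 u = - sroot k u.
Proof.
move=> ku; rewrite /sroot (flippedS _ ku) eqxx addbT.
by case: flipped; rewrite ?opprK.
Qed.

Definition ncl l := exists l', cfact (l ++ l').
(* l is a reduced word of a noncrossing element made of the simple reflections of
   its parabolic subgroup, for the positive roots [sroot k]. *)
Definition slist (k : nat) l := ncl l /\ forall t, span l (rho t) -> comb true (sroot k) l (sroot k t).

Lemma ncl_eorth l : ncl l -> eorth l.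
Proof. by move=> [l' /cfact_eorth]; rewrite /eorth pairwise_cat => /and3P[]. Qed.

Lemma ncl_rfree l : ncl l -> rfree l.
Proof. by move=> [l' /cfact_free/rfree_catl]. Qed.

Lemma ncl_behead t l : ncl (t :: l) -> ncl l.
Proof.
move=> [l' /cfact_rot]; rewrite rcons_cat => ?; by eexists; eassumption.
Qed.

Lemma ncl_belast l t : ncl (rcons l t) -> ncl l.
Proof. by move=> [l' h]; exists (t :: l'); rewrite -cat_rcons. Qed.

Lemma eorth_uniq l : eorth l -> uniq l.
Proof.
elim: l => //= t l IH /andP[tl /IH->]; rewrite andbT.
by apply/negP => /(allP tl); rewrite E_diag rho1 oner_eq0.
Qed.

Lemma comb_perm nneg f l l' : l =i l' -> forall x, comb nneg f l x -> comb nneg f l' x.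
Proof. by move=> e x; apply: comb_sub => t; rewrite e; apply: comb_mem. Qed.

Lemma comb_map nneg f f' l l' (F : 'cV[R]_n -> 'cV[R]_n) :
  F 0 = 0 -> (forall a x y, F (x + a *: y) = F x + a *: F y) ->
  (forall t, t \in l -> comb nneg f' l' (F (f t))) ->
  forall x, comb nneg f l x -> comb nneg f' l' (F x).
Proof.
move=> F0 Flin sub; apply: comb_ind; first by rewrite F0; apply: comb0.
by move=> a t y a0 tl yl; rewrite Flin; apply: combD => //; apply: combZ => //; apply: sub.
Qed.

Lemma cone_span k l x : comb true (sroot k) l x -> span l x.
Proof. by move/comb_weak; apply: (proj1 (span_sign _ _ (srootE k))). Qed.

Lemma sroot_span k l t : span l (rho t) -> span l (sroot k t).
Proof. by case: (srootE k t) => -> // /combN. Qed.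

Lemma span_sroot k l t : span l (sroot k t) -> span l (rho t).
Proof. by case: (srootE k t) => -> // /combN; rewrite opprK. Qed.

Lemma span_sroot_scale k l t (a : R) : ~ span l (rho t) -> span l (a *: sroot k t) -> a = 0.
Proof.
move=> tl; case: (srootE k t) => ->; first exact: span_scale.
by rewrite scalerN -scaleNr => /(span_scale tl)/eqP; rewrite oppr_eq0 => /eqP.
Qed.

Lemma ncl_indep l t l' : ncl l -> t \in l -> t \notin l' -> {subset l' <= l} ->
  ~ span l' (rho t).
Proof.
move=> nl tl; have free := ncl_rfree nl; case/splitPr: tl free => l1 l2 free tl' sub h.
apply: (free l1 t l2 erefl); apply: comb_sub h => u ul; apply: comb_mem.
have := sub u ul; rewrite !mem_cat inE => /or3P[->//|/eqP e|->]; last by rewrite orbT.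
by rewrite -e ul in tl'.
Qed.

Lemma cone_pointed k l l' x : ncl l -> uniq l' -> {subset l' <= l} ->
  comb true (sroot k) l' x -> comb true (sroot k) l' (- x) -> x = 0.
Proof.
move=> nl; elim: l' x => //= t l' IH x /andP[tl' ul'] sub [a [/(_ isT) a0 xa]] [b [/(_ isT) b0 xb]].
have sub' : {subset l' <= l} by move=> u ul; apply: sub; rewrite inE ul orbT.
have ab : - (a + b) = 0.
  apply: (span_sroot_scale (k := k) (ncl_indep nl (sub _ (mem_head _ _)) tl' sub')).
  rewrite (_ : _ *: _ = (x - a *: sroot k t) + (- x - b *: sroot k t)); last by vring.
  by apply: combD; apply: cone_span; eassumption.
have a_0 : a = 0 by lra.
have b_0 : b = 0 by lra.
apply: IH => //; first by move: xa; rewrite a_0 scale0r subr0.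
by move: xb; rewrite b_0 scale0r subr0.
Qed.

Lemma slist_uniq k l : slist k l -> uniq l.
Proof. by case=> /ncl_eorth/eorth_uniq. Qed.

Lemma slist_rem k l t u : slist k l -> t \in l -> span l (rho u) ->
  exists2 a, 0 <= a & comb true (sroot k) (rem t l) (sroot k u - a *: sroot k t).
Proof.
move=> [nl cone] tl /cone/(comb_perm (perm_mem (perm_to_rem tl))) /= -[a [/(_ isT) a0 ua]].
by exists a.
Qed.

Lemma slist_rem_indep k l t : slist k l -> t \in l -> ~ span (rem t l) (rho t).
Proof.
move=> sl tl; apply: (ncl_indep (proj1 sl)) => //; last by move=> u /mem_rem.
by rewrite mem_rem_uniq ?(slist_uniq sl) // inE eqxx.
Qed.

Lemma sroot_conj k t u : reflv (rho t) (sroot k u) = sroot k (rconj u (val t)) \/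
  reflv (rho t) (sroot k u) = - sroot k (rconj u (val t)).
Proof.
have := rho_conj u (val t); rewrite refl_inv -act_refl => h.
have [->|->] := srootE k u; have [->|->] := srootE k (rconj u (val t));
  rewrite ?mulmxN; case: h => ->; rewrite ?opprK; auto.
Qed.

Lemma span_reflv l t x : t \in l -> span l x -> span l (reflv (rho t) x).
Proof. by move=> tl xl; apply: combB => //; apply/combZ/comb_mem. Qed.

Lemma sroot_dot k t : dotp (sroot k t) (sroot k t) = 1.
Proof. by have [->|->] := srootE k t; rewrite ?dotpNl ?dotpNr ?opprK rho1. Qed.

Lemma reflv_sroot k t x : reflv (rho t) x = x - (2 * dotp x (sroot k t)) *: sroot k t.
Proof. by have [->|->] := srootE k t; rewrite // -[LHS]reflvN. Qed.

Lemma sroot_inj_scale k t u (a : R) : sroot k t = a *: sroot k u -> t = u.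
Proof.
have [->|->] := srootE k t; have [->|->] := srootE k u => e.
- exact: rho_scale e.
- by apply: (@rho_scale _ _ (- a)); rewrite e scalerN scaleNr.
- by apply: (@rho_scale _ _ (- a)); rewrite scaleNr -e opprK.
- by apply: (@rho_scale _ _ a); apply: oppr_inj; rewrite e scalerN.
Qed.

Lemma span_conj l t u : t \in l -> span l (rho u) -> span l (rho (rconj u (val t))).
Proof.
move=> tl ul; apply: (span_sroot (k := 0)).
have : span l (reflv (rho t) (sroot 0 u)) by apply: span_reflv => //; apply: sroot_span.
by have [->|->] := sroot_conj 0 t u => // /combN; rewrite opprK.
Qed.

(* A simple reflection permutes the positive roots other than its own. *)
Lemma slist_reflv k l t u : slist k l -> t \in l -> span l (rho u) -> u != t ->
  reflv (rho t) (sroot k u) = sroot k (rconj u (val t)).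
Proof.
move=> sl tl ul ut; have [//|e] := sroot_conj k t u.
have yl := span_conj tl ul.
have [a a0 za] := slist_rem sl tl ul; have [b b0 zb] := slist_rem sl tl yl.
set y := rconj u _ in yl zb e; set d := 2 * dotp (sroot k u) (sroot k t).
have yE : sroot k y = - sroot k u + d *: sroot k t.
  by rewrite -[LHS]opprK -e (reflv_sroot k) -/d opprB addrC.
have ab : d - a - b = 0.
  apply: (span_sroot_scale (k := k) (slist_rem_indep sl tl)).
  rewrite (_ : _ *: _ = (sroot k u - a *: sroot k t) + (sroot k y - b *: sroot k t)).
    by apply: combD; apply: cone_span; eassumption.
  by rewrite yE; vring.
have z0 : sroot k u - a *: sroot k t = 0.
  apply: (cone_pointed (proj1 sl) _ _ za).
  - by rewrite rem_uniq ?(slist_uniq sl).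
  - by move=> v /mem_rem.
  - have -> // : - (sroot k u - a *: sroot k t) = sroot k y - b *: sroot k t.
    by rewrite yE (_ : b = d - a); [vring|lra].
case/eqP: ut; apply: (sroot_inj_scale (k := k) (a := a)).
by apply/eqP; rewrite -subr_eq0 z0.
Qed.

(** Reflecting the root of u in t gives a positive root, whose t-coefficient is - 2 times the dot
    product. *)
Lemma slist_obtuse k l t u : slist k l -> t \in l -> u \in l -> t != u ->
  dotp (sroot k t) (sroot k u) <= 0.
Proof.
move=> sl tl ul tu; have uspan : span l (rho u) by apply: comb_mem.
have e := slist_reflv sl tl uspan; rewrite eq_sym tu in e.
have [a a0] := slist_rem sl tl (span_conj tl uspan).
rewrite -(e isT) (reflv_sroot k) (dotpC (sroot k u)); set d := dotp _ _ => ha.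
have : - (2 * d + a) = 0; last by lra.
apply: (span_sroot_scale (k := k) (slist_rem_indep sl tl)).
rewrite (_ : _ *: _ = (sroot k u - (2 * d) *: sroot k t - a *: sroot k t) - sroot k u); last by vring.
apply: combB; first exact: cone_span ha.
by apply/sroot_span/comb_mem; rewrite mem_rem_uniq ?(slist_uniq sl) // inE eq_sym tu ul.
Qed.

(* The first reflection after the cut is simple: by convexity of the reflection
   ordering on rank 2 parabolics its root is not a positive combination of two
   other positive roots. *)
Lemma slist_front_mem k l u : slist k l -> front k u -> span l (rho u) -> u \in l.
Proof.
move=> sl ku ul; apply: contraT => nul.
(* The root of u is a nonnegative combination of simple roots, so some simple t makes an acute angle
   with it. Then y, the image of u under t, is positive and u = y + 2 d t. *)
have [/hasP[t tl dt]|/hasPn dt] := boolP (has (fun t => 0 < dotp (sroot k u) (sroot k t)) l); last first.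
  have : dotp (sroot k u) (sroot k u) <= 0; last by rewrite sroot_dot ler10.
  apply: (comb_ind (Q := fun x => dotp (sroot k u) x <= 0)) (proj2 sl u ul).
    by rewrite dotp0r.
  move=> a t y /(_ isT) a0 /dt; rewrite -leNgt => dt0 y0; rewrite dotpDr dotpZr.
  have : a * dotp (sroot k u) (sroot k t) <= 0 by rewrite mulr_ge0_le0.
  lra.
set d := dotp _ _ in dt.
have ut : u != t by apply: contraNneq nul => ->.
have yE := slist_reflv sl tl ul ut; rewrite (reflv_sroot k) -/d in yE.
set y := rconj u _ in yE.
have d2 : 0 < 2 * d by rewrite mulr_gt0.
have uy : u != y.
  apply: contra_neq ut => uy; apply: (sroot_inj_scale (k := k) (a := 1)).
  have : (2 * d) *: sroot k t = 0 by apply: oppr_inj; rewrite oppr0; apply: (addrI (sroot k u)); rewrite yE -uy addr0.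
  move=> /eqP; rewrite scaler_eq0 gt_eqF //= => /eqP t0.
  by have := sroot_dot k t; rewrite t0 dotp0l => /eqP; rewrite eq_sym oner_eq0.
(* Signs are normalized by that of u: exactly the reflections below u are then negated. Each of the
   four cases contradicts [prec_between] or the height. *)
have {}yE : rho u - (2 * d) *: (if prec t u then - rho t else rho t) = if prec y u then - rho y else rho y.
  have fE v : sroot k v = (if flipped k u then -1 else 1) *: (if prec v u then - rho v else rho v).
    rewrite /sroot (flipped_front v ku).
    by case: flipped; case: prec; rewrite ?scale1r ?scaleN1r ?opprK.
  have e0 : (if flipped k u then -1 else 1) != 0 :> R by case: ifP; rewrite ?oppr_eq0 oner_eq0.
  apply: (scalerI e0); rewrite -fE -yE !fE prec_irr.
  by vring.
have [w wP] := exists_height; have [[wu wt] wy] := (wP u, wP t, wP y).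
have d2V : 0 < (2 * d)^-1 by rewrite invr_gt0.
have d20 : 2 * d != 0 by rewrite gt_eqF.
have [tu|tu] := boolP (prec t u); have [yu|yu] := boolP (prec y u);
  rewrite ?(negPf tu) ?(negPf yu) ?tu ?yu in yE.
- have := congr1 (dotp w) yE; rewrite !dotp_lin.
  have := mulr_gt0 d2 wt; lra.
- have uy' : prec u y by have := prec_total uy; rewrite (negPf yu) orbF.
  have ytE : rho y = 1 *: rho u + (2 * d) *: rho t by rewrite -yE; vring.
  have yt : y != t by apply: contraTneq tu => <-.
  have := prec_between ltr01 d2 (_ : y != u) yt ytE; rewrite eq_sym => /(_ uy).
  have := prec_asym uy'; have := prec_asym (prec_trans tu uy').
  by move=> /negPf-> /negPf->; rewrite ?andbF.
- have ut' : prec u t by have := prec_total ut; rewrite (negPf tu) orbF.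
  have tE : rho t = (2 * d)^-1 *: rho u + (2 * d)^-1 *: rho y.
    apply: (scalerI d20); rewrite scalerDr !scalerA mulfV // !scale1r -[rho y]opprK -yE.
    by vring.
  have ty' : t != y by apply: contraTneq ut' => ->; apply: prec_asym.
  have := prec_between d2V d2V _ ty' tE; rewrite eq_sym => /(_ ut).
  have := prec_asym (prec_trans yu ut'); have := prec_asym ut'.
  by move=> /negPf-> /negPf->; rewrite ?andbF.
- have ut' : prec u t by have := prec_total ut; rewrite (negPf tu) orbF.
  have uE : rho u = (2 * d) *: rho t + 1 *: rho y by rewrite -yE; vring.
  have := prec_between d2 ltr01 ut uy uE.
  by rewrite (negPf tu) (negPf yu).
Qed.

Lemma orth_commute v u : dotp (rho v) (rho u) = 0 -> rconj v (val u) = v.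
Proof.
move=> vu; have := rho_conj v (val u).
rewrite refl_inv act_refl /reflv vu mulr0 scale0r subr0 => -[] e.
  by apply: (@rho_scale _ _ 1); rewrite e scale1r.
by apply: (@rho_scale _ _ (-1)); rewrite e scaleN1r opprK.
Qed.

(** The product v u is noncrossing of length 2, so [NC2_dot] applies; for the roots with the signs
    of the cut it gives a nonnegative dot product, while simple roots are obtuse. Hence the roots
    are orthogonal. *)
Lemma slist_front_commute k l1 u l2 v : slist k (l1 ++ u :: l2) -> front k u ->
  v \in l1 -> rconj v (val u) = v.
Proof.
move=> sl ku vl.
have vu : v != u.
  by have := slist_uniq sl; rewrite cat_uniq /= => /and3P[_ /norP[ul1 _] _]; apply: contraNneq ul1 => <-.
have le0 := slist_obtuse sl (_ : v \in l1 ++ u :: l2) (_ : u \in l1 ++ u :: l2) vu.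
rewrite !mem_cat vl mem_head orbT in le0; have {}le0 := le0 isT isT.
have [l3 lc] : exists l3, cfact (v :: u :: l3).
  have [l' ] := proj1 sl; case/splitPr: vl => m1 m2; rewrite -!catA => h.
  by apply: cfact_pair h.
have [_ /(NC2_dot vu)[h1 h2]] := cfact_NC2 lc.
apply/orth_commute/eqP; move: le0; rewrite /sroot (flipped_front v ku).
have [pv|pv] := boolP (prec v u).
  have := h2 pv; case: flipped; rewrite /= ?dotpNl ?dotpNr ?opprK => *; apply/eqP; lra.
have := h1 _; have := prec_total vu; rewrite (negPf pv) /= => -> /(_ isT).
by case: flipped; rewrite /= ?dotpNl ?dotpNr ?opprK => *; apply/eqP; lra.
Qed.

(* Two reduced words of one noncrossing element; its reflections are the t with
   [span l (rho t)]. *)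
Definition sim l l' := [/\ pr l = pr l', size l = size l' & forall x, span l x <-> span l' x].

Lemma sim_refl l : sim l l. Proof. by split. Qed.

Lemma sim_sym l l' : sim l l' -> sim l' l.
Proof. by rewrite /sim; case=> -> -> e; split=> // x; apply: iff_sym. Qed.

Lemma sim_trans l2 l1 l3 : sim l1 l2 -> sim l2 l3 -> sim l1 l3.
Proof. by rewrite /sim; case=> -> -> e [-> -> e']; split=> // x; apply: iff_trans (e x) (e' x). Qed.

Lemma span_perm l l' : perm_eq l l' -> forall x, span l x <-> span l' x.
Proof. by move=> /perm_mem e x; split; apply: comb_perm. Qed.

Lemma pr_comm l u : (forall v, v \in l -> rconj v (val u) = v) -> (pr l * val u = val u * pr l)%g.
Proof.
move=> comm; have -> : (val u * pr l)%g = (val u * pr [seq rconj v (val u) | v <- l])%g.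
  by congr (_ * pr _)%g; rewrite -[LHS]map_id; apply/eq_in_map => v /comm.
by rewrite pr_conj conjgE refl_inv !mulgA refl_invol mul1g.
Qed.

Lemma slist_front k l u : slist k l -> front k u -> span l (rho u) ->
  exists2 l1, slist k (u :: l1) & sim l (u :: l1).
Proof.
move=> sl ku ul; have := slist_front_mem sl ku ul => uin.
case/splitPr: uin sl ul => l1 l2 sl _.
have prE : pr (l1 ++ u :: l2) = pr (u :: l1 ++ l2).
  rewrite pr_cat !big_cons pr_cat !mulgA; congr (_ * _)%g.
  by apply: pr_comm => v vl; apply: slist_front_commute sl ku vl.
have pe : perm_eq (l1 ++ u :: l2) (u :: l1 ++ l2) by rewrite perm_catC /= perm_cons perm_catC.
exists (l1 ++ l2); last by split=> //; [apply: perm_size|apply: span_perm].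
have [[l' [l'c l'n]] cone] := sl; split.
  exists l'; split; first by rewrite pr_cat -prE -pr_cat.
  by move: l'n; rewrite /= !size_cat /=; lia.
by move=> t /(span_perm pe)/cone; apply/comb_perm/perm_mem.
Qed.

(** Moving the cut past u replaces the positive roots of the parabolic by their images under u, so
    the new simple roots are the images of the old ones; for u itself this is the change of sign. *)
Lemma slist_rotate k u l : slist k (u :: l) -> front k u ->
  let l' := rcons [seq rconj v (val u) | v <- l] u in slist k.+1 l' /\ sim (u :: l) l'.
Proof.
move=> sl ku l'; have uin : u \in u :: l := mem_head _ _.
have prE : pr (u :: l) = pr l'.
  by rewrite big_rcons pr_conj big_cons /= conjgE refl_inv -!mulgA refl_invol mulg1.
have szE : size (u :: l) = size l' by rewrite size_rcons size_map.
have sub v : v \in l' -> span (u :: l) (rho v).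
  rewrite mem_rcons inE => /orP[/eqP->|/mapP[w wl ->]]; first exact: comb_mem.
  by apply: span_conj => //; apply: comb_mem; rewrite inE wl orbT.
have memc v : v \in l -> rconj v (val u) \in l'.
  by move=> vl; rewrite mem_rcons inE; apply/orP; right; apply/mapP; exists v.
have sub' v : v \in u :: l -> span l' (rho v).
  rewrite inE => /orP[/eqP->|vl]; first by apply: comb_mem; rewrite mem_rcons mem_head.
  rewrite -(rconjK v u); apply: span_conj; first by rewrite mem_rcons mem_head.
  exact/comb_mem/memc.
have ul' : u \notin l by case/andP: (slist_uniq sl).
have spE x : span (u :: l) x <-> span l' x by split; apply: comb_sub.
split=> //; have [[m [mc mn]] cone] := sl; split.
  exists m; split; first by rewrite pr_cat -prE -pr_cat.
  by move: mn; rewrite !size_cat szE.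
move=> t /spE tl; have [->|tu] := eqVneq t u.
  by apply: comb_mem; rewrite mem_rcons mem_head.
rewrite (srootS_neq ku tu) -[t](rconjK t u).
have yl := span_conj uin tl; have yu : rconj t (val u) != u.
  apply: contra_neq tu => e; rewrite -(rconjK t u) e; apply: val_inj.
  by rewrite /= conjgE mulgA mulVg mul1g.
rewrite -(slist_reflv sl uin yl yu).
apply: comb_map (proj2 sl _ yl); first by rewrite /reflv dotp0l mulr0 scale0r subrr.
  by move=> a x y; rewrite /reflv !dotp_lin; vring.
move=> v; rewrite inE => /orP[/eqP->|vl].
  have -> : reflv (rho u) (sroot k u) = sroot k.+1 u.
    by rewrite (srootS_eq ku) (reflv_sroot k) sroot_dot; vring.
  by apply: comb_mem; rewrite mem_rcons mem_head.
have vu : v != u by apply: contraNneq ul' => <-.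
rewrite (slist_reflv sl uin) //; last by apply: comb_mem; rewrite inE vl orbT.
rewrite -(srootS_neq ku).
  exact/comb_mem/memc.
apply: contra_neq vu => e; rewrite -(rconjK v u) e; apply: val_inj.
by rewrite /= conjgE mulgA mulVg mul1g.
Qed.

Lemma slist_step k l : slist k l -> exists2 l', slist k.+1 l' & sim l l'.
Proof.
move=> sl; have [N0|N0] := posnP N.
  exists l => //; split; first by case: sl.
  by move=> t; have := rank_of_ltN t; rewrite N0.
have [u ku] := rank_of_onto k N0.
have [ul|ul] := pselect (span l (rho u)).
  have [l1 sl1 e] := slist_front sl ku ul; have [sl2 e'] := slist_rotate sl1 ku.
  by eexists; [exact: sl2|exact: sim_trans e e'].
exists l => //; split; first by case: sl.
move=> t tl; have tu : t != u by apply: contra_notN ul => /eqP <-.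
rewrite (srootS_neq ku tu); apply: comb_sub (proj2 sl t tl) => v vl.
have vu : v != u by apply: contra_notN ul => /eqP <-; apply: comb_mem.
by rewrite -(srootS_neq ku vu); apply: comb_mem.
Qed.

(** [slist_step] only moves forward, but [sroot] has period 2 N, so the cut k' is reached as k' + 2
    N k. *)
Lemma slist_all k l k' : slist k l -> exists2 l', slist k' l' & sim l l'.
Proof.
move=> sl; have [N0|N0] := posnP N.
  exists l => //; split; first by case: sl.
  by move=> t; have := rank_of_ltN t; rewrite N0.
have per (j i : nat) t : sroot (j + i * (N + N)) t = sroot j t.
  elim: i => [|i IH]; first by rewrite addn0.
  by rewrite mulSn addnCA addnC !addnA !sroot_addN opprK IH.
have [m mE] : exists m, (k' + k * (N + N) = k + m)%N.
  by exists (k' + k * (N + N) - k)%N; nia.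
have [l' sl' e] : exists2 l', slist (k + m)%N l' & sim l l'.
  elim: m {mE} => [|m [l1 sl1 e1]]; first by exists l; rewrite ?addn0.
  have [l2 sl2 e2] := slist_step sl1; rewrite addnS.
  by exists l2 => //; apply: sim_trans e1 e2.
exists l' => //; case: sl' => nl' cone; split=> // t /cone; rewrite -mE per.
by apply: comb_sub => v vl; rewrite per; apply: comb_mem.
Qed.

Lemma slist_behead k u l : slist k (u :: l) -> slist k l.
Proof.
move=> sl; have [nl cone] := sl; split; first exact: ncl_behead nl.
move=> t tl; have ul : ~ span l (rho u).
  have := slist_rem_indep sl (mem_head u l); rewrite /= eqxx; exact.
have /cone /= [a [_ ta]] : span (u :: l) (rho t).
  by apply: comb_sub tl => v vl; apply: comb_mem; rewrite inE vl orbT.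
suff a0 : a = 0 by move: ta; rewrite a0 scale0r subr0.
apply: (span_sroot_scale (k := k) ul).
rewrite (_ : _ *: _ = sroot k t - (sroot k t - a *: sroot k u)); last by vring.
by apply: combB; [apply: sroot_span|apply: cone_span ta].
Qed.

Lemma slist_belast k l u : slist k (rcons l u) -> slist k l.
Proof.
move=> sl; have [nl cone] := sl; split; first exact: ncl_belast nl.
have uin : u \in rcons l u by rewrite mem_rcons mem_head.
have pe : perm_eq (rcons l u) (u :: l) by rewrite perm_rcons.
move=> t tl; have ul : ~ span l (rho u).
  move=> ul; have := slist_rem_indep sl uin; apply; apply: comb_sub ul => v vl.
  apply: comb_mem; rewrite mem_rem_uniq ?(slist_uniq sl) // inE mem_rcons inE vl orbT andbT.
  by have := slist_uniq sl; rewrite rcons_uniq => /andP[nul _]; apply: contraNneq nul => <-.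
have /cone/(comb_perm (perm_mem pe)) /= [a [_ ta]] : span (rcons l u) (rho t).
  by apply: comb_sub tl => v vl; apply: comb_mem; rewrite mem_rcons inE vl orbT.
suff a0 : a = 0 by move: ta; rewrite a0 scale0r subr0.
apply: (span_sroot_scale (k := k) ul).
rewrite (_ : _ *: _ = sroot k t - (sroot k t - a *: sroot k u)); last by vring.
by apply: combB; [apply: sroot_span|apply: cone_span ta].
Qed.

(** * Reduced words with a prescribed first or last letter *)

Definition nice l := exists k l', slist k l' /\ sim l l'.

Lemma nice_sim l l' : sim l l' -> nice l -> nice l'.
Proof.
by move=> e [k [m [sm em]]]; exists k, m; split=> //; apply: sim_trans em; apply: sim_sym.
Qed.

Lemma nice_slist k l : nice l -> exists2 l', slist k l' & sim l l'.
Proof.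
move=> [k' [m [sm em]]]; have [m' sm' em'] := slist_all k sm.
by exists m' => //; apply: sim_trans em em'.
Qed.

Lemma slist_nice k l : slist k l -> nice l.
Proof. by move=> sl; exists k, l; split=> //; apply: sim_refl. Qed.

Lemma simple_slist : exists2 l, slist 0 l & cfact l.
Proof.
have [l [ln lc full cone]] := exists_simple_list; exists l => //.
have sE t : sroot 0 t = rho t by rewrite /sroot /flipped div0n mod0n.
split; first by exists [::]; rewrite cats0.
move=> t _; rewrite sE; apply: comb_sub (cone _ (rho_pos t)) => v vl.
by rewrite -sE; apply: comb_mem.
Qed.

Lemma cfact_nice l : cfact l -> nice l.
Proof.
move=> lc; have [l0 /slist_nice nl0 l0c] := simple_slist; apply: nice_sim nl0.
split; [by case: lc l0c => -> _ []|by case: lc l0c => _ -> []|].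
by move=> x; split=> _; apply: cfact_span.
Qed.

(** The functional x ↦ E x (ρ t) vanishes on the roots of l and is 1 on ρ t, so it reads off the
    coefficient of t. *)
Lemma span_consE t l : eorth (t :: l) ->
  forall x, span l x <-> span (t :: l) x /\ E x (rho t) = 0.
Proof.
move=> /= /andP[/allP tl _] x; have El y : span l y -> E y (rho t) = 0.
  apply: (comb_ind (Q := fun y => E y (rho t) = 0)); first by rewrite E0l.
  by move=> a u z _ /tl/eqP e z0; rewrite !E_lin e z0 mulr0 addr0.
split=> [xl|[[a [_ xa]] x0]].
  split; last exact: El.
  rewrite -[exists a, _]/(span (t :: l) x).
  by apply: comb_sub xl => u ul; apply: comb_mem; rewrite inE ul orbT.
have := El _ xa; rewrite !E_lin x0 E_diag rho1 mulr1 sub0r => /eqP.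
by rewrite oppr_eq0 => /eqP a0; move: xa; rewrite a0 scale0r subr0.
Qed.

Lemma eorth_rcons l t : eorth (rcons l t) = all (fun u => E (rho t) (rho u) == 0) l && eorth l.
Proof. by rewrite /eorth pairwise_rcons. Qed.

Lemma eorth_cat l1 l2 : eorth (l1 ++ l2) =
  [&& allrel (fun t u => E (rho u) (rho t) == 0) l1 l2, eorth l1 & eorth l2].
Proof. by rewrite /eorth pairwise_cat. Qed.

Lemma span_rcons l t x : span (rcons l t) x <-> span (t :: l) x.
Proof. by apply: span_perm; rewrite perm_rcons. Qed.

Lemma span_rconsE l t : eorth (rcons l t) ->
  forall x, span l x <-> span (rcons l t) x /\ E (rho t) x = 0.
Proof.
rewrite eorth_rcons => /andP[/allP tl _] x; have El y : span l y -> E (rho t) y = 0.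
  apply: (comb_ind (Q := fun y => E (rho t) y = 0)); first by rewrite E0r.
  by move=> a u z _ /tl/eqP e z0; rewrite !E_lin e z0 mulr0 addr0.
rewrite span_rcons; split=> [xl|[[a [_ xa]] x0]].
  split; last exact: El.
  by apply: comb_sub xl => u ul; apply: comb_mem; rewrite inE ul orbT.
have := El _ xa; rewrite !E_lin x0 E_diag rho1 mulr1 sub0r => /eqP.
by rewrite oppr_eq0 => /eqP a0; move: xa; rewrite a0 scale0r subr0.
Qed.

(** At the cut just before t, the reflection t is simple and commutes with the letters to its left.
    One more rotation makes it the last letter, as in [nice_peel_right]. *)
Lemma nice_peel_left k l t : front k t -> nice l -> span l (rho t) ->
  exists l1, [/\ slist k (t :: l1), sim l (t :: l1) & slist k l1].
Proof.
move=> kt /(nice_slist k)[l' sl' e] tl; have tl' : span l' (rho t) by case: e => _ _ <-.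
have [l1 sl1 e1] := slist_front sl' kt tl'.
by exists l1; split; [|apply: sim_trans e e1|apply: slist_behead sl1].
Qed.

Lemma nice_peel_right k l t : front k t -> nice l -> span l (rho t) ->
  exists l1, [/\ slist k.+1 (rcons l1 t), sim l (rcons l1 t) & slist k.+1 l1].
Proof.
move=> kt nl tl; have [l1 [sl1 e1 _]] := nice_peel_left kt nl tl.
have [sl2 e2] := slist_rotate sl1 kt; eexists; split; first exact: sl2.
  exact: sim_trans e1 e2.
exact: slist_belast sl2.
Qed.

(** Descent from c, removing the letters of the complement from the right. A simple system for m t
    can be chosen of the form l1 t, and l1 has the same product and span as m, since both spans are
    cut out by E-orthogonality to t. *)
Lemma ncl_nice l : ncl l -> nice l.
Proof.
case=> l' lc; have := cfact_nice lc; have : ncl (l ++ l') by exists [::]; rewrite cats0.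
elim/last_ind: l' {lc} => [|l' t IH]; first by rewrite cats0.
rewrite -rcons_cat; set m := l ++ l' in IH * => nm nicem.
have tm : span (rcons m t) (rho t) by apply: comb_mem; rewrite mem_rcons mem_head.
have [l1 [sl1 [e1 e2 e3] sl1']] := nice_peel_right (front_rank t) nicem tm.
have nm' := ncl_belast nm; apply: (IH nm'); apply: nice_sim (slist_nice sl1').
split; first by move: e1; rewrite !big_rcons /= => /mulIg.
  by move: e2; rewrite !size_rcons => -[].
move=> x; rewrite (span_rconsE (ncl_eorth nm)) (span_rconsE (ncl_eorth (proj1 sl1))).
by split=> -[/e3].
Qed.

Lemma sim_cons t l l' : sim l l' -> sim (t :: l) (t :: l').
Proof.
by case=> e1 e2 e3; split; rewrite ?big_cons ?e1 //= ?e2 // => x; split=> -[a [a0 /e3 ?]]; exists a.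
Qed.

(** The letters of l are peeled off m one at a time; E-orthogonality keeps the later ones in the
    span of what remains. *)
Lemma nice_extend m l : nice m -> eorth l -> (forall t, t \in l -> span m (rho t)) ->
  exists l', sim m (l ++ l').
Proof.
elim: l m => [|t l IH] m nm; first by exists m; apply: sim_refl.
move=> /= /andP[tl el] lm.
have [m1 [sm1 e1 sm1']] := nice_peel_left (front_rank t) nm (lm _ (mem_head t l)).
have [|l' e2] := IH m1 (slist_nice sm1') el.
  move=> u ul; apply/(span_consE (ncl_eorth (proj1 sm1))); split; last exact/eqP/(allP tl).
  by case: e1 => _ _ <-; apply: lm; rewrite inE ul orbT.
by exists l'; apply: sim_trans e1 (sim_cons _ e2).
Qed.

Lemma eorth_ncl l : eorth l -> ncl l.
Proof.
move=> el; have [l0 /slist_nice nl0 l0c] := simple_slist.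
have [|l' [e1 e2 _]] := nice_extend nl0 el; first by move=> t _; apply: cfact_span.
by exists l'; split; rewrite -?e1 -?e2; case: l0c.
Qed.

Lemma eorth_nice l : eorth l -> nice l.
Proof. by move/eorth_ncl/ncl_nice. Qed.

Lemma eorth_peel_left l t : eorth l -> span l (rho t) ->
  exists2 l1, eorth (t :: l1) & sim l (t :: l1).
Proof.
move=> /eorth_nice nl tl; have [l1 [[/ncl_eorth ? _] ? _]] := nice_peel_left (front_rank t) nl tl.
by exists l1.
Qed.

Lemma eorth_peel_right l t : eorth l -> span l (rho t) ->
  exists2 l1, eorth (rcons l1 t) & sim l (rcons l1 t).
Proof.
move=> /eorth_nice nl tl; have [l1 [[/ncl_eorth ? _] ? _]] := nice_peel_right (front_rank t) nl tl.
by exists l1.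
Qed.

(** * Signs of [E] and the reflection ordering *)

Lemma E_last_cone k l u x : comb true (sroot k.+1) (rcons l u) x -> eorth (rcons l u) ->
  front k u -> E (sroot k u) x <= 0.
Proof.
move=> xl el ku; apply: (comb_ind (Q := fun x => E (sroot k u) x <= 0)) xl; first by rewrite E0r.
move=> a t y /(_ isT) a0; rewrite mem_rcons inE => tl y0; rewrite !E_lin.
suff : E (sroot k u) (sroot k.+1 t) <= 0 by move=> /(mulr_ge0_le0 a0); lra.
case/orP: tl => [/eqP->|tl].
  by rewrite (srootS_eq ku) !E_lin E_diag sroot_dot lerN10.
have /eqP e : E (rho u) (rho t) == 0 by move: el; rewrite eorth_rcons => /andP[/allP/(_ t tl)].
by have [->|->] := srootE k u; have [->|->] := srootE k.+1 t; rewrite ?ENl ?ENr e ?oppr0.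
Qed.

(** Write c with last letter u. At the next cut, the root of t is a nonnegative combination of
    letters E-orthogonal to u and of the negated root of u, where E takes the value - 1. *)
Lemma E_sroot k u t : front k u -> t != u -> E (sroot k u) (sroot k t) <= 0.
Proof.
move=> ku tu; have [l0 /slist_nice nl0 l0c] := simple_slist.
have [l1 [sl1 [_ _ e] _]] := nice_peel_right ku nl0 (cfact_span l0c _).
rewrite -(srootS_neq ku tu); apply: E_last_cone (ncl_eorth (proj1 sl1)) ku.
by apply: (proj2 sl1); rewrite -e; apply: cfact_span.
Qed.

(** The first sign comes from the cut just before t. At the cut just before u the root of t is
    already negated, which reverses the second sign. *)
Lemma E_prec t u : prec t u -> E (rho t) (rho u) <= 0 /\ 0 <= E (rho u) (rho t).
Proof.
move=> tu; have ut := prec_neq tu; split.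
  have := E_sroot (front_rank t) (_ : u != t); rewrite eq_sym => /(_ ut).
  by rewrite /sroot !flipped_rank prec_irr (negPf (prec_asym tu)).
have := E_sroot (front_rank u) ut.
by rewrite /sroot !flipped_rank prec_irr tu ENr oppr_le0.
Qed.

(* If every simple root for the order cut after u were flipped, so would be
   every root, contradicting the existence of u' above u. *)
Lemma exists_above l u u' : eorth l -> span l (rho u) -> span l (rho u') -> prec u u' ->
  exists t, [/\ span l (rho t), prec u t & E (rho u) (rho t) = 0].
Proof.
move=> /eorth_nice nl ul ul' uu'.
have [l1 [sl1 [_ _ e] _]] := nice_peel_right (front_rank u) nl ul.
have el1 := ncl_eorth (proj1 sl1).
have [/hasP[t tl ut]|/hasPn below] := boolP (has (prec u) l1).
  exists t; split=> //; first by rewrite e; apply: comb_mem; rewrite mem_rcons inE tl orbT.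
  by apply/eqP; move: el1; rewrite eorth_rcons => /andP[/allP/(_ t tl)].
have [w wP] := exists_height.
have flipE v : sroot (rank_of u).+1 v = if prec u v then rho v else - rho v.
  rewrite /sroot (flippedS _ (front_rank u)) flipped_rank.
  have [->|vu] := eqVneq v u; first by rewrite prec_irr.
  rewrite addbF; have := prec_total vu; case: (boolP (prec v u)) => [/prec_asym/negPf->//|_ /=].
  by move->.
have : dotp w (sroot (rank_of u).+1 u') <= 0.
  apply: (comb_ind (Q := fun x => dotp w x <= 0)) (proj2 sl1 u' _); first by rewrite dotp0r.
    move=> a t y /(_ isT) a0; rewrite mem_rcons inE flipE => tl y0.
    have -> : prec u t = false.
      by case/orP: tl => [/eqP->|/below/negPf//]; rewrite prec_irr.
    rewrite !dotp_lin mulrN; have := mulr_ge0 a0 (ltW (wP t)); lra.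
  by rewrite -e.
by rewrite flipE uu' leNgt wP.
Qed.

(** Dual to [exists_above], with u as first letter and the cut just before u. *)
Lemma exists_below l u u' : eorth l -> span l (rho u) -> span l (rho u') -> prec u' u ->
  exists t, [/\ span l (rho t), prec t u & E (rho t) (rho u) = 0].
Proof.
move=> /eorth_nice nl ul ul' uu'.
have [l1 [sl1 [_ _ e] _]] := nice_peel_left (front_rank u) nl ul.
have el1 := ncl_eorth (proj1 sl1).
have [/hasP[t tl ut]|/hasPn below] := boolP (has (prec^~ u) l1).
  exists t; split=> //; first by rewrite e; apply: comb_mem; rewrite inE tl orbT.
  by apply/eqP; move: el1 => /= /andP[/allP/(_ t tl)].
have [w wP] := exists_height.
have : 0 <= dotp w (sroot (rank_of u) u').
  apply: (comb_ind (Q := fun x => 0 <= dotp w x)) (proj2 sl1 u' _); first by rewrite dotp0r.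
    move=> a t y /(_ isT) a0; rewrite inE /sroot flipped_rank => tl y0.
    have -> : prec t u = false.
      by case/orP: tl => [/eqP->|/below/negPf//]; rewrite prec_irr.
    by rewrite !dotp_lin addr_ge0 // mulr_ge0 // ltW.
  by rewrite -e.
by rewrite /sroot flipped_rank uu' dotpNr oppr_ge0 leNgt wP.
Qed.

Lemma eorth2_conj a t : E (rho t) (rho a) = 0 -> E (rho a) (rho (rconj t (val a))) = 0.
Proof.
move=> e; have /eorth_ncl[l lc] : eorth [:: a; t] by rewrite /eorth /= e eqxx.
have : cfact ([:: rconj t (val a); a] ++ l).
  case: lc => l1 l2; split; last by move: l2.
  by rewrite -l1 /= !big_cons /= conjgE refl_inv -!mulgA [(val a * (val a * _))%g]mulgA refl_invol mul1g.
by move/cfact_eorth => /= /andP[/andP[/eqP]].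
Qed.

(** If t^a were below a, [exists_below] would provide a reflection of the same dihedral parabolic
    below a and E-orthogonal to it. The only candidate is t, which is above a. *)
Lemma eorth_prec_conj a t : E (rho t) (rho a) = 0 -> prec a t -> prec a (rconj t (val a)).
Proof.
move=> e at_; have el : eorth [:: a; t] by rewrite /eorth /= e eqxx.
set t' := rconj t (val a); have ta : t' != a.
  apply: contra_neq (prec_neq at_) => e'; rewrite -(rconjK t a) -/t' e'.
  by apply/val_inj; rewrite /= conjgE mulgA mulVg mul1g.
have as_ : span [:: a; t] (rho a) by apply: comb_mem; rewrite mem_head.
have ts : span [:: a; t] (rho t') by apply: span_conj; [rewrite mem_head|apply: comb_mem; rewrite !inE eqxx orbT].
have := prec_total ta => /orP[t'a|//].
have [y [ys ya ey]] := exists_below el as_ ts t'a.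
have /= [b [_ yb]] : span [:: t] (rho y) by apply/(span_consE el).
have yt : y = t by apply: (@rho_scale _ _ b); apply/eqP; rewrite -subr_eq0 yb.
by move: at_; rewrite -yt => /prec_asym; rewrite ya.
Qed.

(** * Sorting reduced words *)

Definition decreasing := pairwise (fun t u => prec u t).

(** Insertion sort: t passes to the left of a smaller letter a and becomes t^a, while the letters of
    l do not change. The last clause carries through the induction that the inserted letter stays
    above those it has passed. *)
Lemma insert_decreasing l t : decreasing l -> eorth (rcons l t) ->
  exists t1 l', [/\ perm_eq l' (t1 :: l), decreasing l', eorth l', span (rcons l t) (rho t1)
    & forall z, prec z t -> all (prec z) l -> prec z t1].
Proof.
elim/last_ind: l t => [|l a IH] t dl el.
  by exists t, [:: t]; split=> //; apply: comb_mem; rewrite mem_head.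
have tin : t \in rcons (rcons l a) t by rewrite mem_rcons mem_head.
have [ta|ta] := boolP (prec t a).
  exists t, (rcons (rcons l a) t); split=> //; first by rewrite perm_rcons.
    rewrite /decreasing pairwise_rcons -/decreasing dl andbT; apply/allP => x.
    rewrite mem_rcons inE => /orP[/eqP->//|xl]; apply: prec_trans ta _.
    by move: dl; rewrite /decreasing pairwise_rcons => /andP[/allP/(_ x xl)].
  exact: comb_mem.
have := el; rewrite !eorth_rcons => /andP[/allP tP /andP[/allP aP el0]].
have Eta : E (rho t) (rho a) = 0 by apply/eqP/tP; rewrite mem_rcons mem_head.
have at_ : prec a t.
  suff : t != a by move/prec_total; rewrite (negPf ta).
  by apply: contra_eq_neq Eta => ->; rewrite E_diag rho1 oner_eq0.
set t' := rconj t (val a); have at' := eorth_prec_conj Eta at_.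
have t'span : span [:: t; a] (rho t').
  by apply: span_conj; [rewrite !inE eqxx orbT|apply: comb_mem; rewrite mem_head].
have et' : eorth (rcons l t').
  rewrite eorth_rcons el0 andbT; apply/allP => x xl; apply/eqP.
  apply: (comb_ind (Q := fun y => E y (rho x) = 0)) t'span; first by rewrite E0l.
  move=> b z y _; rewrite !inE => zP y0; rewrite !E_lin y0.
  suff -> : E (rho z) (rho x) = 0 by rewrite mulr0 addr0.
  by apply/eqP; case/orP: zP => /eqP->; [apply: tP; rewrite mem_rcons inE xl orbT|apply: aP].
move: (dl); rewrite /decreasing pairwise_rcons => /andP[/allP da dl0].
have [t1 [l' [pe dl' el' t1s t1P]]] := IH t' dl0 et'.
have at1 : prec a t1 by apply: t1P at' _; apply/allP.
have sub x : span (rcons l t') x -> span (rcons (rcons l a) t) x.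
  apply: comb_sub => y; rewrite mem_rcons inE => /orP[/eqP->|yl].
    by apply: comb_sub t'span => z; rewrite !inE => zP; apply: comb_mem; rewrite !(mem_rcons, inE) orbA zP.
  by apply: comb_mem; rewrite !(mem_rcons, inE) yl !orbT.
exists t1, (rcons l' a); split.
- apply: (@perm_trans _ (a :: t1 :: l)); first by rewrite perm_rcons perm_cons.
  apply: (@perm_trans _ (t1 :: a :: l)); first exact/permEl/(perm_catCA [:: a] [:: t1] l).
  by rewrite perm_cons perm_sym perm_rcons.
- rewrite /decreasing pairwise_rcons -/decreasing dl' andbT; apply/allP => x.
  by rewrite (perm_mem pe) inE => /orP[/eqP->//|/da].
- rewrite eorth_rcons el' andbT; apply/allP => x.
  rewrite (perm_mem pe) inE => /orP[/eqP->|/aP//]; apply/eqP.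
  apply: (comb_ind (Q := fun y => E (rho a) y = 0)) t1s; first by rewrite E0r.
  move=> b z y _; rewrite mem_rcons inE => zP y0; rewrite !E_lin y0.
  suff -> : E (rho a) (rho z) = 0 by rewrite mulr0 addr0.
  by case/orP: zP => [/eqP->|/aP/eqP//]; apply: eorth2_conj.
- exact: sub.
- by move=> z _; rewrite all_rcons => /andP[za _]; apply: prec_trans at1.
Qed.

(** * Meets and joins *)

(** The cone of the positive roots of the parabolic of l at the cut k; by [cone_slist], any simple
    system generates it. *)
Definition cone (k : nat) l x := exists l', [/\ slist k l', sim l l' & comb true (sroot k) l' x].

Lemma cone_slist k l l' x : slist k l' -> sim l l' -> cone k l x -> comb true (sroot k) l' x.
Proof.
move=> sl' [_ _ e'] [m [[nm _] [_ _ e] xm]]; apply: comb_sub xm => t tm.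
by apply: (proj2 sl'); rewrite -e' e; apply: comb_mem.
Qed.

Lemma cone_root k l t : eorth l -> span l (rho t) -> cone k l (sroot k t).
Proof.
move=> /eorth_nice/(nice_slist k)[l' sl' e] tl; exists l'; split=> //.
by apply: (proj2 sl'); case: e => _ _ <-.
Qed.

(** If u is in the parabolic, the new simple system contains the negated root of u, and the
    coefficient of x there is - E u x. Otherwise the cone does not change. *)
Lemma cone_step k u l x : eorth l -> front k u -> cone k l x ->
  (span l (rho u) -> E (sroot k u) x <= 0) -> cone k.+1 l x.
Proof.
move=> el ku xl ux; have [ul|ul] := pselect (span l (rho u)); last first.
  have [m [sm e xm]] := xl; have um : ~ span m (rho u) by case: e => _ _ <-.
  have [m' sm' e'] := slist_step sm.
  exists m'; split=> //; first exact: sim_trans e e'.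
  apply: comb_sub xm => t tm; have tu : t != u.
    by apply: contra_notN um => /eqP <-; apply: comb_mem.
  rewrite -(srootS_neq ku tu); apply: (proj2 sm'); case: e' => _ _ <-.
  exact: comb_mem.
have [l1 [sl1 e1 _]] := nice_peel_left ku (eorth_nice el) ul.
have [sl2 e2] := slist_rotate sl1 ku; set l2 := rcons _ u in sl2 e2.
exists l2; split=> //; first exact: sim_trans e1 e2.
have /= [a [/(_ isT) a0 xa]] := cone_slist sl1 e1 xl.
have {}xa : comb true (sroot k.+1) l2 (x - a *: sroot k u).
  apply: comb_sub xa => t tl; have tu : t != u.
    by apply: contraTneq tl => ->; case/andP: (slist_uniq sl1).
  rewrite -(srootS_neq ku tu); apply: (proj2 sl2); case: e2 => _ _ <-.
  by apply: comb_mem; rewrite inE tl orbT.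
have pe : perm_eq l2 (u :: [seq rconj v (val u) | v <- l1]) by rewrite perm_rcons.
have /= [b [/(_ isT) b0 xb]] := comb_perm (perm_mem pe) xa.
have el2 := ncl_eorth (proj1 sl2).
have Eu y : comb true (sroot k.+1) [seq rconj v (val u) | v <- l1] y -> E (sroot k u) y = 0.
  apply: (comb_ind (Q := fun y => E (sroot k u) y = 0)); first by rewrite E0r.
  move=> d t z _ tl z0; rewrite !E_lin z0 add0r.
  move: el2; rewrite eorth_rcons => /andP[/allP/(_ t tl)/eqP e _].
  by have [->|->] := srootE k u; have [->|->] := srootE k.+1 t; rewrite ?ENl ?ENr e ?oppr0 mulr0.
have := Eu _ xb; rewrite (srootS_eq ku) !E_lin E_diag sroot_dot => xE.
have ab : 0 <= b - a by have := ux ul; lra.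
apply: (comb_perm (l := u :: [seq rconj v (val u) | v <- l1])); first by move=> y; rewrite (perm_mem pe).
exists (b - a); split=> //; rewrite (_ : _ - _ = x - a *: sroot k u - b *: sroot k.+1 u) //.
by rewrite (srootS_eq ku); vring.
Qed.

Lemma E_cone k u l x : front k u -> ~ span l (rho u) -> cone k l x -> E (sroot k u) x <= 0.
Proof.
move=> ku ul [m [sm [_ _ e] xm]].
apply: (comb_ind (Q := fun y => E (sroot k u) y <= 0)) xm; first by rewrite E0r.
move=> a t y /(_ isT) a0 tm y0; rewrite !E_lin.
have tu : t != u by apply: contra_notN ul => /eqP <-; rewrite e; apply: comb_mem.
have := mulr_ge0_le0 a0 (E_sroot ku tu); lra.
Qed.

(** E (-) (ρ u) vanishes on the letters after u, so the subtracted vector is the u-component of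
    x. *)
Lemma cone_front k u l x : eorth l -> front k u -> span l (rho u) -> cone k l x ->
  exists l1, [/\ eorth (u :: l1), sim l (u :: l1) & cone k l1 (x - (E x (rho u)) *: rho u)].
Proof.
move=> el ku ul xl; have [l1 [sl1 e1 sl1']] := nice_peel_left ku (eorth_nice el) ul.
have eo := ncl_eorth (proj1 sl1).
exists l1; split=> //; exists l1; split; [exact: sl1'|exact: sim_refl|].
have /= [a [/(_ isT) a0 xa]] := cone_slist sl1 e1 xl.
have [_] := proj1 (span_consE eo _) (cone_span xa).
rewrite !E_lin => x0; have -> : E x (rho u) *: rho u = a *: sroot k u; last by [].
move: x0; case: (srootE k u) => ->; rewrite ?ENl E_diag rho1 => x0.
  by congr (_ *: _); lra.
by rewrite scalerN -scaleNr; congr (_ *: _); lra.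
Qed.

(* Rotating the cut shows that a vector in two such cones is a combination of
   common reflections: as long as the first reflection u after the cut is not
   common, x stays in both cones when u is moved to the end, and after a whole
   turn x and - x are in the same pointed cone. *)
Lemma cone_common k l l' x : eorth l -> eorth l' -> cone k l x -> cone k l' x ->
  exists m, (forall t, t \in m -> span l (rho t) /\ span l' (rho t)) /\ span m x.
Proof.
have [r] := ubnP (size l + size l'); elim: r => // r IHr in k l l' x *; rewrite ltnS => sz el el'.
have [l0 sl0 l0c] := simple_slist; have nl0 := slist_nice sl0.
have big (j : nat) (m : seq (refl s)) y : cone j m y -> cone j l0 y.
  move=> [m' [_ _ ym]]; have [l1 sl1 e1] := nice_slist j nl0; exists l1; split=> //.
  apply: comb_sub ym => t _; apply: (proj2 sl1); case: e1 => _ _ <-.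
  exact: cfact_span l0c _.
have pointed (j : nat) y : cone j l0 y -> cone j l0 (- y) -> y = 0.
  move=> [m [sm em ym]] ym'; apply: (cone_pointed (proj1 sm) (slist_uniq sm) _ ym) => //.
  exact: cone_slist sm em ym'.
have turn (j i : nat) y : cone j l y -> cone j l' y -> cone (j + i) l0 (- y) ->
  exists m, (forall t, t \in m -> span l (rho t) /\ span l' (rho t)) /\ span m y.
  elim: i j y => [|i IHi] j y yl yl'.
    by rewrite addn0 => yN; exists [::]; split=> //; apply: pointed yN; apply: big yl.
  move=> yN; have [N0|N0] := posnP N.
    exists [::]; split=> //; case: yl => -[|t m] [_ _] //.
    by have := rank_of_ltN t; rewrite N0.
  have [u ku] := rank_of_onto j N0.
  have [[ul ul']|nu] := pselect (span l (rho u) /\ span l' (rho u)).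
    (* When u is common, its component is split off in both cones. It is the same vector, as it
       depends on y and u only, and the induction on the sizes applies to the remainders. *)
    have [l1 [el1 e1 y1]] := cone_front el ku ul yl.
    have [l1' [el1' e1' y1']] := cone_front el' ku ul' yl'.
    have [|||m [mP my]] := IHr j l1 l1' _ _ _ _ y1 y1'.
    - by case: e1 => _ s1 _; case: e1' => _ s2 _; move: sz; rewrite s1 s2 /=; lia.
    - by case/andP: el1.
    - by case/andP: el1'.
    exists (u :: m); split=> [t|]; last by exists (E y (rho u)).
    rewrite inE => /orP[/eqP->//|/mP[t1 t2]].
    case: e1 => _ _ ->; case: e1' => _ _ ->.
    by split; [case/(span_consE el1): t1|case/(span_consE el1'): t2].
  have ux : E (sroot j u) y <= 0.
    have [ul|ul] := pselect (span l (rho u)); last exact: E_cone ku ul yl.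
    by apply: E_cone ku _ yl' => ul'; apply: nu.
  by apply: (IHi j.+1); rewrite ?addSnnS //; apply: cone_step ku _ _.
move=> xl xl'; apply: (turn k N) => //; have [m [sm em xm]] := big _ _ _ xl.
have [m' sm' em'] := nice_slist (k + N) nl0; exists m'; split=> //.
apply: (comb_map (F := fun y => - y)) xm; rewrite ?oppr0 //; first by move=> a y z; vring.
move=> t _; rewrite -sroot_addN; apply: (proj2 sm'); case: em' => _ _ <-.
exact: cfact_span l0c _.
Qed.

Lemma eorth_extend m l : eorth m -> eorth l -> (forall t, t \in l -> span m (rho t)) ->
  exists l', sim m (l ++ l').
Proof. by move=> /eorth_nice; apply: nice_extend. Qed.

Lemma sim_eorth m l : eorth m -> sim m l -> eorth l.
Proof.
move=> /eorth_ncl[l' [mc mn]] [e1 e2 _]; apply: ncl_eorth; exists l'.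
by split; [rewrite pr_cat -e1 -pr_cat|move: mn; rewrite !size_cat e2].
Qed.

(** A common reflection u is peeled off both words, and the meet of the remainders is formed. The
    root of another common reflection minus its u-component lies in the cones of both remainders, so
    [cone_common] writes it with their common reflections. *)
Lemma meet_exists l l' : eorth l -> eorth l' -> exists2 m, eorth m &
  forall t, span m (rho t) <-> span l (rho t) /\ span l' (rho t).
Proof.
have [r] := ubnP (size l); elim: r => // r IHr in l l' *; rewrite ltnS => sz el el'.
have [[u [ul ul']]|nu] := pselect (exists u, span l (rho u) /\ span l' (rho u)); last first.
  exists [::] => // t; split=> [/= t0|[tl tl']]; last by case: nu; exists t.
  by have := rho_neq0 t; rewrite t0 eqxx.
have ku := front_rank u; set k := rank_of u in ku.
have cf t : span l (rho t) -> exists l1, [/\ eorth (u :: l1), sim l (u :: l1) &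
    cone k l1 (sroot k t - (E (sroot k t) (rho u)) *: rho u)].
  by move=> tl; apply: cone_front => //; apply: cone_root.
have [l1 el1 e1] := eorth_peel_left el ul.
have [l1' el1' e1'] := eorth_peel_left el' ul'.
have el1u : eorth l1 by case/andP: (el1).
have el1u' : eorth l1' by case/andP: (el1').
have [|m em mP] := IHr l1 l1' _ el1u el1u'.
  by case: e1 => _ + _; move: sz => /= => sz s1; rewrite s1 in sz.
have eum : eorth (u :: m).
  rewrite /eorth /= -/eorth em andbT; apply/allP => t tm; apply/eqP.
  by have [/(span_consE el1)[]] := proj1 (mP t) (comb_mem _ _ tm).
exists (u :: m) => // t; split=> [tm|[tl tl']].
  have [[_ _ e1s] [_ _ e1s']] := (e1, e1').
  split; [apply/e1s|apply/e1s']; apply: comb_sub tm => v; rewrite inE => /orP[/eqP->|vm];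
    try by apply: comb_mem; rewrite mem_head.
    by have [/(span_consE el1)[]] := proj1 (mP v) (comb_mem _ _ vm).
  by have [_ /(span_consE el1')[]] := proj1 (mP v) (comb_mem _ _ vm).
have [l2 [el2 e2 c2]] := cf _ tl.
have [l2' [el2' e2' c2']] := cone_front el' ku ul' (cone_root k el' tl').
have el2u : eorth l2 by case/andP: (el2).
have el2u' : eorth l2' by case/andP: (el2').
have tail_eq (a b d : seq (refl s)) : eorth (u :: a) -> eorth (u :: b) -> sim d (u :: a) ->
    sim d (u :: b) -> forall x, span a x <-> span b x.
  move=> ea eb [_ _ sa] [_ _ sb] x; rewrite (span_consE ea) (span_consE eb) -sa -sb; exact: iff_refl.
have [q [qP xq]] := cone_common el2u el2u' c2 c2'.
apply: (span_sroot (k := k)); exists (E (sroot k t) (rho u)); split=> //.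
apply: comb_sub xq => v /qP[v1 v2]; apply/mP.
split; [apply: (proj1 (tail_eq _ _ _ el2 el1 e2 e1 _)) v1|].
exact: (proj1 (tail_eq _ _ _ el2' el1' e2' e1' _)) v2.
Qed.

(** Start from c. As long as some upper bound does not contain j, the meet of the two is an upper
    bound shorter than j. *)
Lemma join_exists p q : eorth p -> eorth q -> exists j, [/\ eorth j,
  forall t, t \in p ++ q -> span j (rho t) &
  forall l, eorth l -> (forall t, t \in p ++ q -> span l (rho t)) ->
    forall x, span j x -> span l x].
Proof.
move=> ep eq_; have [l0 sl0 l0c] := simple_slist.
suff main (r : nat) j : (size j < r)%N -> eorth j -> (forall t, t \in p ++ q -> span j (rho t)) ->
    exists j, [/\ eorth j, forall t, t \in p ++ q -> span j (rho t) &
      forall l, eorth l -> (forall t, t \in p ++ q -> span l (rho t)) -> forall x, span j x -> span l x].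
  apply: (main (size l0).+1 l0) => //; first exact: ncl_eorth (proj1 sl0).
  by move=> t _; apply: cfact_span.
elim: r j => // r IHr j; rewrite ltnS => jr ej jP.
have [min|nmin] := pselect (forall l, eorth l -> (forall t, t \in p ++ q -> span l (rho t)) ->
    forall x, span j x -> span l x); first by exists j.
have [l [el lP [t tj tl]]] : exists l, [/\ eorth l, forall t, t \in p ++ q -> span l (rho t) &
    exists2 t, t \in j & ~ span l (rho t)].
  apply: contrapT => nl; apply: nmin => l el lP x; apply: comb_sub => t tj.
  by apply: contrapT => tl; apply: nl; exists l; split=> //; exists t.
have [m em mP] := meet_exists ej el.
have mpq u : u \in p ++ q -> span m (rho u) by move=> upq; apply/mP; split; [apply: jP|apply: lP].
apply: (IHr m) => //; have [|l' [_ e2 e3]] := eorth_extend ej em.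
  by move=> u um; have [] := proj1 (mP u) (comb_mem _ _ um).
move: e2 e3; rewrite size_cat; case: l' => [|y l'] e2 e3; last by move: e2 => /=; lia.
case: tl; suff /mP[] : span m (rho t) by [].
by rewrite -[m]cats0; apply/e3; apply: comb_mem.
Qed.

(** The side condition of the braid relations in terms of [E]; t = u appears because then t u =
    1. *)
Lemma abs_le_pair t u :
  abs_le s (val t * val u)%g c <-> t = u \/ E (rho u) (rho t) = 0.
Proof.
split=> [le|[->|e]]; last 2 first.
- by rewrite refl_invol /abs_le abs_length1 invg1 mul1g add0n.
- have /eorth_ncl[l lc] : eorth [:: t; u] by rewrite /eorth /= e eqxx.
  by have [_] := @cfact_abs_le [:: t; u] l lc; rewrite !big_cons big_nil mulg1.
have [->|tu] := eqVneq t u; [by left|right].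
have le2 : (abs_length s (val t * val u)%g <= 2)%N.
  by have [_ /(_ [:: t; u])] := abs_lengthP (val t * val u)%g; rewrite !big_cons big_nil mulg1; apply.
have [[m mk mE] _] := abs_lengthP ((val t * val u)^-1 * c)%g.
move: le; rewrite /abs_le abs_length_c -mk => /eqP sz.
have [a0|[a1|a2]] : abs_length s (val t * val u)%g = 0%N \/
  abs_length s (val t * val u)%g = 1%N \/ abs_length s (val t * val u)%g = 2%N by lia.
- have [[m0 + m0E] _] := abs_lengthP (val t * val u)%g.
  rewrite a0 => /size0nil m00; move: m0E; rewrite m00 big_nil => /esym/(canRL (mulgK _)).
  by rewrite mul1g refl_inv => /val_inj /eqP; rewrite (negPf tu).
- have [y yE] := abs_length_eq1 a1.
  (* If t u were a reflection y, the hyperplane fixed by y would be that of t and that of u, so t =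
     u. *)
  have fix_perp x : dotp x (rho y) = 0 -> dotp x (rho u) = 0 /\ dotp x (rho t) = 0.
    move=> xy; have : rG (val t * val u)%g *m x = x.
      by rewrite -yE act_refl /reflv xy mulr0 scale0r subr0.
    rewrite actM => /(congr1 (fun z => rG (val t) *m z)).
    rewrite -actM refl_invol act1 !act_refl /reflv => e.
    have /(rho_indep tu) [/eqP + /eqP] : (2 * dotp x (rho t)) *: rho t + (- (2 * dotp x (rho u))) *: rho u = 0.
      transitivity ((x - (2 * dotp x (rho u)) *: rho u) - (x - (2 * dotp x (rho t)) *: rho t)); first by vring.
      by rewrite e subrr.
    by rewrite oppr_eq0 !mulf_eq0 pnatr_eq0 /= => /eqP-> /eqP->.
  have eq_y v : (forall x, dotp x (rho y) = 0 -> dotp x (rho v) = 0) -> v = y.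
    move=> vP; apply/eqP; apply: contraT => vy; have := rho_dot_lt1 vy.
    have := vP (rho v - dotp (rho v) (rho y) *: rho y).
    rewrite !dotp_lin !rho1 mulr1 subrr (dotpC (rho y)) => /(_ erefl).
    by rewrite -expr2 => ->; rewrite ltxx.
  have ty : t = y by apply: eq_y => x /fix_perp[].
  have uy : u = y by apply: eq_y => x /fix_perp[].
  by move: tu; rewrite ty uy eqxx.
- have /cfact_eorth : cfact ([:: t; u] ++ m).
    split; first by rewrite pr_cat !big_cons big_nil mulg1 mE mulKVg.
    by move: sz; rewrite a2.
  by move=> /= /andP[/andP[/eqP]].
Qed.

(** Split x along the words l and r. If x is E-orthogonal to r, its r-component z satisfies E z z =
    0. Thus the span of l depends only on the complementary word. *)
Lemma span_complement l r x : cfact (l ++ r) ->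
  span l x <-> forall u, u \in r -> E (rho u) x = 0.
Proof.
move=> lc; have := cfact_eorth lc; rewrite eorth_cat => /and3P[/allrelP orth _ _].
have lr (y : refl s) z : y \in r -> span l z -> E (rho y) z = 0.
  move=> yr; apply: (comb_ind (Q := fun z => E (rho y) z = 0)); first by rewrite E0r.
  by move=> a t w _ tl w0; rewrite !E_lin w0 (eqP (orth t y tl yr)) mulr0 addr0.
split=> [xl y yr|xr]; first exact: lr.
have [z [zr xz]] : exists z, span r z /\ span l (x - z).
  apply: (comb_ind (Q := fun x => exists z, span r z /\ span l (x - z))) (cfact_span lc x).
    by exists 0; rewrite subr0; split; apply: comb0.
  move=> a t y _; rewrite mem_cat => /orP[tl|tr] [z [zr yz]].
    exists z; split=> //; rewrite addrAC; apply: combD => //.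
    by apply/combZ/comb_mem.
  exists (z + a *: rho t); split; last by rewrite opprD addrACA subrr addr0.
  by apply: combD => //; apply/combZ/comb_mem.
have Ez (y : refl s) : y \in r -> E (rho y) z = 0.
  move=> yr; have := lr y _ yr xz; rewrite !E_lin xr // sub0r => /eqP.
  by rewrite oppr_eq0 => /eqP.
suff z0 : z = 0 by move: xz; rewrite z0 subr0.
apply: dotp_eq0; rewrite -E_diag.
apply: (comb_ind (Q := fun y => E y z = 0)) zr; first by rewrite E0l.
by move=> a t y _ tr y0; rewrite !E_lin y0 Ez // mulr0 addr0.
Qed.

(** The same word r completes l and l' to factorizations of c, so [span_complement] describes both
    spans. *)
Lemma pr_sim l l' : eorth l -> pr l = pr l' -> size l = size l' -> eorth l' /\ sim l l'.
Proof.
move=> /eorth_ncl[r lc] e1 e2.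
have lc' : cfact (l' ++ r) by case: lc => c1 c2; split; [rewrite pr_cat -e1 -pr_cat|move: c2; rewrite !size_cat e2].
split; first by apply: ncl_eorth; exists r.
by split=> // x; rewrite (span_complement x lc) (span_complement x lc').
Qed.

Lemma sim_rcons t l l' : sim l l' -> sim (rcons l t) (rcons l' t).
Proof.
case=> e1 e2 e3; split; rewrite ?big_rcons /= ?e1 ?size_rcons ?e2 // => x.
by rewrite !span_rcons; split=> -[a [a0 /e3 ?]]; exists a.
Qed.

Lemma eorth_extendr m l : eorth m -> eorth l -> (forall t, t \in l -> span m (rho t)) ->
  exists l', sim m (l' ++ l).
Proof.
elim/last_ind: l m => [|l t IH] m em el lm; first by exists m; rewrite cats0; apply: sim_refl.
have tin : t \in rcons l t by rewrite mem_rcons mem_head.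
have [m1 em1 e1] := eorth_peel_right em (lm t tin).
have := el; rewrite eorth_rcons => /andP[/allP tl el0].
have := em1; rewrite eorth_rcons => /andP[_ em1'].
have [|l' e2] := IH m1 em1' el0.
  move=> u ul; apply/(span_rconsE em1); split; last exact/eqP/tl.
  by case: e1 => _ _ <-; apply: lm; rewrite mem_rcons inE ul orbT.
by exists l'; rewrite -rcons_cat; apply: sim_trans e1 (sim_rcons _ e2).
Qed.

(** * Divisibility in the dual braid monoid *)

Local Notation beq := (@braid_eq n gT s).

Lemma beq_rcons (x y : seq (refl s)) t : beq x y -> beq (rcons x t) (rcons y t).
Proof. by rewrite -!cats1 => xy; apply: braid_eq_cat => //; apply: BraidRefl. Qed.

(** The defining relation for u^t and t, read backwards. *)
Lemma beq_swap (x : seq (refl s)) t u : E (rho u) (rho t) = 0 ->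
  beq (rcons (rcons x t) u) (rcons (rcons x (rconj u (val t))) t).
Proof.
move=> e; apply: BraidSym; rewrite -!cats1 -!catA /=.
have := @BraidStep n gT s x [::] (rconj u (val t)) t.
rewrite rconjK /= conjgE refl_inv -!mulgA refl_invol mulg1; apply.
by apply/abs_le_pair; right.
Qed.

Definition topmost l u := span l (rho u) /\ forall t, span l (rho t) -> ~~ prec u t.

Lemma topmost_uniq l l' u u' : sim l l' -> topmost l u -> topmost l' u' -> u = u'.
Proof.
move=> [_ _ e] [ul uP] [ul' uP']; apply/eqP; apply: contraT => /prec_total.
by rewrite (negPf (uP _ _)) ?(negPf (uP' _ _)) //; [apply/e|apply/e].
Qed.

(* Climbing: a reduced word that does not end with the largest reflection of
   its parabolic can be changed by braid relations into one ending higher. *)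
Lemma hurwitz l l' : eorth l -> pr l = pr l' -> size l = size l' -> beq l l'.
Proof.
have [r] := ubnP (size l); elim: r => // r IHr in l l' *; rewrite ltnS.
(* The inner induction is on the number of reflections from u upwards; the outer one, on the length,
   rewrites the letters before u so that they end with a higher reflection. *)
have climb (k : nat) m u : (N - rank_of u <= k)%N -> (size m < r)%N -> eorth (rcons m u) ->
    exists m' u', [/\ beq (rcons m u) (rcons m' u'), eorth (rcons m' u'), sim (rcons m u) (rcons m' u')
      & topmost (rcons m u) u'].
  elim: k m u => [|k IHk] m u; first by have := rank_of_ltN u; lia.
  move=> ku mr emu; have us : span (rcons m u) (rho u) by apply: comb_mem; rewrite mem_rcons mem_head.
  have [top|[u' [us' uu']]] : topmost (rcons m u) u \/ exists u', span (rcons m u) (rho u') /\ prec u u'.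
    have [ex|nex] := pselect (exists u', span (rcons m u) (rho u') /\ prec u u'); [by right|left].
    by split=> // t tu; apply/negP => ut; apply: nex; exists t.
  - by exists m, u; split=> //; apply: BraidRefl.
  have [t [ts ut e]] := exists_above emu us us' uu'.
  have em : eorth m by move: emu; rewrite eorth_rcons => /andP[].
  have tm : span m (rho t) by apply/(span_rconsE emu).
  have [m2 em2 [e1 e2 e3]] := eorth_peel_right em tm.
  have b1 : beq (rcons m u) (rcons (rcons m2 t) u) by apply/beq_rcons/IHr.
  have b2 := beq_swap m2 e.
  have [em3 s3] : eorth (rcons (rcons m2 (rconj u (val t))) t) /\
      sim (rcons m u) (rcons (rcons m2 (rconj u (val t))) t).
    apply: pr_sim => //; last by rewrite !size_rcons e2 size_rcons.
    by rewrite !big_rcons /= e1 big_rcons /= conjgE refl_inv -!mulgA refl_invol mulg1.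
  have [||//|m' [u'' [b4 em4 s4 [t4 t4P]]]] := IHk (rcons m2 (rconj u (val t))) t.
  - by have := rank_of_ltN t; have := rank_of_ltN u; move: ut; rewrite rank_of_lt; lia.
  - by move: mr; rewrite e2 !size_rcons.
  exists m', u''; split=> //.
  - exact: BraidTrans b1 (BraidTrans b2 b4).
  - exact: sim_trans s3 s4.
  - by case: s3 => _ _ s3; split; [apply/s3|move=> v /s3/t4P].
case/lastP: l => [|m u]; first by move=> _ _ _ /esym/size0nil->; apply: BraidRefl.
case/lastP: l' => [|m' u']; first by rewrite size_rcons.
move=> sz el e1 e2; have [el' sl] := pr_sim el e1 e2.
rewrite !size_rcons in sz e2; have [//|//|m1 [u1 [b1 em1 s1 t1]]] := climb _ m u (leqnn _).
have [|//|m2 [u2 [b2 em2 s2 t2]]] := climb _ m' u' (leqnn _); first by case: e2 => <-.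
have u12 := topmost_uniq sl t1 t2; rewrite -u12 in b2 em2 s2.
apply: BraidTrans b1 (BraidTrans _ (BraidSym b2)); apply/beq_rcons.
have [p1 z1 _] := s1; have [p2 z2 _] := s2; rewrite !size_rcons in z1 z2.
apply: IHr; first by lia.
- by move: em1; rewrite eorth_rcons => /andP[].
- by apply: (mulIg (val u1)); move: p1 p2; rewrite !big_rcons /= => <- <-; move: e1; rewrite !big_rcons.
- by lia.
Qed.

Definition is_join p q j := [/\ eorth j, forall t, t \in p ++ q -> span j (rho t) &
  forall l, eorth l -> (forall t, t \in p ++ q -> span l (rho t)) -> forall x, span j x -> span l x].

Lemma E_spanl l x y : (forall t, t \in l -> E (rho t) y = 0) -> span l x -> E x y = 0.
Proof.
move=> yl; apply: (comb_ind (Q := fun z => E z y = 0)); first by rewrite E0l.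
by move=> a t z _ tl z0; rewrite !E_lin z0 yl // mulr0 addr0.
Qed.

(** Write c as l1 u. The span of l1 is the kernel of E (ρ u), so l1 is an upper bound of p and q and
    contains their join. *)
Lemma join_orth p q j u : is_join p q j -> (forall t, t \in p ++ q -> E (rho u) (rho t) = 0) ->
  forall x, span j x -> E (rho u) x = 0.
Proof.
move=> [ej _ min] uP x xj; have [l0 sl0 l0c] := simple_slist.
have el0 := ncl_eorth (proj1 sl0); have full := cfact_span l0c.
have [l1 el1 [_ _ e]] := eorth_peel_right el0 (full (rho u)).
have [el1' fullr] : eorth l1 /\ forall x, span (rcons l1 u) x.
  by move: el1; rewrite eorth_rcons => /andP[_ ->]; split=> // y; apply/e.
have [] // := proj1 (span_rconsE el1 x).
by apply: min xj => // t /uP tu; apply/(span_rconsE el1).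
Qed.

Lemma eorth_catP l1 l2 : eorth l1 -> eorth l2 ->
  (forall t u, t \in l1 -> u \in l2 -> E (rho u) (rho t) = 0) -> eorth (l1 ++ l2).
Proof.
by move=> e1 e2 h; rewrite eorth_cat e1 e2 !andbT; apply/allrelP => t u tl ul; apply/eqP/h.
Qed.

Lemma eorth_catl l1 l2 : eorth (l1 ++ l2) -> eorth l1.
Proof. by rewrite eorth_cat => /and3P[]. Qed.

Lemma eorth_cat_orth l1 l2 t u : eorth (l1 ++ l2) -> t \in l1 -> u \in l2 -> E (rho u) (rho t) = 0.
Proof. by rewrite eorth_cat => /and3P[/allrelP h _ _] tl ul; apply/eqP/h. Qed.

(* Garside: a common multiple of p and q is a multiple of their join. *)
Definition lcm_property (L : nat) := forall b1 p b2 q j, size (b1 ++ p) = L ->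
  eorth p -> eorth q -> is_join p q j -> beq (b1 ++ p) (b2 ++ q) ->
  exists h p' q', [/\ sim j (p' ++ p), sim j (q' ++ q), beq b1 (h ++ p') & beq b2 (h ++ q')].

(** The hard case is transitivity: the middle word with last letter a'' gives two factorizations of
    its prefix, which is shorter, so the hypothesis compares them. By [join_orth] the join of p' and
    r can still be followed by a''. *)
Lemma last_letters (L : nat) : (forall K, (K < L)%N -> lcm_property K) ->
  forall w w', beq w w' ->
  forall (y : seq (refl s)) u (y' : seq (refl s)) u', w = rcons y u -> w' = rcons y' u' -> size w = L ->
  exists h p p', [/\ eorth (rcons p u), sim (rcons p u) (rcons p' u'),
    beq y (h ++ p) & beq y' (h ++ p')].
Proof.
move=> IH w w'; elim=> {w w'} [w|w w' ww' IHw|w w'' w' ww'' IH1 w''w' IH2|w w' t u tu] y a y' a' wE w'E szw.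
- move: w'E; rewrite wE => /rcons_inj[-> ->].
  exists y', [::], [::]; rewrite !cats0; split=> //; exact: BraidRefl.
- have [|h [p [p' [ep e b b']]]] := IHw _ _ _ _ w'E wE.
    by rewrite (braid_eq_size ww').
  by exists h, p', p; split=> //; [exact: sim_eorth ep e|exact: sim_sym].
- have sz'' := braid_eq_size ww''; have [y'' [a'' w''E]] : exists (y'' : seq (refl s)) a'', w'' = rcons y'' a''.
    case/lastP: w'' sz'' {ww'' w''w' IH1 IH2} => [|y'' a'' _]; last by exists y'', a''.
    by rewrite wE size_rcons.
  have [h [p [p' [ep e b b']]]] := IH1 _ _ _ _ wE w''E szw.
  have [|g [r [r' [er e2 b2 b2']]]] := IH2 _ _ _ _ w''E w'E; first by rewrite -sz''.
  have ep' := sim_eorth ep e; have er' := sim_eorth er e2.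
  have := ep'; rewrite eorth_rcons => /andP[/allP p'a ep'0].
  have := er; rewrite eorth_rcons => /andP[/allP ra er0].
  have hg : beq (h ++ p') (g ++ r) := BraidTrans (BraidSym b') b2.
  have [j jP] := join_exists ep'0 er0.
  have szK : (size (h ++ p') < L)%N.
    by rewrite -(braid_eq_size b') -szw sz'' w''E size_rcons.
  have [k [c1 [c2 [s1 s2 hk gk]]]] := IH _ szK _ _ _ _ j erefl ep'0 er0 jP hg.
  have [ej _ _] := jP; have ec1 := sim_eorth ej s1.
  have e0 : eorth (rcons (c1 ++ p') a'').
    rewrite eorth_rcons ec1 andbT; apply/allP => x xc; apply/eqP.
    apply: (join_orth jP) => [v|]; last by case: s1 => _ _ ->; apply: comb_mem.
    by rewrite mem_cat => /orP[/p'a/eqP|/ra/eqP].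
  have [pr1 sz1 _] := e; have [pr2 sz2 _] := e2; have [prj1 szj1 _] := s1; have [prj2 szj2 _] := s2.
  have [ex sx] : eorth (rcons (c1 ++ p) a) /\ sim (rcons (c1 ++ p') a'') (rcons (c1 ++ p) a).
    apply: pr_sim => //; last by move: sz1; rewrite !(size_rcons, size_cat); clear; lia.
    by rewrite !rcons_cat !pr_cat pr1.
  have [_ sx'] : eorth (rcons (c2 ++ r') a') /\ sim (rcons (c1 ++ p') a'') (rcons (c2 ++ r') a').
    apply: pr_sim => //; last by move: sz2; rewrite !size_rcons -szj1 szj2 !size_cat; clear; lia.
    transitivity (pr (rcons (c2 ++ r) a'')); first by rewrite !big_rcons -prj1 prj2.
    by rewrite !rcons_cat !pr_cat pr2.
  exists k, (c1 ++ p), (c2 ++ r'); split=> //.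
  + exact: sim_trans (sim_sym sx) sx'.
  + apply: BraidTrans b _; rewrite catA; apply: braid_eq_cat hk _; exact: BraidRefl.
  + apply: BraidTrans b2' _; rewrite catA; apply: braid_eq_cat gk _; exact: BraidRefl.
case/lastP: w' wE w'E szw => [|w' b] wE w'E szw; last first.
  move: wE w'E; rewrite -!rcons_cat => /rcons_inj[<- <-] /rcons_inj[<- <-].
  exists (w ++ [:: u; rconj t (val u)] ++ w'), [::], [::]; rewrite !cats0; split=> //.
  - exact: BraidStep.
  - exact: BraidRefl.
move: wE w'E; rewrite !cats0 -!cats1 -[[:: t; u]]/([:: t] ++ [:: u]) -[[:: u; _]]/([:: u] ++ [:: rconj t (val u)]).
rewrite !catA !cats1 => /rcons_inj[<- <-] /rcons_inj[<- <-].
have [tuE|e] := proj1 (abs_le_pair _ _) tu.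
  have -> : rconj t (val u) = u.
    by rewrite tuE; apply: val_inj; rewrite /= conjgE mulKg.
  exists (rcons w t), [::], [::]; rewrite !cats0 tuE; split=> //; exact: BraidRefl.
exists w, [:: t], [:: u]; rewrite !cats1.
have ee : eorth [:: t; u] by rewrite /eorth /= e eqxx.
split=> //; try exact: BraidRefl.
have [||//] := @pr_sim [:: t; u] [:: u; rconj t (val u)] ee; last by [].
by rewrite !big_cons !big_nil /= conjgE !mulg1 mulKVg.
Qed.

Lemma lcmP (L : nat) : lcm_property L.
Proof.
have [r] := ubnP L; elim: r => // r IHr in L *; rewrite ltnS => Lr.
have IH K : (K < L)%N -> lcm_property K by move=> KL; apply: IHr; lia.
move=> b1 p b2 q j sz ep eq_ jP beq12.
have [ej jpq jmin] := jP.
(* Any noncrossing common multiple A1 p = A2 q dividing the given element suffices: it is a multiple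
   K j of the join, and K is absorbed into the prefix m. *)
suff [m [A1 [A2 [eA1 sA bm1 bm2]]]] : exists m A1 A2,
    [/\ eorth (A1 ++ p), sim (A1 ++ p) (A2 ++ q), beq b1 (m ++ A1) & beq b2 (m ++ A2)].
  have eA2 := sim_eorth eA1 sA.
  have [|K sK] := @eorth_extendr (A1 ++ p) j eA1 ej.
    move=> t tj; apply: jmin => [//|v|]; last exact: comb_mem.
    rewrite mem_cat => /orP[vp|vq]; first by apply: comb_mem; rewrite mem_cat vp orbT.
    by case: sA => _ _ ->; apply: comb_mem; rewrite mem_cat vq orbT.
  have [|p' sp] := eorth_extendr ej ep; first by move=> t tp; apply: jpq; rewrite mem_cat tp.
  have [|q' sq] := eorth_extendr ej eq_; first by move=> t tq; apply: jpq; rewrite mem_cat tq orbT.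
  exists (m ++ K), p', q'; split=> //.
  - apply: BraidTrans bm1 _; rewrite -catA; apply: braid_eq_cat; first exact: BraidRefl.
    have [x1 z1 _] := sK; have [x2 z2 _] := sp.
    apply: hurwitz (eorth_catl eA1) _ _; last by move: z1 z2; rewrite !size_cat; clear; lia.
    by apply: (mulIg (pr p)); rewrite -!pr_cat x1 pr_cat x2 -pr_cat catA.
  - apply: BraidTrans bm2 _; rewrite -catA; apply: braid_eq_cat; first exact: BraidRefl.
    have [x1 z1 _] := sim_trans (sim_sym sA) sK; have [x2 z2 _] := sq.
    apply: hurwitz (eorth_catl eA2) _ _; last by move: z1 z2; rewrite !size_cat; clear; lia.
    by apply: (mulIg (pr q)); rewrite -!pr_cat x1 pr_cat x2 -pr_cat catA.
case/lastP: p ep sz jP beq12 jpq jmin => [|p0 u] ep sz jP beq12 jpq jmin.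
  rewrite cats0 in beq12; exists b2, q, [::]; rewrite !cats0; split=> //.
  exact: BraidRefl.
case/lastP: q eq_ jP beq12 jpq jmin => [|q0 u'] eq_ jP beq12 jpq jmin.
  rewrite cats0 in beq12; exists b1, [::], (rcons p0 u); rewrite !cats0; split=> //.
  - exact: BraidRefl.
  - exact: BraidSym.
rewrite -!rcons_cat in beq12 sz; rewrite size_rcons in sz.
have [|h [r1 [r2 [er1 sr by1 by2]]]] := last_letters IH beq12 erefl erefl; first by rewrite size_rcons.
have er2 := sim_eorth er1 sr.
have [ep0 pu] : eorth p0 /\ forall t, t \in p0 -> E (rho u) (rho t) = 0.
  by move: ep; rewrite eorth_rcons => /andP[/allP pu ->]; split=> // t /pu/eqP.
have [eq0 qu] : eorth q0 /\ forall t, t \in q0 -> E (rho u') (rho t) = 0.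
  by move: eq_; rewrite eorth_rcons => /andP[/allP pu' ->]; split=> // t /pu'/eqP.
have [er10 ru] : eorth r1 /\ forall t, t \in r1 -> E (rho u) (rho t) = 0.
  by move: er1; rewrite eorth_rcons => /andP[/allP pu' ->]; split=> // t /pu'/eqP.
have [er20 ru'] : eorth r2 /\ forall t, t \in r2 -> E (rho u') (rho t) = 0.
  by move: er2; rewrite eorth_rcons => /andP[/allP pu' ->]; split=> // t /pu'/eqP.
(* Both b1 p0 and b2 q0 are multiples of h. The induction hypothesis is used three times: for p0
   with r1, for q0 with r2, and for the resulting right divisors e1 and e2 of h. *)
have [j1 j1P] := join_exists ep0 er10; have [j2 j2P] := join_exists eq0 er20.
have L1 : (size (b1 ++ p0) < L)%N by rewrite -sz.
have L2 : (size (b2 ++ q0) < L)%N.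
  by have := braid_eq_size beq12; rewrite !size_rcons sz => ->.
have [k [a1 [e1 [s1a s1e b1k hk]]]] := IH _ L1 _ _ _ _ j1 erefl ep0 er10 j1P by1.
have [k' [a2 [e2 [s2a s2e b2k hk']]]] := IH _ L2 _ _ _ _ j2 erefl eq0 er20 j2P by2.
have [ej1 _ _] := j1P; have [ej2 _ _] := j2P.
have ee1 := sim_eorth ej1 s1e; have ee2 := sim_eorth ej2 s2e.
have [j3 j3P] := join_exists (eorth_catl ee1) (eorth_catl ee2).
have kk : beq (k ++ e1) (k' ++ e2) := BraidTrans (BraidSym hk) hk'.
have L3 : (size (k ++ e1) < L)%N.
  by rewrite -(braid_eq_size hk) -sz ltnS (braid_eq_size by1) size_cat leq_addr.
have [m [f1 [f2 [s3f s3f' km km']]]] := IH _ L3 _ _ _ _ j3 erefl (eorth_catl ee1) (eorth_catl ee2) j3P kk.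
have [ej3 _ _] := j3P.
have orth1 (t y : refl s) : t \in e1 -> y \in rcons r1 u -> E (rho y) (rho t) = 0.
  move=> te; rewrite mem_rcons inE => /orP[/eqP->|yr]; last exact: eorth_cat_orth ee1 te yr.
  apply: (join_orth j1P) => [v|].
    by rewrite mem_cat => /orP[/pu|/ru].
  by case: s1e => _ _ ->; apply: comb_mem; rewrite mem_cat te.
have orth2 (t y : refl s) : t \in e2 -> y \in rcons r1 u -> E (rho y) (rho t) = 0.
  move=> te yr; have ys : span (rcons r2 u') (rho y) by case: sr => _ _ <-; apply: comb_mem.
  apply: E_spanl ys => z; rewrite mem_rcons inE => /orP[/eqP->|zr]; last exact: eorth_cat_orth ee2 te zr.
  apply: (join_orth j2P) => [v|].
    by rewrite mem_cat => /orP[/qu|/ru'].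
  by case: s2e => _ _ ->; apply: comb_mem; rewrite mem_cat te.
(* The letters of r1 u are E-orthogonal to e1 and to e2, hence to their join, so the pieces assemble
   into a single noncrossing element. *)
have big : eorth ((f1 ++ e1) ++ rcons r1 u).
  apply: eorth_catP => //; first exact: sim_eorth ej3 s3f.
  move=> t y tf yr; apply: (join_orth j3P) => [v|].
    by rewrite mem_cat => /orP[ve|ve]; [apply: orth1|apply: orth2].
  by case: s3f => _ _ ->; apply: comb_mem.
have [prr szr _] := sr; have [pra1 sza1 _] := sim_trans (sim_sym s1e) s1a.
have [pra2 sza2 _] := sim_trans (sim_sym s2e) s2a.
have [prf szf _] := sim_trans (sim_sym s3f) s3f'.
have [eK1 sK1] : eorth ((f1 ++ a1) ++ rcons p0 u) /\ sim ((f1 ++ e1) ++ rcons r1 u) ((f1 ++ a1) ++ rcons p0 u).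
  apply: pr_sim => //; last by move: sza1; rewrite !(size_cat, size_rcons); clear; lia.
  rewrite -!catA !pr_cat; congr (_ * _)%g; rewrite !big_rcons /= !mulgA -!pr_cat.
  by rewrite pra1.
have [eK2 sK2] : eorth ((f2 ++ a2) ++ rcons q0 u') /\ sim ((f1 ++ e1) ++ rcons r1 u) ((f2 ++ a2) ++ rcons q0 u').
  apply: pr_sim => //; last by move: sza2 szf szr; rewrite !(size_cat, size_rcons); clear; lia.
  rewrite pr_cat prf prr -pr_cat -!catA !pr_cat; congr (_ * _)%g.
  by rewrite !big_rcons /= !mulgA -!pr_cat pra2.
exists m, (f1 ++ a1), (f2 ++ a2); split=> //.
- exact: sim_trans (sim_sym sK1) sK2.
- apply: BraidTrans b1k _; rewrite catA; apply: braid_eq_cat km _; exact: BraidRefl.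
- apply: BraidTrans b2k _; rewrite catA; apply: braid_eq_cat km' _; exact: BraidRefl.
Qed.

(** For equal last letters, [last_letters] leaves two reduced words p, p' of one noncrossing
    element, which [hurwitz] identifies. *)
Lemma beq_cancel (y y' : seq (refl s)) u : beq (rcons y u) (rcons y' u) -> beq y y'.
Proof.
move=> b; have [h [p [p' [ep [e1 e2 _] b1 b2]]]] :=
  last_letters (fun K _ => lcmP (L := K)) b erefl erefl erefl.
apply: BraidTrans b1 (BraidTrans _ (BraidSym b2)).
apply: braid_eq_cat; first exact: BraidRefl.
apply: hurwitz; first by move: ep; rewrite eorth_rcons => /andP[].
  by move: e1; rewrite !big_rcons /= => /mulIg.
by move: e2; rewrite !size_rcons => -[].
Qed.

(** The element y t is a multiple of the join of t and u. By [exists_above] this join contains some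
    v ≻ t that can be written just before t, and as the join is E-orthogonal to l, the word v t l
    stays reduced. *)
Lemma beq_higher_divisor (y y' : seq (refl s)) t u l : prec t u ->
  eorth (t :: l) -> eorth (u :: l) -> beq (rcons y t) (rcons y' u) ->
  exists v (z : seq (refl s)), [/\ prec t v, eorth (v :: t :: l) & beq y (rcons z v)].
Proof.
move=> tu etl eul b; have et v : eorth [:: v] by [].
have [j jP] := join_exists (et t) (et u).
have [|h [p' [q' [sp sq yh _]]]] := @lcmP _ y [:: t] y' [:: u] j erefl (et t) (et u) jP.
  by rewrite !cats1.
have [ej jtu _] := jP.
have uin : u \in [:: t] ++ [:: u] by rewrite !inE eqxx orbT.
have [v [vj tv e]] := exists_above ej (jtu t (mem_head _ _)) (jtu u uin) tu.
have ep := sim_eorth ej sp; rewrite cats1 in ep sp.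
have vp : span p' (rho v) by apply/(span_rconsE ep); case: sp => _ _ <-.
have ep' : eorth p' by move: ep; rewrite eorth_rcons => /andP[].
have [p2 ep2 [x1 z1 _]] := eorth_peel_right ep' vp.
exists v, (h ++ p2); split=> //.
  have /allP lt : all (fun x : refl s => E (rho x) (rho t) == 0) l by case/andP: etl.
  have /allP lu : all (fun x : refl s => E (rho x) (rho u) == 0) l by case/andP: eul.
  rewrite /eorth /= -[pairwise _ l]/(eorth l) e eqxx /=; apply/andP; split; last exact: etl.
  apply/allP => x xl; apply/eqP; apply: (join_orth jP) vj => w.
  by rewrite !inE => /orP[] /eqP->; apply/eqP; [apply: lt|apply: lu].
rewrite rcons_cat; apply: BraidTrans yh _; apply: braid_eq_cat; first exact: BraidRefl.
exact: hurwitz.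
Qed.

(** * Faces and boundaries *)

Lemma decreasing_eorth l : decreasing l ->
  (forall t u, t \in l -> u \in l -> prec u t -> E (rho u) (rho t) = 0) -> eorth l.
Proof.
move=> dl h; have := dl; rewrite /decreasing /eorth.
by apply: (sub_in_pairwise (P := mem l)); [move=> t u tl ul /(h t u tl ul)->|apply/allP].
Qed.

Lemma pairwise_or (r : rel (refl s)) l t u : pairwise r l -> t \in l -> u \in l -> t != u ->
  r t u \/ r u t.
Proof.
elim: l => //= w l IH /andP[/allP wl rl]; rewrite !inE => /orP[/eqP->|tl] /orP[/eqP->|ul] tu.
- by rewrite eqxx in tu.
- by left; apply: wl.
- by right; apply: wl.
- exact: IH.
Qed.

Lemma decreasing_flag l t u : decreasing l -> eorth l -> t \in l -> u \in l -> prec u t ->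
  E (rho u) (rho t) = 0.
Proof.
move=> dl el tl ul ut.
have p : pairwise (fun t u => prec u t && (E (rho u) (rho t) == 0)) l by rewrite pairwise_relI; apply/andP.
case: (pairwise_or p tl ul) => [|/andP[_ /eqP]//|/andP[]]; first by rewrite eq_sym prec_neq.
by rewrite (negPf (prec_asym ut)).
Qed.

(** A letter of the complement is inserted by [insert_decreasing], which keeps the given letters,
    until the length is n. *)
Lemma decreasing_cluster l : decreasing l -> eorth l ->
  exists l', [/\ {subset l <= l'}, decreasing l' & cfact l'].
Proof.
have [r] := ubnP (n - size l); elim: r l => // r IH l; rewrite ltnS => lr dl el.
have [[|t l2] lc] := eorth_ncl el.
  by exists l; split=> //; rewrite cats0 in lc.
have elt : eorth (rcons l t) by apply: ncl_eorth; exists l2; rewrite cat_rcons.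
have [t1 [l1 [pl dl1 el1 _ _]]] := insert_decreasing dl elt.
have [|//|//|l' [s1 d1 c1]] := IH l1.
  by have := perm_size pl; case: lc => _; rewrite size_cat /=; move: lr; clear; lia.
by exists l'; split=> // u ul; apply: s1; rewrite (perm_mem pl) inE ul orbT.
Qed.

Lemma decreasing_dotp_ge0 l t u : decreasing l -> eorth l -> t \in l -> u \in l ->
  0 <= dotp (rho t) (rho u).
Proof.
move=> dl el tl ul; have [->|/prec_total] := eqVneq t u; first by rewrite rho1.
wlog tu : t u tl ul / prec t u.
  by move=> h /orP[] tu; [|rewrite dotpC]; apply: h => //; rewrite tu.
by move=> _; have := E_sym (rho t) (rho u); have [] := E_prec tu; rewrite (decreasing_flag dl el ul tl tu); lra.
Qed.

Lemma sort_decreasing l : uniq l -> decreasing (sort (fun t u => ~~ prec t u) l).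
Proof.
move=> ul; have tot : total (fun t u => ~~ prec t u).
  by move=> t u; rewrite -negb_and; apply/negP => /andP[/prec_asym/negP].
have tr : transitive (fun t u => ~~ prec t u).
  by move=> u t v; rewrite !rank_of_lt -!leqNgt => h1 h2; apply: leq_trans h2 h1.
have p : pairwise (fun t u => ~~ prec t u && (t != u)) (sort (fun t u => ~~ prec t u) l).
  by rewrite pairwise_relI -sorted_pairwise // sort_sorted //= -uniq_pairwise sort_uniq.
by apply: sub_pairwise p => t u /andP[/negPf tu /prec_total]; rewrite tu.
Qed.

(** For two elements of a cluster, one of the two values of E is 0, their sum is 2 <ρ t, ρ u> ≥ 0,
    and E (ρ u) (ρ t) ≤ 0 when u ≺ t; so this last value is 0. Conversely, the decreasing list of f
    is completed by [decreasing_cluster]. *)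
Lemma is_faceP (f : {set refl s}) : is_face rG alpha f <->
  forall t u, t \in f -> u \in f -> prec u t -> E (rho u) (rho t) = 0.
Proof.
have aux (a b d : R) : a + b = 2 * d -> 0 <= d -> a <= 0 -> b = 0 -> a = 0 by lra.
split=> [/orP[/eqP->|/existsP[F /andP[/existsP[l /and3P[/eqP-> /eqP lc /forallP l0]] /subsetP fl]]]|h].
- by move=> t u; rewrite inE.
- move=> t u /fl; rewrite inE => tl /fl; rewrite inE => ul ut.
  have lc' : cfact l by rewrite /cfact size_tuple.
  have [E1 _] := E_prec ut; have tu : t != u by rewrite eq_sym prec_neq.
  have := E_sym (rho u) (rho t); have := pairwise_or (cfact_eorth lc') tl ul tu.
  have d0 : 0 <= dotp (rho t) (rho u).
    move: tl ul; rewrite -!index_mem size_tuple => iN jN.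
    have := forallP (l0 (Ordinal iN)) (Ordinal jN); rewrite !(tnth_nth t) /= !nth_index -?index_mem ?size_tuple //.
    by move/implyP; apply; apply: contra_neq tu => -[] /(congr1 (nth t l)); rewrite !nth_index -?index_mem ?size_tuple.
  by rewrite (dotpC (rho u)) => -[] /eqP // E2 ES; apply: aux ES d0 E1 E2.
set l := sort (fun t u => ~~ prec t u) (enum f).
have lf : l =i f by move=> t; rewrite mem_sort mem_enum.
have dl : decreasing l by apply/sort_decreasing/enum_uniq.
have el : eorth l by apply: decreasing_eorth => // t u; rewrite !lf; apply: h.
have [l' [sub dl' lc]] := decreasing_cluster dl el.
have sz : size l' == n by case: lc => _ ->.
apply/orP; right; apply/existsP; exists [set t in l']; apply/andP; split; last first.
  by apply/subsetP => t tf; rewrite inE sub // lf.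
apply/existsP; exists (Tuple sz); rewrite eqxx; case: lc (lc) => -> _ lc; rewrite eqxx /=.
apply/'forall_forallP => i j; apply/implyP => _.
by apply: (decreasing_dotp_ge0 dl' (cfact_eorth lc)); apply: mem_tnth.
Qed.

Definition del (i : nat) l := take i l ++ drop i.+1 l.

Lemma size_del i l : (i < size l)%N -> size (del i l) = (size l).-1.
Proof. by move=> il; rewrite size_cat size_take size_drop il; lia. Qed.

Lemma del_sub i l : subseq (del i l) l.
Proof.
rewrite -{2}(cat_take_drop i l) cat_subseq //.
by rewrite -addn1 addnC -drop_drop drop_subseq.
Qed.

Definition reduced_decreasing l := decreasing l && eorth l.

Lemma reduced_decreasing_sub l l' : subseq l' l -> reduced_decreasing l -> reduced_decreasing l'.
Proof. by move=> sl /andP[dl el]; apply/andP; split; apply: subseq_pairwise sl _. Qed.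

Local Notation fc := (@face n gT s R rG alpha).
Local Notation fseq := (@face_seq n gT s R rG alpha prec _).

Lemma face_seq_inj p : injective (fun f : fc p => fseq f).
Proof.
move=> f g e; apply/val_inj/setP => t; rewrite -mem_enum -[RHS]mem_enum.
by rewrite -(mem_sort (fun t u => ~~ prec t u)) [X in t \in X]e mem_sort.
Qed.

Lemma mem_face_seq p (f : fc p) : fseq f =i val f.
Proof. by move=> t; rewrite mem_sort mem_enum. Qed.

Lemma face_seq_reduced p (f : fc p) : reduced_decreasing (fseq f).
Proof.
have dl : decreasing (fseq f) by apply/sort_decreasing/enum_uniq.
apply/andP; split=> //; apply: decreasing_eorth => // t u; rewrite !mem_face_seq.
by have /andP[/is_faceP h _] := valP f; apply: h.
Qed.

Lemma decreasing_eq l l' : decreasing l -> decreasing l' -> l =i l' -> l = l'.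
Proof.
have anti : antisymmetric (fun t u => prec u t).
  by move=> t u /andP[/prec_asym/negPf->].
have tr : transitive (fun t u => prec u t) by move=> u t v h1 h2; apply: prec_trans h2 h1.
rewrite /decreasing -!sorted_pairwise // => s1 s2.
by apply: (irr_sorted_eq (leT := fun t u => prec u t)) => // t; apply: prec_irr.
Qed.

Lemma face_of_seq p l : reduced_decreasing l -> size l = p -> exists f : fc p, fseq f = l.
Proof.
move=> /andP[dl el] sl; have h : is_face rG alpha [set t in l] && (#|[set t in l]| == p).
  apply/andP; split; last by rewrite cardsE (card_uniqP (eorth_uniq el)) sl.
  by apply/is_faceP => t u; rewrite !inE; apply: decreasing_flag.
exists (exist (fun f : {set refl s} => is_face rG alpha f && (#|f| == p)) _ h).
apply: decreasing_eq => // [|t]; first by apply/sort_decreasing/enum_uniq.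
by rewrite mem_face_seq inE.
Qed.

Lemma face_seq_del p (f : fc p.+1) i : fseq (face_del prec f i) = del i (fseq f).
Proof.
have sz : size (fseq f) = p.+1 := eqP (face_seq_size prec f).
have /andP[df ef] := face_seq_reduced f.
have /andP[dd _] := reduced_decreasing_sub (del_sub i (fseq f)) (face_seq_reduced f).
apply: decreasing_eq => // [|t]; first by case/andP: (face_seq_reduced (face_del prec f i)).
have iN : (i < size (fseq f))%N by rewrite sz.
rewrite mem_face_seq /= !inE -mem_face_seq.
pose x := tnth (face_vtx prec f) i; have xE : x = nth x (fseq f) i by rewrite {1}/x (tnth_nth x).
rewrite -/x.
have := eorth_uniq ef; rewrite -{1 2}(cat_take_drop i (fseq f)) (drop_nth x) // -xE.
rewrite cat_uniq /= mem_cat inE negb_or => /and4P[_ /andP[x1 _] x2 _]; rewrite mem_cat.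
by case: eqVneq => //= ->; rewrite (negPf x1) (negPf x2).
Qed.

(* The reflections t_i^(t_(i-1), ..., t_0). *)
Definition conjs l := foldr (fun t m => t :: [seq rconj u (val t) | u <- m]) [::] l.

Lemma size_conjs l : size (conjs l) = size l.
Proof. by elim: l => //= t l <-; rewrite size_map. Qed.

Lemma nth_conjs_cons (t0 t : refl s) l (i : nat) : (i < size l)%N ->
  nth t0 (conjs (t :: l)) i.+1 = rconj (nth t0 (conjs l) i) (val t).
Proof. by move=> il; rewrite /= (nth_map t0) // size_conjs. Qed.

Lemma nth_conjs (t0 : refl s) l (i : nat) : (i < size l)%N ->
  nth t0 (conjs l) i = rconj (nth t0 l i) (pr (rev (take i l))).
Proof.
elim: l i => // t l IH [_|i il]; first by apply: val_inj; rewrite /= big_nil conjg1.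
rewrite nth_conjs_cons // IH //; apply: val_inj.
by rewrite /= rev_cons big_rcons /= -conjgM.
Qed.

(** The conjugates read backwards form another word of the same element; this is why [conjs_eorth]
    reverses the order. *)
Lemma pr_conjs l : pr (rev (conjs l)) = pr l.
Proof.
elim: l => [|t l IH]; first by rewrite !big_nil.
by rewrite /= rev_cons big_rcons /= -map_rev pr_conj IH big_cons conjgE refl_inv -!mulgA refl_invol mulg1.
Qed.

Lemma conjs_eorth l (t0 : refl s) (i j : nat) : eorth l -> (i < j < size l)%N ->
  E (rho (nth t0 (conjs l) i)) (rho (nth t0 (conjs l) j)) = 0.
Proof.
move=> el /andP[ij jl]; have sz : size l = size (rev (conjs l)) by rewrite size_rev size_conjs.
have [+ _] := pr_sim el (esym (pr_conjs l)) sz.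
rewrite /eorth => /(pairwiseP t0)/(_ (size l - j.+1)%N (size l - i.+1)%N); rewrite !inE -sz.
rewrite !nth_rev ?size_conjs; [|lia|lia].
have -> : (size l - (size l - j.+1).+1 = j)%N by lia.
have -> : (size l - (size l - i.+1).+1 = i)%N by lia.
by move=> h; apply/eqP/h; lia.
Qed.

Lemma conjs_del_lt (t0 : refl s) l (i j : nat) : (i < j < size l)%N ->
  nth t0 (conjs (del j l)) i = nth t0 (conjs l) i.
Proof.
move=> /andP[ij jl]; have il : (i < size (del j l))%N by rewrite size_del //; lia.
rewrite !nth_conjs //; last lia.
by rewrite /del take_cat nth_cat size_take jl ij take_takel ?nth_take // ltnW.
Qed.

(** Conjugating by the entry i of [conjs] removes the letter of index i from the conjugators of the
    later letters. *)
Lemma conjs_del_ge (t0 : refl s) l (i j : nat) : (i <= j)%N -> (j.+1 < size l)%N ->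
  nth t0 (conjs (del i l)) j =
  rconj (nth t0 (conjs l) j.+1) (val (nth t0 (conjs l) i)).
Proof.
elim: l i j => // t l IH [|i] j ij jl.
  by rewrite nth_conjs_cons // /del /= drop0 rconjK.
case: j ij jl => // j ij jl; rewrite nth_conjs_cons //.
have il : (i < size l)%N by move: ij jl => /=; clear; lia.
have -> : del i.+1 (t :: l) = t :: del i l by [].
rewrite !nth_conjs_cons ?IH // ?size_del //; last by move: jl => /=; clear; lia.
by apply: val_inj; rewrite /= conjJg.
Qed.

(** * The boundary on decreasing words *)

Variable k : fieldType.
Local Notation A := {malg k[dual_braid s]}.
Local Notation gen := (@dbgen n gT s).
Local Notation mon X := (malgmod k (dual_braid s) X).
Local Notation bd := (@boundary n gT s R rG alpha prec k _).

(* [tens], indexed by decreasing words instead of faces. *)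
Definition lift p (a : A) l : mon (fc p) := [ffun f => if fseq f == l then a else 0].

Lemma liftD p a b l : lift p (a + b) l = lift p a l + lift p b l.
Proof. by apply/ffunP => f; rewrite !ffunE; case: ifP; rewrite ?addr0. Qed.

Lemma lift0 p l : lift p 0 l = 0.
Proof. by apply/ffunP => f; rewrite !ffunE if_same. Qed.

Lemma tens_lift p a (f : fc p) : tens a f = lift p a (fseq f).
Proof. by apply/ffunP => g; rewrite !ffunE (inj_eq (@face_seq_inj p)). Qed.

Lemma lift_decomp p (v : mon (fc p)) : v = \sum_f lift p (v f) (fseq f).
Proof.
apply/ffunP => g; rewrite sum_ffunE (bigD1 g) //= ffunE eqxx big1 ?addr0 // => f fg.
by rewrite ffunE (inj_eq (@face_seq_inj p)) eq_sym (negPf fg).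
Qed.

Lemma face_refl_nth (t0 : refl s) p (f : fc p.+1) i : face_refl prec f i = nth t0 (conjs (fseq f)) i.
Proof.
have iN : (i < size (fseq f))%N by rewrite (eqP (face_seq_size prec f)).
by rewrite nth_conjs // /face_refl (tnth_nth t0).
Qed.

Lemma boundary_lift (t0 : refl s) p (a : A) l : reduced_decreasing l -> size l = p.+1 ->
  bd (lift p.+1 a l) =
  \sum_(i < p.+1) (-1) ^+ i *: lift p (a * << gen (nth t0 (conjs l) i) >>) (del i l).
Proof.
move=> rl sl; have [f fl] := face_of_seq rl sl; rewrite -fl -tens_lift.
pose F (g : fc p.+1) (a : A) := \sum_(i < p.+1) (-1) ^+ i *:
  tens (a * << dbgen (face_refl prec g i) >>) (face_del prec g i).
have F0 (g : fc p.+1) : F g 0 = 0.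
  by rewrite /F big1 // => i _; rewrite mul0r tens0 scaler0.
rewrite /boundary [LHS](sum_tens a f F0) /F.
by apply: eq_bigr => i _; rewrite (face_refl_nth t0) tens_lift face_seq_del.
Qed.

Lemma del_del l (i j : nat) : (i <= j)%N -> del i (del j.+1 l) = del j (del i l).
Proof.
elim: l i j => // t l IH [|i] [|j] // ij.
- by rewrite /del /= !drop0.
- by rewrite /del /= !drop0.
- by have := IH i j ij; rewrite /del /= => ->.
Qed.

(** The usual pairing behind ∂∂ = 0: removing entry j + 1 and then i, against i and then j. *)
Lemma double_sum_cancel (V : zmodType) (m : nat) (F : nat -> nat -> V) :
  (forall i j, (i <= j < m)%N -> F j.+1 i = - F i j) ->
  \sum_(i < m.+1) \sum_(j < m) F i j = 0.
Proof.
elim: m => [|m IH] h; first by rewrite big_ord1 big_ord0.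
rewrite big_ord_recr /=.
under eq_bigr do rewrite big_ord_recr /=.
rewrite big_split /= IH ?add0r; last by move=> i j ij; apply: h; move: ij; clear; lia.
by rewrite -big_split /= big1 // => i _; rewrite h ?subrr // leq_ord ltnSn.
Qed.

Lemma double_sum_single (V : zmodType) (I J : finType) (F : I -> J -> V) i j :
  (forall i' j', ~ (i' = i /\ j' = j) -> F i' j' = 0) -> \sum_i' \sum_j' F i' j' = F i j.
Proof.
move=> h; rewrite (bigD1 i) //= (bigD1 j) //= big1 => [|j' jj]; last first.
  by apply: h => -[_ e]; rewrite e eqxx in jj.
by rewrite addr0 big1 ?addr0 // => i' ii; apply: big1 => j' _; apply: h => -[e]; rewrite e eqxx in ii.
Qed.

(** This is a single defining relation of D(W), available because the conjugates i and j + 1 are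
    E-orthogonal. *)
Lemma gen_conjs (t0 : refl s) l (i j : nat) : eorth l -> (i <= j)%N -> (j.+1 < size l)%N ->
  mmul (gen (nth t0 (conjs l) j.+1)) (gen (nth t0 (conjs (del j.+1 l)) i)) =
  mmul (gen (nth t0 (conjs l) i)) (gen (nth t0 (conjs (del i l)) j)).
Proof.
move=> el ij jl; rewrite conjs_del_lt ?ltnS ?ij // conjs_del_ge //.
rewrite -[LHS]dbword_cat -[RHS]dbword_cat; apply/dbwordP.
apply: (@BraidStep n gT s [::] [::]); apply/abs_le_pair; right.
by apply: conjs_eorth => //; rewrite ltnS ij.
Qed.

Lemma mul_gen2 (a : A) (x y : dual_braid s) : a * << x >> * << y >> = a * << mmul x y >>.
Proof. by rewrite -mulrA malgUM. Qed.

Lemma boundary_lift2 (t0 : refl s) p a l : reduced_decreasing l -> size l = p.+2 ->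
  bd (bd (lift p.+2 a l)) = 0.
Proof.
move=> rl sl; rewrite (boundary_lift t0) // linear_sum /=.
pose F (i j : nat) := (-1) ^+ i *: ((-1) ^+ j *: lift p
  (a * << mmul (gen (nth t0 (conjs l) i)) (gen (nth t0 (conjs (del i l)) j)) >>) (del j (del i l))).
rewrite (eq_bigr (fun i : 'I_p.+2 => \sum_(j < p.+1) F i j)); last first.
  move=> i _; rewrite linearZ /= (boundary_lift t0) ?size_del ?sl ?ltn_ord //; last first.
    by apply: reduced_decreasing_sub rl; apply: del_sub.
  by rewrite scaler_sumr; apply: eq_bigr => j _; rewrite mul_gen2.
have /andP[_ el] := rl.
apply: double_sum_cancel => i j /andP[ij jp]; rewrite /F del_del // gen_conjs ?sl //.
by move: (lift _ _ _) => v; rewrite !scalerA -!exprD addSn exprS mulN1r scaleNr addnC.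
Qed.

Lemma face_has_vertex p (f : fc p) : (0 < p)%N -> exists t0 : refl s, t0 \in fseq f.
Proof.
move=> p0; have := eqP (face_seq_size prec f); case: (fseq f) => [|t l _].
  by move=> e; rewrite -e in p0.
by exists t; rewrite mem_head.
Qed.

Lemma boundary_decomp p (v : mon (fc p.+1)) : bd v = \sum_f bd (lift p.+1 (v f) (fseq f)).
Proof. by rewrite {1}[v]lift_decomp (linear_sum (@boundary n gT s R rG alpha prec k p)). Qed.

Lemma boundaryD p : {morph @boundary n gT s R rG alpha prec k p : v w / v + w}.
Proof. exact: linearD. Qed.

Lemma boundaryN p : {morph @boundary n gT s R rG alpha prec k p : v / - v}.
Proof. exact: linearN. Qed.

Lemma boundary2 p (v : mon (fc p.+2)) : bd (bd v) = 0.
Proof.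
rewrite (boundary_decomp v) (linear_sum (@boundary n gT s R rG alpha prec k p)) /= big1 // => f _.
have [//|t0 _] := face_has_vertex f; rewrite (boundary_lift2 t0) ?face_seq_reduced //.
exact: eqP (face_seq_size prec f).
Qed.

(** * The matching *)

(* The matching pairs b M ⊗ f with b ⊗ (M ∪ f) for the largest possible M ≻ f;
   these are the second members of the pairs, and the unmatched 1 ⊗ ∅. *)
Definition upper (b : dual_braid s) l := if l is t :: m then
    forall u b', prec t u -> mmul b (gen t) = mmul b' (gen u) -> ~ eorth (u :: m)
  else b = mone.

Definition uppers p (v : mon (fc p)) := forall (f : fc p) (b : dual_braid s), b \in msupp (v f) -> upper b (fseq f).

Definition reducible p (v : mon (fc p)) := exists w (v' : mon (fc p)), v = bd w + v' /\ uppers v'.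

Lemma uppers0 p : uppers (0 : mon (fc p)).
Proof. by move=> f b; rewrite ffunE msupp0. Qed.

Lemma reducibleD p (v w : mon (fc p)) : reducible v -> reducible w -> reducible (v + w).
Proof.
move=> [v1 [v2 [-> v2P]]] [w1 [w2 [-> w2P]]]; exists (v1 + w1), (v2 + w2); split.
  by rewrite boundaryD addrACA.
move=> f b; rewrite ffunE => /(fsubsetP (msuppD_le _ _)); rewrite inE => /orP[].
  exact: v2P.
exact: w2P.
Qed.

Lemma reducibleN p (v : mon (fc p)) : reducible v -> reducible (- v).
Proof.
move=> [v1 [v2 [-> v2P]]]; exists (- v1), (- v2); split; first by rewrite boundaryN opprD.
by move=> f b; rewrite ffunE msuppN; apply: v2P.
Qed.

Lemma reducible_sum p I (r : seq I) (P : pred I) (F : I -> mon (fc p)) :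
  (forall i, P i -> reducible (F i)) -> reducible (\sum_(i <- r | P i) F i).
Proof.
move=> h; apply: big_ind => //; last exact: reducibleD.
by exists 0, 0; rewrite linear0 addr0; split=> //; apply: uppers0.
Qed.

Lemma reducible_sign p (i : nat) (v : mon (fc p)) : reducible v -> reducible ((-1) ^+ i *: v).
Proof.
by rewrite -signr_odd; case: odd; rewrite ?expr1 ?expr0 ?scaleN1r ?scale1r //; apply: reducibleN.
Qed.

Lemma reducible_upper p (a : k) (b : dual_braid s) l : upper b l -> reducible (lift p << a *g b >> l).
Proof.
move=> h; exists 0, (lift p << a *g b >> l); rewrite linear0 add0r; split=> // f x.
rewrite ffunE; case: eqP => [->|_]; last by rewrite msupp0.
by move/(fsubsetP msuppU_le); rewrite inE => /eqP->.
Qed.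

Lemma malgUU (a : k) (x y : dual_braid s) : << a *g x >> * << y >> = << a *g mmul x y >> :> A.
Proof. by rewrite malgM_def fgmulUU mulr1. Qed.

Lemma beq_gen (x : seq (refl s)) t : mmul (dbword x) (gen t) = dbword (rcons x t).
Proof. by rewrite -cats1 dbword_cat. Qed.

Lemma higher_divisor (b b' : dual_braid s) t u l : prec t u -> eorth (t :: l) -> eorth (u :: l) ->
  mmul b (gen t) = mmul b' (gen u) ->
  exists v b1, [/\ prec t v, eorth (v :: t :: l) & b = mmul b1 (gen v)].
Proof.
rewrite -(dbword_repr b) -(dbword_repr b') !beq_gen => tu et eu /dbwordP h.
have [v [z [tv ev bz]]] := beq_higher_divisor tu et eu h.
by exists v, (dbword z); split=> //; rewrite beq_gen; apply/dbwordP.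
Qed.

Lemma gen_cancel (b b' : dual_braid s) t : mmul b (gen t) = mmul b' (gen t) -> b = b'.
Proof.
rewrite -(dbword_repr b) -(dbword_repr b') !beq_gen => /dbwordP h.
by apply/dbwordP; apply: beq_cancel h.
Qed.

Lemma reduced_decreasing_cons t u l : prec t u -> eorth (u :: t :: l) ->
  reduced_decreasing (t :: l) -> reduced_decreasing (u :: t :: l).
Proof.
move=> tu eu /andP[dl _]; rewrite /reduced_decreasing eu andbT; apply/andP; split=> //=.
rewrite tu /=; case/andP: dl => /allP lt _; apply/allP => x /lt xt.
exact: prec_trans xt tu.
Qed.

(** If b ⊗ f is not yet the second member of a pair, [higher_divisor] gives b = b1 v with v above f
    and v f a face. In the boundary of b1 ⊗ v f, the first term is b ⊗ f and all others have the
    higher top vertex v, so induction on the top vertex applies. *)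
Lemma reducible_lift p (a : k) (b : dual_braid s) l : reduced_decreasing l -> size l = p ->
  reducible (lift p << a *g b >> l).
Proof.
case: l => [|t l] rl sl.
  have [->|] := eqVneq b mone; first exact: reducible_upper.
  rewrite -(dbword_repr b); case/lastP: (generic_quotient.repr b) => [/eqP//|x u _].
  (* Over the empty face, x u ⊗ ∅ is the boundary of x ⊗ {u}. *)
  exists (lift p.+1 << a *g dbword x >> [:: u]), 0; split; last exact: uppers0.
  rewrite (boundary_lift u) //=; last by rewrite -sl.
  by move: sl => <-; rewrite big_ord1 expr0 scale1r addr0 malgUU beq_gen.
have [r] := ubnP (N - rank_of t); elim: r p a b t l rl sl => // r IH p a b t l rl sl; rewrite ltnS => tr.
have [/reducible_upper//|nu] := pselect (upper b (t :: l)).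
have [u [b' [tu bb eu]]] : exists u b', [/\ prec t u, mmul b (gen t) = mmul b' (gen u) & eorth (u :: l)].
  apply/not_existsP => h; apply: nu => u b' tu bb eu; apply: (h u); by exists b'.
have /andP[dl el] := rl; have [v [b1 [tv ev ->]]] := higher_divisor tu el eu bb.
have rv := reduced_decreasing_cons tv ev rl.
have sv : size (v :: t :: l) = p.+1 by rewrite -sl.
have := boundary_lift t << a *g b1 >> rv sv.
rewrite big_ord_recl /= expr0 scale1r malgUU {1}/del /= => /esym/(canRL (addrK _)) ->.
apply: reducibleD.
  exists (lift p.+1 << a *g b1 >> (v :: t :: l)), 0; rewrite addr0; split=> //.
  exact: uppers0.
apply/reducibleN/reducible_sum => i _; apply: reducible_sign.
rewrite /bump /= malgUU.
have -> : del (1 + i) (v :: t :: l) = v :: del i (t :: l) by [].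
apply: IH.
- by apply: reduced_decreasing_sub rv; apply: (del_sub i.+1 (v :: t :: l)).
- rewrite -[LHS]/(size (del i (t :: l))).+1 size_del sl ?ltn_ord //.
  by case: (p) i => [[]|].
- by have := rank_of_ltN v; move: tv tr; rewrite rank_of_lt; lia.
Qed.

Lemma reducible_all p (v : mon (fc p)) : reducible v.
Proof.
rewrite [v]lift_decomp; apply: reducible_sum => f _.
have lD (a b : A) : lift p (a + b) (fseq f) = lift p a (fseq f) + lift p b (fseq f) := liftD _ _ _ _.
rewrite [v f]monalgE.
have -> : lift p (\sum_(x <- msupp (v f)) << (v f)@_x *g x >>) (fseq f) =
    \sum_(x <- msupp (v f)) lift p << (v f)@_x *g x >> (fseq f).
  by apply: (big_morph (fun a => lift p a (fseq f)) lD); apply: lift0.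
apply: reducible_sum => x _; apply: reducible_lift; first exact: face_seq_reduced.
exact: eqP (face_seq_size prec f).
Qed.

Lemma mcoeff_sign (i : nat) (a : A) m : ((-1) ^+ i * a)@_m = (-1) ^+ i * a@_m.
Proof.
by rewrite -signr_odd -[in RHS]signr_odd; case: odd; rewrite ?expr1 ?expr0 ?mulN1r ?mul1r // mcoeffN.
Qed.

Lemma boundary_coef p (v : mon (fc p.+1)) (f : fc p) m : (bd v f)@_m =
  \sum_(f1 : fc p.+1) \sum_(i < p.+1) (-1) ^+ i *
    (if f == face_del prec f1 i then (v f1 * << gen (face_refl prec f1 i) >>)@_m else 0).
Proof.
rewrite /boundary sum_ffunE raddf_sum; apply: eq_bigr => f1 _.
rewrite sum_ffunE raddf_sum; apply: eq_bigr => i _.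
by rewrite ffunE [LHS]mcoeff_sign /tens ffunE; case: ifP; rewrite ?mcoeff0.
Qed.

Lemma msupp_mul_gen (a : A) (x m : dual_braid s) : (a * << x >>)@_m != 0 ->
  exists2 b, b \in msupp a & m = mmul b x.
Proof.
rewrite mcoeff_neq0 => /msuppM_le[b [y [ba]]]; rewrite msuppU1 inE => /eqP-> ->.
by exists b.
Qed.

Lemma msupp_boundary p (v : mon (fc p.+1)) (f : fc p) m : m \in msupp (bd v f) ->
  exists (f1 : fc p.+1) i b, [/\ f = face_del prec f1 i, b \in msupp (v f1)
    & m = mmul b (gen (face_refl prec f1 i))].
Proof.
rewrite -mcoeff_neq0 boundary_coef => h; apply: contrapT => nex.
case/eqP: h; rewrite big1 // => f1 _; rewrite big1 // => i _.
case: eqP => [fE|_]; last by rewrite mulr0.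
have [->|] := eqVneq (v f1 * << gen (face_refl prec f1 i) >>)@_m 0; first by rewrite mulr0.
by move=> /msupp_mul_gen[b bv mE]; case: nex; exists f1, i, b.
Qed.

(** By right cancellation, no other monomial of [a] contributes. *)
Lemma mcoeff_mul_gen (a : A) b t : (a * << gen t >>)@_(mmul b (gen t)) = a@_b.
Proof.
rewrite malgM_def fgmulgU raddf_sum /=.
under eq_bigr do rewrite mcoeffU mulr1.
have e (x : dual_braid s) : (mmul x (gen t) == mmul b (gen t)) = (x == b).
  by apply/eqP/eqP => [/gen_cancel|->].
under eq_bigr do rewrite e.
have [bs|bs] := boolP (b \in msupp a).
  rewrite (bigD1_seq b) ?fset_uniq //= eqxx big1 ?addr0 // => x /negPf->.
  by rewrite mulr0n.
rewrite big_seq big1 => [|x xa]; first by move: bs; rewrite -mcoeff_eq0 => /eqP.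
by case: eqP xa bs => [->->|]; rewrite ?mulr0n.
Qed.

(** Let f have the lowest top vertex t in the support of v and let b occur with it; then b t ⊗ (f
    minus t) arises only once. Another face that loses a vertex below its top would have a top below
    t, and one that loses a top u ≠ t would contradict [upper] for the smaller of t and u. *)
Lemma uppers_boundary0 p (v : mon (fc p.+1)) : uppers v -> bd v = 0 -> v = 0.
Proof.
move=> vP v0; apply/ffunP => f0; rewrite ffunE; apply/eqP; apply: contraT => f00.
have [t0 _] := face_has_vertex f0 isT; pose top (f : fc p.+1) := nth t0 (fseq f) 0.
have [f fn fmin] := @arg_minnP _ f0 (fun f : fc p.+1 => v f != 0) (fun f : fc p.+1 => rank_of (top f)) f00.
have szf (f : fc p.+1) : size (fseq f) = p.+1 := eqP (face_seq_size prec f).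
have [b bf] : exists b, b \in msupp (v f).
  by apply/fset0Pn; rewrite msupp_eq0.
have topE (h : fc p.+1) : fseq h = top h :: behead (fseq h).
  by rewrite /top; case: (fseq h) (szf h).
pose g := face_del prec f ord0; pose m := mmul b (gen (top f)).
have gE : fseq g = behead (fseq f) by rewrite face_seq_del /del topE /= drop0.
have r0 (h : fc p.+1) : face_refl prec h ord0 = top h by rewrite (face_refl_nth t0) topE.
have key (f1 : fc p.+1) i : g = face_del prec f1 i ->
    (v f1 * << gen (face_refl prec f1 i) >>)@_m != 0 -> f1 = f /\ i = ord0.
  move=> gi /msupp_mul_gen[b1 b1f mE].
  have del_i : behead (fseq f) = del i (fseq f1) by rewrite -gE gi face_seq_del.
  have /andP[df ef] := face_seq_reduced f; have /andP[_ ef1] := face_seq_reduced f1.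
  have [i0|i0] := posnP i; last first.
    move: df; rewrite topE del_i topE; case: (val i) i0 => //= j _ /andP[/andP[+ _] _].
    rewrite rank_of_lt ltnNge fmin //; apply: contraTneq b1f => ->; by rewrite msupp0.
  have iE : i = ord0 by apply: val_inj.
  rewrite iE r0 in mE; have bE : behead (fseq f1) = behead (fseq f).
    by rewrite del_i i0 [in RHS]topE /del /= drop0.
  split=> //; apply: face_seq_inj; rewrite topE [RHS]topE bE; congr (_ :: _).
  apply/eqP; apply: contraT => /prec_total.
  have := vP f b bf; have := vP f1 b1 b1f; move: ef ef1; rewrite (topE f) (topE f1) bE => ef ef1.
  move=> h1 h /orP[lt|lt]; first by case: (h1 _ b lt); rewrite -?mE.
  by case: (h _ b1 lt).
have := congr1 (fun w : mon (fc p) => (w g)@_m) v0; rewrite /= ffunE mcoeff0 boundary_coef.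
pose T (f1 : fc p.+1) i := if g == face_del prec f1 i then (v f1 * << gen (face_refl prec f1 i) >>)@_m else 0.
rewrite (@double_sum_single _ _ _ (fun (f1 : fc p.+1) (i : 'I_p.+1) => (-1) ^+ i * T f1 i) f ord0) => [|f1 i ne].
  by rewrite expr0 mul1r /T eqxx r0 /m mcoeff_mul_gen => /eqP; rewrite mcoeff_eq0 bf.
rewrite /T; case: eqP => [/key e|_]; last by rewrite mulr0.
by have [->|/e//] := eqVneq ((v f1 * << gen (face_refl prec f1 i) >>)@_m) 0; rewrite mulr0.
Qed.

Lemma boundary_exact p (v : mon (fc p.+1)) : bd v = 0 <-> exists w, bd w = v.
Proof.
split=> [v0|[w <-]]; last exact: boundary2.
have [w [v' [vE /uppers_boundary0 v'0]]] := reducible_all v.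
exists w; have v'E : v' = 0 by apply: v'0; move: v0; rewrite vE boundaryD boundary2 add0r.
by rewrite vE v'E addr0.
Qed.

(** * Augmentation and minimality *)

Local Notation eps := (@epsilon n gT s R rG alpha k).

Lemma face0_eq (f : fc 0) : f = face0 s rG alpha.
Proof. by apply: val_inj; case: f => f /= /andP[_ /eqP/cards0_eq]. Qed.

Lemma gen_neq1 (b : dual_braid s) t : mone != mmul b (gen t).
Proof. by apply/negP => /eqP/esym/dbmul_eq1[_ /(congr1 (@dblength n gT s))]; rewrite dblength_word dblength1. Qed.

Lemma epsilon_boundary (v : mon (fc 1)) : eps (bd v) = 0.
Proof.
apply/eqP; apply: contraT; rewrite /epsilon /augmentation mcoeff_neq0.
by move=> /msupp_boundary[f [i [b [_ _ /eqP]]]]; rewrite (negPf (gen_neq1 _ _)).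
Qed.

Lemma epsilon_exact (v : mon (fc 0)) : eps v = 0 <-> exists w, bd w = v.
Proof.
split=> [v0|[w <-]]; last exact: epsilon_boundary.
have [w [v' [vE v'P]]] := reducible_all v; exists w.
have : eps v' = 0.
  by move: v0; rewrite vE /epsilon /augmentation ffunE mcoeffD [X in X + _ = _]epsilon_boundary add0r.
move=> v'0; rewrite vE; suff -> : v' = 0 by rewrite addr0.
apply/ffunP => f; apply/eqP; rewrite ffunE -msupp_eq0; apply: contraT => /fset0Pn[b bf].
have := v'P f b bf; have := face_seq_size prec f; rewrite size_eq0 => /eqP-> /= b1.
by move: bf; rewrite (face0_eq f) b1 -mcoeff_neq0 [_@_ _]v'0 eqxx.
Qed.

Lemma resolution : minimal_graded_free_resolution (@dblength n gT s) n
  (@face_weight n gT s R rG alpha) (@boundary n gT s R rG alpha prec k) eps.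
Proof.
split.
- move=> p np; apply/eqP; rewrite -leqn0 leqNgt; apply/card_gt0P => -[f _].
  have /andP[_ /eorth_ncl[l [_ sl]]] := face_seq_reduced f.
  by move: sl np; rewrite size_cat (eqP (face_seq_size prec f)); clear; lia.
- by move=> u v; rewrite /epsilon /augmentation ffunE mcoeffD.
- by move=> a v; rewrite /epsilon /augmentation ffunE [LHS]rmorphM.
- move=> e v hv e0; apply/eqP; rewrite /epsilon /augmentation; apply: contraT.
  rewrite mcoeff_neq0 => /hv; rewrite /face_weight addn0 => d0.
  have d1 : dblength (dbone s) = e := d0.
  by rewrite -d1 dblength1 in e0.
- move=> p e v hv f m /msupp_boundary[f1 [i [b [_ /hv <- ->]]]].
  have dm : dblength (dbmul b (gen (face_refl prec f1 i))) = (dblength b).+1.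
    by rewrite dblengthM dblength_word addn1.
  by rewrite /face_weight addnS -addSn; congr (_ + _)%N; apply: dm.
- move=> z; exists (tens << z *g mone >> (face0 s rG alpha)).
  by rewrite /epsilon /augmentation ffunE eqxx mcoeffUU.
- exact: epsilon_exact.
- exact: boundary_exact.
- move=> p f g; apply/eqP; apply: contraT; rewrite /augmentation mcoeff_neq0.
  by move=> /msupp_boundary[f1 [i [b [_ _ /eqP]]]]; rewrite (negPf (gen_neq1 _ _)).
Qed.

End Resolution.

Theorem theorem4p4 (n : nat) (gT : finGroupType) (s : 'I_n -> gT)
    (hW : coxeter_system s)
    (R : realType) (rG : mx_representation R [set: gT] n)
    (alpha : 'I_n -> 'cV[R]_n) (hR : reflection_realization s rG alpha)
    (prec : rel (refl s)) (hprec : reflection_ordering rG alpha prec)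
    (hc : c_compatible prec) (k : fieldType) :
  minimal_graded_free_resolution (@dblength n gT s) n
    (@face_weight n gT s R rG alpha)
    (@boundary n gT s R rG alpha prec k)
    (@epsilon n gT s R rG alpha k).
Proof. exact: resolution. Qed.
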